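(* Let $p,q\in\mathbb N$, $n=p+q\ge1$, and $(G,K)=(\mathrm{SO}(2n+1,\mathbb C),S(\mathrm O(2p,\mathbb C)\times\mathrm O(2q+1,\mathbb C)))$. Suppose $\mathcal O=\mathcal O_\gamma$ is the $K$-orbit in $G/B$ indexed by the symmetric $(2p,2q+1)$-clan $\gamma$. Let $k=\lfloor|p-q-\tfrac12|\rfloor$ and $z=-\iota(\gamma)\in\mathcal I(W_n)$. Then $$d_{\mathcal O}(w)=|\{i\in[n]:0<z(i)<i\}|+\ell_0(w)\ \text{ for all }w\in\mathcal A_{\mathrm{Brion}}(\mathcal O)\qquad\text{and}\qquad\mathcal A_{\mathrm{Brion}}(\mathcal O)=\bigsqcup_{M\in\mathsf{NCSP}^{\mathrm{BI}}_k(\gamma)}\mathcal A_k(z,M).$$ Thus $\mathcal A_{\mathrm{Brion}}(\mathcal O)\subseteq\mathcal A_k(z)$, and $\mathcal A_{\mathrm{Brion}}(\mathcal O)=\mathcal A(z)$ if $p-q\in\{0,1\}$ and $\gamma$ is alternating.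
   Context: **Signed permutations and atoms.** $[n]=\{1,\dots,n\}$, $[\pm n]=\{\pm1,\dots,\pm n\}$, $\bar m=-m$. $W_n$ is the group of bijections $w:[\pm n]\to[\pm n]$ with $w(-i)=-w(i)$, a Coxeter group with simple generators $t_0=(-1,1)$, $t_i=(-i,-i-1)(i,i+1)$ ($i\in[n-1]$) and length function $\ell$. For $w\in W_n$, $-w$ is the element $i\mapsto -w(i)$, and $\ell_0(w)=|\{i\in[n]:w(i)<0\}|$. The Demazure product $\circ$ is the unique associative product on $W_n$ with $s\circ s=s$ for simple $s$ and $u\circ v=uv$ if $\ell(uv)=\ell(u)+\ell(v)$. $\mathcal I(W_n)=\{w:w=w^{-1}\}$. For $y,z\in\mathcal I(W_n)$, $\mathcal A(y,z)$ is the (possibly empty) set of minimal-length $w\in W_n$ with $w^{-1}\circ y\circ w=z$; $\mathcal A(z)=\mathcal A(1,z)$; a superscript $-1$ on a set denotes the set of inverses. **Shapes.** Identify $w\in W_n$ with its one-line word $w_1\cdots w_n$. Starting from the word of $w\in\mathcal A(z)^{-1}$, repeatedly delete two consecutive letters $b\,a$ with $b>a$, until the remaining word $\xi(w)$ is increasing. For $w\in\mathcal A(z)^{-1}$, $\xi(w)$ and the set $\mathrm{NDes}(w)$ of deleted pairs $(b,a)$ do not depend on the choices. $\mathrm{NNeg}(w)$ is the set of absolute values of negative letters of $\xi(w)$. The shape $\mathrm{sh}(w)$ is the matching with blocks $\{a,b\},\{-a,-b\}$ for each $(a,-b)\in\mathrm{NDes}(w)$ with $0<a<b$, together with $\{e,-e\}$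 for each $e\in\mathrm{NNeg}(w)$. A block $\{i,-i\}=\{\pm i\}$ is called trivial. A matching (set of disjoint 2-element subsets) in $X=-X\subset[\pm n]$ is perfect if it covers $X$, symmetric if $\{i,j\}\in M\Rightarrow\{-i,-j\}\in M$, and noncrossing if no blocks $\{i,k\},\{j,l\}$ have $i<j<k<l$. **Relative atoms.** For $0\le k\le n$, let $y^{\mathsf{BC}}_{n,k}=(-1,1)(-2,2)\cdots(-k,k)$ and let $g^{\mathsf{BC}}_{n,k}$ have one-line form $\bar k\cdots\bar2\,\bar1\,(k+1)\cdots n$. Put $\mathcal A_k(z)=\mathcal A(y^{\mathsf{BC}}_{n,k},z)$; if $w\in\mathcal A_k(z)^{-1}$ then $w\cdot g^{\mathsf{BC}}_{n,k}\in\mathcal A(z)^{-1}$ and $\mathrm{sh}_k(w):=\mathrm{sh}(w\cdot g^{\mathsf{BC}}_{n,k})$. Let $\mathcal A_k(z,M)=\{w\in\mathcal A_k(z):\mathrm{sh}_k(w^{-1})=M\}$. **Clans.** An $(a,b)$-clan is a sequence of $a+b$ symbols, each an integer or a sign $+$ or $-$, such that each integer that appears appears exactly twice and the number of $+$'s minus the number of $-$'s is $a-b$; two sequences are the same clan if they have the same signs in the same positions and the same pairs of positions with matching integers. $\mathrm{signs}(\gamma)$ is the subsequence of signs. A clan is symmetric if it equals its reversal as a clan. Write a symmetric $(2p,2q+1)$-clan as $\gamma=(c_{-n},\dots,c_{-1},c_0,c_1,\dots,c_n)$; then $c_0$ is a sign. $\iota(\gamma)\in\mathcal I(W_n)$ is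 the involution having $(i,j)$ as a 2-cycle, for distinct $i,j\in[\pm n]$, iff $c_i=c_j\in\mathbb Z$. $\gamma$ is alternating if $\mathrm{signs}(\gamma)$ has no two equal adjacent entries. $\mathsf{NCSP}_k^{\mathrm{BI}}(\gamma)$ is the set of noncrossing symmetric perfect matchings $M$ in $\{i\in[\pm n]:c_i\in\{+,-\}\}$ such that (1) if $\{i,j\}\in M$ and $i+j\ne0$ then $c_i\ne c_j$; and (2) if the trivial blocks of $M$ are $\{\pm i_1\},\dots,\{\pm i_l\}$ with $0<i_1<\dots<i_l$, then $k\le l$ and $c_0\ne c_{i_1}\ne c_{i_2}\ne\cdots\ne c_{i_{l-k}}$ (i.e. consecutive terms in this list differ; the last $k$ trivial blocks are ignored). **Orbits and Brion atoms.** Let $B\supset T$ be a Borel subgroup and torus of $G$, both preserved by the involution of $G$ with fixed-point subgroup $K$; the Weyl group is $W_n$. For a $K$-orbit $\mathcal O$ in $G/B$ and a simple generator $s$ with simple root $\alpha$ and projection $\pi_\alpha:G/B\to G/P_\alpha$ ($P_\alpha$ the minimal parabolic of type $\alpha$ containing $B$), $s\cdot\mathcal O$ is the unique dense $K$-orbit in $\pi_\alpha^{-1}(\pi_\alpha(\mathcal O))$. Form the directed graph on $K$-orbits with edges $\mathcal O\xrightarrow{s}s\cdot\mathcal O$ whenever $s\cdot\mathcal O\ne\mathcal O$; an edge is doubled if $\pi_\alpha$ restricted to $\overline{\mathcal O}$ has degree two. Let $\mathcal O_{\mathrm{dense}}$ be the dense orbit, which is the unique maximum of the resulting (weak) order.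 For a directed path $P=(\mathcal O\xrightarrow{s_1}\mathcal O'\xrightarrow{s_2}\cdots\xrightarrow{s_l}\mathcal O_{\mathrm{dense}})$ let $w(P)=s_l\cdots s_2s_1$ and let $d(P)$ be its number of doubled edges. $\mathcal A_{\mathrm{Brion}}(\mathcal O)$ is the set of all $w(P)$ for paths $P$ from $\mathcal O$ to $\mathcal O_{\mathrm{dense}}$, and $d_{\mathcal O}(w)=d(P)$ for any such $P$ with $w(P)=w$ (independent of $P$). The $K$-orbits are indexed as $\mathcal O_\gamma$ by symmetric $(2p,2q+1)$-clans (standard parametrization of Matsuki–Oshima and Wyser), with $s\cdot\mathcal O_\gamma=\mathcal O_{s\cdot\gamma}$ where: (i) if $s=t_i$, $i\in[n-1]$, and $c_i,c_{i+1}$ are not both signs, or $s=t_0$ and $c_1$ is not a sign, then $s\cdot\gamma$ is the unique symmetric clan with $\iota(s\cdot\gamma)=s\circ\iota(\gamma)\circ s$ and $\mathrm{signs}(s\cdot\gamma)=\mathrm{signs}(\gamma)$; (ii) if $s=t_i$, $i\in[n-1]$, and $c_i,c_{i+1}$ are both signs, then $s\cdot\gamma=\gamma$ if $c_i=c_{i+1}$, and otherwise $s\cdot\gamma$ is obtained by replacing $c_i,c_{i+1}$ by a pair of matching integers and $c_{-i-1},c_{-i}$ by another pair, both new; (iii) if $s=t_0$ and $c_1$ is a sign, then $s\cdot\gamma=\gamma$ if $c_{-1}=c_0=c_1$, and otherwise $s\cdot\gamma$ is obtained by replacing $c_{-1},c_1$ by a new pair of matching integers and reversing the sign $c_0$.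 The edge $\mathcal O_\gamma\xrightarrow{s}\mathcal O_{s\cdot\gamma}$ is doubled iff $s=t_0$ and $c_0\ne c_1$ are opposite signs, or $s=t_i$ for some $i\in[n-1]$ with $c_{-i}=c_{i+1}\in\mathbb Z$ and $c_{-i-1}=c_i\in\mathbb Z$. *)

(* Defs.v *)
From HB Require Import structures.
From mathcomp Require Import all_boot all_order all_algebra all_fingroup.
From mathcomp Require Import zify.
Set Implicit Arguments.
Unset Strict Implicit.
Unset Printing Implicit Defensive.
Import Order.TTheory GRing.Theory Num.Theory.
Local Open Scope ring_scope.

(* The positions -n, ..., -1, 0, 1, ..., n are encoded by the ordinals
   0, ..., 2n in the same order: [lab] is the label of an ordinal and [pos] the
   ordinal of a label (meaningful only for labels in [-n, n]).  Under this
   encoding [rev_ord] is the negation of labels. *)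
Notation idx n := 'I_(n.*2.+1).

Definition lab (n : nat) (i : idx n) : int := (i : nat)%:Z - n%:Z.
Definition pos (n : nat) (x : int) : idx n := inord (absz (x + n%:Z)).

Section SignedPermutations.
Variable n : nat.
Implicit Types (u v w y z : {perm (idx n)}) (s : 'I_n).

Definition negp : {perm (idx n)} := perm (@rev_ord_inj n.*2.+1).

(* W_n: the permutations of {-n, ..., n} that commute with the negation; they
   all fix 0, so this is the group of signed permutations of [+-n]. *)
Definition W : {group {perm (idx n)}} := 'C[negp]%G.

(* Composition of maps, (u o v)(i) = u (v i): the library's product of
   permutations composes in the opposite order. *)
Definition wmul u v : {perm (idx n)} := (v * u)%g.

Definition wopp w : {perm (idx n)} := wmul negp w.

Definition sgen s : {perm (idx n)} :=
  if s == 0 :> nat then tperm (pos n (-1)) (pos n 1)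
  else (tperm (pos n (- (s : nat)%:Z)) (pos n (- s.+1%:Z)) *
        tperm (pos n (s : nat)%:Z) (pos n s.+1%:Z))%g.

(* The word s_1 ... s_l is sent to the product s_l ... s_2 s_1. *)
Definition wprod (t : seq 'I_n) : {perm (idx n)} :=
  foldl (fun w s => wmul (sgen s) w) 1%g t.

(* Smallest number of simple generators with product w; the bound #|W| on the
   search is harmless, since a shortest word has pairwise distinct prefixes. *)
Definition len w : nat :=
  find (fun m => [exists t : m.-tuple 'I_n, wprod t == w]) (iota 0 #|W|.+1).

Definition is_demazure
    (dem : {perm (idx n)} -> {perm (idx n)} -> {perm (idx n)}) : Prop :=
  [/\ {in W &, forall u v, dem u v \in W},
      {in W & &, forall u v w, dem u (dem v w) = dem (dem u v) w},
      forall s, dem (sgen s) (sgen s) = sgen s &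
      {in W &, forall u v, len (wmul u v) = (len u + len v)%N ->
         dem u v = wmul u v}].

Definition atoms (dem : {perm (idx n)} -> {perm (idx n)} -> {perm (idx n)})
    y z : {set {perm (idx n)}} :=
  let sol := [set w in W | dem (dem w^-1%g y) w == z] in
  [set w in sol | [forall v in sol, len w <= len v]%N].

Definition ell0 w : nat := #|[set i : idx n | (0 < lab i) && (lab (w i) < 0)]|.

Definition wword w : seq int :=
  [seq lab (w (pos n (i%:Z))) | i <- iota 1 n].

(* Deletion of consecutive descents, leftmost descent first: [stk] is the
   increasing part already read, in reverse order, and [D] is the list of
   deleted pairs.  The result is (xi, NDes); for inverses of atoms it does not
   depend on the order of the deletions. *)
Fixpoint delete_descents (stk : seq int) (D : seq (int * int)) (u : seq int)
    : seq int * seq (int * int) :=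
  match u with
  | [::] => (rev stk, D)
  | a :: u' =>
    if stk is b :: stk' then
      if a < b then delete_descents stk' ((b, a) :: D) u'
      else delete_descents (a :: stk) D u'
    else delete_descents [:: a] D u'
  end.

Definition xi w : seq int := (delete_descents [::] [::] (wword w)).1.
Definition NDes w : seq (int * int) := (delete_descents [::] [::] (wword w)).2.

(* A pair (a, -b) of NDes is stored as d, so that a = d.1 and b = - d.2. *)
Definition shape w : {set {set (idx n)}} :=
  [set S | has (fun d : int * int => [&& 0 < d.1, d.1 < - d.2 &
                  (S == [set pos n d.1; pos n (- d.2)])
                  || (S == [set pos n (- d.1); pos n d.2])]) (NDes w)]
  :|: [set S | has (fun e => (e < 0) && (S == [set pos n e; pos n (- e)]))
                 (xi w)].

Definition yBC (k : nat) : {perm (idx n)} :=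
  (\prod_(i < k) tperm (pos n (- (i.+1)%:Z)) (pos n (i.+1)%:Z))%g.

(* One-line form -k, ..., -1, k+1, ..., n (see [wword_gBC]). *)
Definition gBC (k : nat) : {perm (idx n)} :=
  (\prod_(i < k) tperm (pos n (i.+1)%:Z) (pos n (i%:Z - k%:Z)))%g.

Definition shapek (k : nat) w : {set {set (idx n)}} := shape (wmul w (gBC k)).

Definition atoms_shape
    (dem : {perm (idx n)} -> {perm (idx n)} -> {perm (idx n)})
    (k : nat) z (M : {set {set (idx n)}}) : {set {perm (idx n)}} :=
  [set w in atoms dem (yBC k) z | shapek k w^-1%g == M].

End SignedPermutations.

Lemma pos_lab (n : nat) : cancel (@lab n) (@pos n).
Proof.
by move=> i; rewrite /pos /lab subrK absz_nat inord_val.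
Qed.

Lemma lab_pos (n : nat) (x : int) :
  - n%:Z <= x -> x <= n%:Z -> lab (pos n x) = x.
Proof.
move=> h1 h2; have h0 : 0 <= x + n%:Z by rewrite -lerBlDr sub0r.
have h : (absz (x + n%:Z)%R < n.*2.+1)%N.
  by rewrite ltnS -lez_nat gez0_abs // -addnn PoszD lerD2r.
by rewrite /lab /pos inordK // gez0_abs // addrK.
Qed.

Lemma gBC_pos (n k m : nat) (x : int) : (m <= k <= n)%N -> 1 <= x -> x <= n%:Z ->
  (\prod_(i < m) tperm (pos n (i.+1)%:Z) (pos n (i%:Z - k%:Z)))%g (pos n x) =
  pos n (if x <= m%:Z then x - (k.+1)%:Z else x).
Proof.
move=> + x1 xn; elim: m => [|m IH] /andP[mk kn].
  by rewrite big_ord0 perm1 ifF //; lia.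
have pN a b : - n%:Z <= a -> a <= n%:Z -> - n%:Z <= b -> b <= n%:Z ->
    a != b -> pos n a != pos n b.
  move=> ? ? ? ? /eqP ab; apply/eqP => /(congr1 (@lab n)).
  by rewrite !lab_pos.
rewrite big_ord_recr permM IH /=; last by rewrite kn ltnW.
have [xm|xm] := leP x m%:Z.
  rewrite ifT; last by lia.
  by rewrite tpermD //; apply: pN; lia.
have [xm1|xm1] := leP x m.+1%:Z.
  have -> : x = m.+1%:Z by lia.
  by rewrite tpermL; congr (pos n _); lia.
by rewrite tpermD //; apply: pN; lia.
Qed.

Lemma wword_gBC (n k : nat) : (k <= n)%N ->
  wword (gBC n k) = [seq - (j%:Z) | j <- rev (iota 1 k)]
                    ++ [seq j%:Z | j <- iota k.+1 (n - k)].
Proof.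
move=> kn; apply: (@eq_from_nth _ 0) => [|i].
  by rewrite size_cat !size_map size_rev !size_iota; lia.
rewrite size_map size_iota => lt_in.
rewrite (nth_map 0%N) ?size_iota // nth_iota // /gBC gBC_pos ?leqnn //; try lia.
rewrite nth_cat size_map size_rev size_iota.
case: ltnP => ik.
  rewrite ifT; last by lia.
  rewrite (nth_map 0%N) ?size_rev ?size_iota // nth_rev ?size_iota //.
  by rewrite nth_iota ?lab_pos; lia.
rewrite ifF; last by lia.
by rewrite (nth_map 0%N) ?size_iota ?nth_iota ?lab_pos; lia.
Qed.

(* A clan on the positions -n, ..., n is a sequence of symbols up to renaming of
   its integers.  It is encoded by the unique representative in which the integer
   at position i is the position of its other occurrence: [inl true] is +,
   [inl false] is - and [inr j] at position i says that c_i = c_j is an integer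
   and i <> j. *)
Notation symbol n := (bool + idx n)%type.

Definition clan_pred n (c : {ffun idx n -> symbol n}) : bool :=
  [forall i, if c i is inr j then (j != i) && (c j == inr i) else true].

Record clan (n : nat) := Clan
  { csym :> {ffun idx n -> symbol n}; csymP : clan_pred csym }.
HB.instance Definition _ n := [isSub for @csym n].
HB.instance Definition _ n := [Finite of clan n by <:].

Section Clans.
Variable n : nat.
Implicit Types (c : clan n) (s : 'I_n).

Definition is_sign (x : symbol n) : bool := if x is inl _ then true else false.

Definition clan_reversal c : {ffun idx n -> symbol n} :=
  [ffun i => match c (rev_ord i) with
             | inl b => inl b
             | inr j => inr (rev_ord j)
             end].

(* Symmetric (2p, 2q+1)-clans. *)
Definition symclan (p q : nat) c : Prop :=
  [/\ clan_reversal c = c,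
      n.*2.+1 = (p.*2 + q.*2.+1)%N &
      #|[set i | c i == inl true]|%:Z - #|[set i | c i == inl false]|%:Z
        = p.*2%:Z - q.*2.+1%:Z].

Definition signs c : seq bool :=
  pmap (fun i => if c i is inl b then Some b else None) (enum (idx n)).

Definition alternating c : bool := sorted (fun a b => a != b) (signs c).

Definition mate c (i : idx n) : idx n := if c i is inr j then j else i.

Lemma mateK c : involutive (mate c).
Proof.
move=> i; rewrite /mate; case E: (c i) => [b|j]; first by rewrite E.
by move/forallP: (csymP c) => /(_ i); rewrite E => /andP[_ /eqP ->].
Qed.

(* The involution iota(c); it also fixes 0 when c is symmetric. *)
Definition clan_inv c : {perm (idx n)} := perm (inv_inj (mateK c)).

Definition perfect_matching (X : {set (idx n)}) (M : {set {set (idx n)}}) :=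
  partition M X && [forall S in M, #|S| == 2%N].

Definition symmetric_matching (M : {set {set (idx n)}}) :=
  forall i j, [set i; j] \in M -> [set rev_ord i; rev_ord j] \in M.

Definition noncrossing (M : {set {set (idx n)}}) :=
  forall i j k l : idx n, [set i; k] \in M -> [set j; l] \in M ->
    ~~ [&& i < j, j < k & k < l]%N.

(* i_1 < ... < i_l, the positive elements of the trivial blocks. *)
Definition trivial_blocks (M : {set {set (idx n)}}) : seq (idx n) :=
  [seq i <- enum (idx n) | (0 < lab i) && ([set i; rev_ord i] \in M)].

Definition NCSP (k : nat) c (M : {set {set (idx n)}}) : Prop :=
  let tb := trivial_blocks M in
  [/\ perfect_matching [set i | (lab i != 0) && is_sign (c i)] M,
      symmetric_matching M,
      noncrossing M,
      (forall i j, [set i; j] \in M -> lab i + lab j != 0 -> c i != c j) &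
      (k <= size tb)%N /\
      path (fun x y => x != y) (c (pos n 0))
        [seq c i | i <- take (size tb - k) tb]].

(* [clan_act dem s c c'] : c' = s . c. *)
Definition clan_act
    (dem : {perm (idx n)} -> {perm (idx n)} -> {perm (idx n)})
    s (c c' : clan n) : Prop :=
  let i := (s : nat)%:Z in
  let c_ x := c (pos n x) in
  let conj_case :=
    clan_inv c' = dem (dem (sgen s) (clan_inv c)) (sgen s)
    /\ signs c' = signs c in
  if i == 0 then
    if is_sign (c_ 1) then
      if (c_ (-1) == c_ 0) && (c_ 0 == c_ 1) then c' = c
      else forall x : idx n, c' x =
        if x == pos n 1 then inr (pos n (-1))
        else if x == pos n (-1) then inr (pos n 1)
        else if x == pos n 0 then
          (if c x is inl b then inl (~~ b) else c x)
        else c x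
    else conj_case
  else
    if is_sign (c_ i) && is_sign (c_ (i + 1)) then
      if c_ i == c_ (i + 1) then c' = c
      else forall x : idx n, c' x =
        if x == pos n i then inr (pos n (i + 1))
        else if x == pos n (i + 1) then inr (pos n i)
        else if x == pos n (- (i + 1)) then inr (pos n (- i))
        else if x == pos n (- i) then inr (pos n (- (i + 1)))
        else c x
    else conj_case.

Definition clan_doubled s c : bool :=
  let i := (s : nat)%:Z in
  let c_ x := c (pos n x) in
  if i == 0 then [&& is_sign (c_ 0), is_sign (c_ 1) & c_ 0 != c_ 1]
  else (c_ (- i) == inr (pos n (i + 1))) && (c_ (- (i + 1)) == inr (pos n i)).

End Clans.

From mathcomp Require Import boolp classical_sets reals complex.
From mathcomp Require mpoly.
Local Open Scope classical_set_scope.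

Section Flags.
Variables (R : realType) (n p : nat).
Let C : fieldType := R[i].
Let Mat := 'M[C]_(n.*2.+1).
Implicit Types (s : 'I_n) (X Y : set Mat) (O : set (set Mat)).

(* SO(2n+1, C) is taken with respect to the symmetric form with antidiagonal Gram
   matrix, so that its upper triangular elements form a Borel subgroup. *)
Definition antidiag : Mat := \matrix_(i, j) (j == rev_ord i)%:R.

Definition SO : set Mat :=
  [set g | g^T *m antidiag *m g = antidiag /\ \det g = 1].

(* The involution of G is conjugation by the diagonal matrix with entry 1 at the
   2p positions of label +-1, ..., +-p and -1 at the other ones.  For n = p + q
   its fixed points are the elements of G that preserve the nondegenerate
   subspaces of dimensions 2p and 2q+1 given by the eigenspaces of this matrix,
   that is, S(O(2p) x O(2q+1)). *)
Definition sign_mx : Mat :=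
  diag_mx (\row_i if (lab i != 0) && (`|lab i| <= p%:Z) then 1 else -1).

Definition theta (g : Mat) : Mat := sign_mx *m g *m invmx sign_mx.

Definition KSO : set Mat := [set g | SO g /\ theta g = g].

Definition borel : set Mat := [set g | SO g /\ is_trig_mx g^T].

(* A representative in SO of the Weyl group element t_i: its permutation matrix,
   negated when this has determinant -1. *)
Definition sgen_mx s : Mat := (-1) ^+ odd_perm (sgen s) *: perm_mx (sgen s).

(* B u B t_i B *)
Definition parabolic s : set Mat :=
  borel `|`
  [set g | exists a b, [/\ borel a, borel b & g = a *m sgen_mx s *m b]].

(* Points of G/B and G/P are left cosets, as sets of matrices. *)
Definition flags : set (set Mat) :=
  [set X | exists2 g, SO g & X = [set g *m b | b in borel]].

Definition proj s X : set Mat :=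
  [set h | exists g a, [/\ X g, parabolic s a & h = g *m a]].

Definition Korbit O : Prop :=
  exists2 X, flags X & O = [set [set k *m g | g in X] | k in KSO].

Definition evalmx (f : mpoly.mpoly (n.*2.+1 * n.*2.+1) C) (g : Mat) : C :=
  mpoly.meval (fun i => mxvec g 0 i) f.

(* Zariski closure of a set of left cosets (of B or of a parabolic): the
   topology of G/H is the quotient of the topology of G, so a coset is in the
   closure when every polynomial in the matrix entries that vanishes on all
   the cosets of the set vanishes on it. *)
Definition zclosure O : set (set Mat) :=
  [set Y | forall f, (forall X g, O X -> X g -> evalmx f g = 0) ->
                     forall g, Y g -> evalmx f g = 0].

Definition saturation s O : set (set Mat) :=
  [set Y | flags Y /\ exists2 X, O X & proj s Y = proj s X].

(* [orbit_act s O O'] : O' = s . O. *)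
Definition orbit_act s O O' : Prop :=
  [/\ Korbit O', O' `<=` saturation s O & saturation s O `<=` zclosure O'].

Definition dense_orbit O : Prop := Korbit O /\ flags `<=` zclosure O.

Definition edge s O O' : Prop := orbit_act s O O' /\ O' <> O.

(* The restriction of pi_s to the closure Z of O has degree two: all the fibres
   over a dense open subset U of its image have two elements. *)
Definition degree_two s O : Prop :=
  let Z := flags `&` zclosure O in
  let piZ := [set proj s X | X in Z] in
  exists U : set (set Mat),
    [/\ U `<=` piZ,
        U `&` zclosure (piZ `\` U) = set0,
        piZ `<=` zclosure U &
        forall Y, U Y -> exists X1 X2, X1 <> X2 /\
          [set X | Z X /\ proj s X = Y] = [set X1; X2]].

(* Directed paths from an orbit to D, with labels t and d doubled edges. *)
Inductive brion_path (D : set (set Mat)) :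
    set (set Mat) -> seq 'I_n -> nat -> Prop :=
| brion_nil : brion_path D D [::] 0
| brion_single s O O' t d :
    edge s O O' -> ~ degree_two s O -> brion_path D O' t d ->
    brion_path D O (s :: t) d
| brion_double s O O' t d :
    edge s O O' -> degree_two s O -> brion_path D O' t d ->
    brion_path D O (s :: t) d.+1.

Definition brion_atoms D O : set {perm (idx n)} :=
  [set w | exists t d, brion_path D O t d /\ wprod t = w].

(* [brion_degree D O w d] : d is a value of d_O(w). *)
Definition brion_degree D O (w : {perm (idx n)}) (d : nat) : Prop :=
  exists2 t, brion_path D O t d & wprod t = w.

End Flags.

(* [orb] is an indexing of the K-orbits by the symmetric (2p, 2q+1)-clans for
   which the weak order and the doubled edges are given by the rules for clans,
   as is known for the parametrization of Matsuki-Oshima and Wyser.  As [orb_act]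
   is an equivalence, it includes the uniqueness of the orbit s . O. *)
Record clan_indexing (R : realType) (n p q : nat)
    (dem : {perm (idx n)} -> {perm (idx n)} -> {perm (idx n)})
    (orb : clan n -> set (set 'M[R[i]]_(n.*2.+1))) : Prop :=
  { orb_Korbit : forall c, symclan p q c -> Korbit p (orb c);
    orb_inj : forall c c', symclan p q c -> symclan p q c' ->
      orb c = orb c' -> c = c';
    orb_surj : forall O, Korbit p O -> exists2 c, symclan p q c & orb c = O;
    orb_act : forall s c c', symclan p q c -> symclan p q c' ->
      (orbit_act p s (orb c) (orb c') <-> clan_act dem s c c');
    orb_doubled : forall s c c', symclan p q c -> symclan p q c' ->
      clan_act dem s c c' -> c' <> c ->
      (degree_two s (orb c) <-> clan_doubled s c) }.

(* Main.v *)
(* The hypothesis [orb_indexing] turns K-orbits into clans.  If z = -iota(c), then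
   going up from c in the weak order on clans is going down from z in the weak
   order on involutions; a path from c to the dense clan, read backwards, is a
   chain from y_k to z, and such chains are the reduced words of the elements of
   A_k(z).  A chain lifts to a path of clans iff the two signs differ at every step
   that joins two signs ([allowed]).

   One step of a chain multiplies u = w^-1 g_k by a generator s on the left, which
   relabels the deletions of descents of u; the only other change is that i+1, i
   becomes a deleted pair when both are fixed points.  So a step relabels the shape,
   leaves it unchanged, adds {i,i+1} and {-i,-i-1}, or adds {-1,1}; in the last two
   cases the new shape lies in NCSP_k(c) iff the two signs of c differ and the old
   one lies in NCSP_k(s.c).  Induction along the chain gives the decomposition, and
   the degree is counted along the same chain. *)
Require Import Defs.
From mathcomp Require Import all_boot all_order all_algebra all_fingroup.
From mathcomp Require Import boolp classical_sets reals complex.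
From mathcomp Require Import zify lra.
Set Implicit Arguments.
Unset Strict Implicit.
Unset Printing Implicit Defensive.
Import Order.TTheory GRing.Theory Num.Theory.
Local Open Scope ring_scope.

(** The obstacle is that t_i may turn an ascent of u into a descent, or back, and so upset the whole
    sequence of deletions. The remedy is an invariant tying u to z: whatever deletions are chosen,
    each deleted pair is a 2-cycle of z or consists of two points negated by z, and each surviving
    letter is a positive fixed point or a negative negated point ([goodword]). If z i < z (i+1),
    neighbouring letters of such a word change their order under t_i only when i and i+1 are fixed.

    That chains are reduced words comes from a rank: half the sum of length and absolute length
    grows by one at each strict step, so no word leads from y to z with fewer letters.

    The number k is found by counting: the dense clan has equal signs on [-k, k] and no others,
    whence 2k + 1 = |2p - 2q - 1|. The shape at y_k consists of k trivial blocks. A later block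
    {-1,1} comes in front of all older ones and relabelling keeps their order, so the k blocks
    ignored by condition (2) are the initial ones, and each link of its list belongs to the step
    that created a block. *)

(** * Deleting descents *)

(* [red u D x]: some sequence of deletions takes u to x, with deleted pairs D.
   Every statement below holds for all such sequences, so that it need not be
   shown that D and x are independent of the choices. *)
Inductive red : seq int -> seq (int * int) -> seq int -> Prop :=
| red_nil x : sorted <=%R x -> red x [::] x
| red_step L R b a D x :
    a < b -> red (L ++ R) D x -> red (L ++ b :: a :: R) ((b, a) :: D) x.

Lemma sorted_adjP (u : seq int) :
  (forall L R x y, u = L ++ x :: y :: R -> x <= y) <-> sorted <=%R u.
Proof.
split=> [|u_s L R x y uE]; last first.
  move: u_s; rewrite uE => /cat_sorted2 [_] /=.
  by case/andP.
elim: u => [//|x [//|y u] IH] h /=.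
rewrite (h [::] u) //=; apply: IH => L R a b E.
by apply: (h (x :: L) R); rewrite E.
Qed.

(** The current word is [rev stk ++ u]; as the stack is increasing, its first descent can only be at
    the top of the stack. Deleted pairs are accumulated in front of [D], hence [catrev]. *)
Lemma greedy_red stk D u : sorted <=%R (rev stk) ->
  exists D', red (rev stk ++ u) D' (delete_descents stk D u).1 /\
    (delete_descents stk D u).2 = catrev D' D.
Proof.
elim: u stk D => [|a u IH] stk D s_stk /=.
  by exists [::]; rewrite cats0; split=> //; apply: red_nil.
case: stk s_stk => [|b stk] s_stk.
  by have [D' [? ?]] := IH [:: a] D erefl; exists D'.
case: ltP => ab.
  have s' : sorted <=%R (rev stk).
    by move: s_stk; rewrite rev_cons -cats1 => /cat_sorted2[].
  have [D' [h1 h2]] := IH stk ((b, a) :: D) s'.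
  exists ((b, a) :: D'); split=> //.
  by rewrite rev_cons cat_rcons; apply: red_step.
have s' : sorted <=%R (rev [:: a, b & stk]).
  move: s_stk; rewrite !rev_cons; case: (rev stk) => [|e r] /=; first by rewrite ab.
  by rewrite !rcons_path last_rcons ab andbT.
have [D' [h1 h2]] := IH [:: a, b & stk] D s'.
by exists D'; split=> //; move: h1; rewrite [rev (a :: _)]rev_cons cat_rcons.
Qed.

Lemma red_exists u : exists D x, red u D x.
Proof. by have [D' [h _]] := @greedy_red [::] [::] u erefl; exists D', (delete_descents [::] [::] u).1. Qed.

Lemma red_sorted u D x : red u D x -> sorted <=%R x.
Proof. by elim. Qed.

Lemma red_mem u D x : red u D x -> forall e,
  e \in u -> (e \in x) || has (fun d => (e == d.1) || (e == d.2)) D.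
Proof.
elim=> [y ys e -> //|L R b a {}D {}x ab _ IH e].
rewrite mem_cat !inE /= => eu.
case/or4P: eu => [eL|/eqP->|/eqP->|eR]; rewrite ?eqxx ?orbT //.
  have /orP[->|->] : (e \in x) || has (fun d => (e == d.1) || (e == d.2)) D.
  - by apply: IH; rewrite mem_cat eL.
  - by [].
  - by rewrite !orbT.
have /orP[->|->] : (e \in x) || has (fun d => (e == d.1) || (e == d.2)) D.
- by apply: IH; rewrite mem_cat eR orbT.
- by [].
- by rewrite !orbT.
Qed.

Lemma red_cat u D x : red u D x -> forall P S E y,
  red (P ++ x ++ S) E y -> red (P ++ u ++ S) (D ++ E) y.
Proof.
elim=> [//|L R b a {}D {}x ab _ IH] P S E y h /=.
have := IH P S E y h; rewrite -!catA /= => h'.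
by rewrite catA; apply: red_step => //; rewrite -catA.
Qed.

Lemma red_sub u D x : red u D x -> subseq x u.
Proof.
elim=> [y _|L R b a {}D {}x ab _ IH]; first exact: subseq_refl.
apply: subseq_trans IH _; apply: cat_subseq; first exact: subseq_refl.
exact: subseq_trans (subseq_cons R a) (subseq_cons _ b).
Qed.

(** * Words whose reductions are governed by an involution *)

Section Good.
Variable z : int -> int.

(* The two kinds of pairs deleted from the inverse of an atom of z: 2-cycles of
   z, and pairs of points negated by z. *)
Definition goodpair (d : int * int) : bool :=
  (0 < d.1) && (((`|d.2| < d.1) && (z d.2 == d.1)) ||
    [&& d.1 < - d.2, z d.1 == - d.1 & z d.2 == - d.2]).

Definition goodlet (e : int) : bool :=
  ((0 < e) && (z e == e)) || ((e < 0) && (z e == - e)).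

(** Quantifying over all reductions leaves the first deletion free and lets goodness pass to every
    partial reduction. *)
Definition goodword (u : seq int) : Prop :=
  forall D x, red u D x -> all goodpair D /\ all goodlet x.

Lemma goodword_cat P u S D x : goodword (P ++ u ++ S) -> red u D x ->
  goodword (P ++ x ++ S).
Proof.
move=> h r E y r2; have /h := red_cat r r2.
by rewrite all_cat => -[/andP[_ ->]].
Qed.

Lemma goodword_step L R b a : goodword (L ++ b :: a :: R) -> a < b ->
  goodpair (b, a) /\ goodword (L ++ R).
Proof.
move=> h ab; split=> [|E y r].
  have [D [x r]] := red_exists (L ++ R).
  by have [] := h _ _ (red_step ab r); case/andP.
by have [/andP[_ hE] hy] := h _ _ (red_step ab r).
Qed.

Lemma goodword_sorted u : goodword u -> sorted <=%R u -> all goodlet u.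
Proof. by move=> h us; have [] := h _ _ (red_nil us). Qed.

(** Reducing the two sides of a factor separately puts it between increasing words, where any
    further descent has to involve a letter of the factor or the junction next to it. *)
Lemma goodword_context L m R : goodword (L ++ m ++ R) ->
  exists L' R', [/\ sorted <=%R L', sorted <=%R R', subseq L' L, subseq R' R &
    goodword (L' ++ m ++ R')].
Proof.
move=> h; have [D [L' r]] := red_exists L; have [D2 [R' r2]] := red_exists R.
exists L', R'; rewrite (red_sorted r) (red_sorted r2) (red_sub r) (red_sub r2).
split=> //.
have h1 := @goodword_cat [::] L _ _ _ h r.
by move: h1; rewrite /= catA -[R]cats0 => h1; have := goodword_cat h1 r2;
  rewrite cats0 -catA.
Qed.
End Good.

(** The generator t_i acting on all integers, free of [n], so that words are handled without range
    conditions. *)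
Definition sig (i : nat) (x : int) : int :=
  if i == 0 then (if `|x| == 1 then - x else x)
  else if x == i then i.+1%:Z else if x == i.+1 then i%:Z
  else if x == - i%:Z then - i.+1%:Z else if x == - i.+1%:Z then - i%:Z else x.

Lemma sigE i x : let y := sig i x in
  (i = 0%N /\ ((x = 1 /\ y = -1) \/ (x = -1 /\ y = 1) \/ (x <> 1 /\ x <> -1 /\ y = x)))
  \/ ((0 < i)%N /\ ((x = i /\ y = i.+1) \/ (x = i.+1 /\ y = i) \/
     (x = - i%:Z /\ y = - i.+1%:Z) \/ (x = - i.+1%:Z /\ y = - i%:Z) \/
     (x <> i /\ x <> i.+1 /\ x <> - i%:Z /\ x <> - i.+1%:Z /\ y = x))).
Proof.
rewrite /sig /=; case: i => [|i].
  left; split=> //; rewrite eqxx.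
  by case: eqP; lia.
right; split=> //.
by rewrite /=; do ![case: eqP => ?]; lia.
Qed.

Lemma sigK i : involutive (sig i).
Proof. by move=> x; have := sigE i (sig i x); have := sigE i x; lia. Qed.

Lemma sigN i x : sig i (- x) = - sig i x.
Proof. by have := sigE i x; have := sigE i (- x); lia. Qed.

Ltac case_sig i x :=
  let H := fresh in have H := sigE i x; cbv zeta in H;
  repeat match type of H with _ \/ _ => destruct H as [H|H] end;
  repeat match type of H with _ /\ _ =>
    let H1 := fresh in destruct H as [H1 H] end.

Lemma sig_inversion i x y : x < y -> sig i y <= sig i x ->
  (x = i /\ y = i.+1) \/ (x = - i.+1%:Z /\ y = - i%:Z) \/
  (i = 0%N /\ (x = - 1%N%:Z /\ y = 1%N%:Z)).
Proof. by move=> lt le; case_sig i x; case_sig i y; lia. Qed.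

Lemma sorted_cat_le (L R : seq int) : sorted <=%R L -> sorted <=%R R ->
  (forall a b, a \in L -> b \in R -> a <= b) -> sorted <=%R (L ++ R).
Proof.
rewrite !(sorted_pairwise le_trans) pairwise_cat => -> -> h.
by rewrite !andbT; apply/allrelP => a b; apply: h.
Qed.

Lemma sorted_rcons_le (L : seq int) b : sorted <=%R (rcons L b) ->
  sorted <=%R L /\ forall e, e \in L -> e <= b.
Proof.
rewrite !(sorted_pairwise le_trans) -cats1 pairwise_cat.
case/and3P=> /allrelP h -> _; split=> // e eL; apply: h => //; exact: mem_head.
Qed.

Lemma sorted_cons_le (R : seq int) a : sorted <=%R (a :: R) ->
  sorted <=%R R /\ forall e, e \in R -> a <= e.
Proof.
rewrite !(sorted_pairwise le_trans) /= => /andP[/allP h ->].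
by split=> // e /h.
Qed.

(** * Adjacent letters i, i+1 and -(i+1), -i in good words *)

Section Adjacent.
Variables (z : int -> int) (i : nat).
Hypotheses (zN : forall x, z (- x) = - z x) (zK : involutive z) (i_gt0 : (0 < i)%N).
Hypothesis z_asc : z i < z i.+1.

Definition avoids (u : seq int) :=
  forall e, e \in u -> `|e| != i%:Z /\ `|e| != i.+1%:Z.

Lemma avoids_sub u v : subseq u v -> avoids v -> avoids u.
Proof. by move=> /mem_subseq s h e /s /h. Qed.

Lemma goodpairE b a : goodpair z (b, a) ->
  0 < b /\ (`|a| < b /\ z a = b /\ z b = a \/ b < - a /\ z b = - b /\ z a = - a).
Proof.
case/andP=> /= b0 /orP[/andP[ab /eqP za]|/and3P[h /eqP h1 /eqP h2]]; split=> //.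
  by left; split=> //; split=> //; rewrite -za zK.
by right.
Qed.

Lemma goodletE e : goodlet z e -> 0 < e /\ z e = e \/ e < 0 /\ z e = - e.
Proof. by case/orP=> /andP[? /eqP ?]; [left|right]. Qed.

Lemma goodword_fst L R b a : goodword z (rcons L b ++ a :: R) -> a < b ->
  goodpair z (b, a) /\ goodword z (L ++ R).
Proof. by rewrite cat_rcons; apply: goodword_step. Qed.

(** The only possible descent is between [x] and the head of [R]; without it the word is increasing
    and all of its letters survive. *)
Lemma goodword_front L x R : goodword z (L ++ x :: R) ->
  sorted <=%R L -> sorted <=%R R -> (forall e, e \in L -> e <= x) ->
  (exists a R', [/\ R = a :: R', a < x, goodpair z (x, a) & goodword z (L ++ R')])
  \/ (forall e, e \in L ++ x :: R -> goodlet z e).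
Proof.
move=> h Ls Rs Lx.
have [xR|] := boolP (all (>= x) R); last first.
  case: R h Rs => [//|a R] h Rs; have [_ aR] := sorted_cons_le Rs.
  have [ax _|xa] := ltP a x.
    by left; exists a, R; have [? ?] := goodword_step h ax.
  case/negP; apply/allP => e; rewrite inE => /orP[/eqP->//|/aR].
  exact: le_trans.
right; apply/allP; apply: goodword_sorted => //; apply: sorted_cat_le => //.
  by rewrite /= (path_sortedE le_trans) xR.
move=> a b /Lx ax; rewrite inE => /orP[/eqP->//|/(allP xR)].
exact: le_trans.
Qed.

(* By [goodword_front], reducing L and R first forces the pairs of i and i+1, and
   their values under z violate [z_asc] unless both letters survive. *)
Lemma goodword_adj_pos L R : goodword z (L ++ i%:Z :: i.+1%:Z :: R) ->
  avoids (L ++ R) -> z i = i /\ z i.+1 = i.+1.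
Proof.
move=> h av.
have {h av} [L' [R' [Ls Rs h av]]] : exists L' R', [/\ sorted <=%R L',
    sorted <=%R R', goodword z (L' ++ i%:Z :: i.+1%:Z :: R') & avoids (L' ++ R')].
  have [L' [R' [? ? sL sR ?]]] := goodword_context (m := [:: i%:Z; i.+1%:Z]) h.
  by exists L', R'; split=> //; apply: avoids_sub av; apply: cat_subseq.
clear L R.
have [Li|] := boolP (all (<= i%:Z) L').
  have := @goodword_front (rcons L' i%:Z) i.+1%:Z R'; rewrite cat_rcons.
  case=> // [||[a [R3 [E ai ga gw]]]|gl].
  - rewrite -cats1; apply: sorted_cat_le => // e f /(allP Li) /= ei.
    by rewrite inE => /eqP->.
  - by move=> e; rewrite mem_rcons inE => /orP[/eqP->|/(allP Li) /=]; lia.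
  - move: gw; rewrite cat_rcons => gw.
    have [aR lR] : sorted <=%R R3 /\ forall e, e \in R3 -> a <= e.
      by apply: sorted_cons_le; rewrite -E.
    have := goodpairE ga.
    case: (goodword_front gw) => // [e /(allP Li)//|[a2 [R2 [E2 ? ga2 _]]]|gl].
      by have := goodpairE ga2; have := lR a2; rewrite E2 mem_head => /(_ isT); lia.
    by have := gl i; rewrite mem_cat mem_head orbT => /(_ isT) /goodletE; lia.
  have := gl i; have := gl i.+1%:Z; rewrite !mem_cat !inE !eqxx !orbT.
  by move=> /(_ isT) /goodletE ? /(_ isT) /goodletE; lia.
case/lastP: L' Ls h av => [//|L b] Ls h av.
have {Ls} [Ls Lb] := sorted_rcons_le Ls => Lbi.
have bi : i.+1%:Z < b.
  have := av b; rewrite mem_cat mem_rcons mem_head => /(_ isT).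
  move/allPn: Lbi => [e]; rewrite mem_rcons inE => /orP[/eqP->/=|/Lb ? /=]; lia.
have [/goodpairE gb {}h] : goodpair z (b, i%:Z) /\ goodword z (L ++ i.+1%:Z :: R').
  by apply: goodword_fst h _; lia.
have [Li|] := boolP (all (<= i.+1%:Z) L).
  case: (goodword_front h) => // [e /(allP Li)//|[a [R3 [E ai /goodpairE ga gw]]]|gl].
    by lia.
  by have := gl i.+1%:Z; rewrite mem_cat mem_head orbT => /(_ isT) /goodletE; lia.
case/lastP: L Ls Lb h {av Lbi} => [//|L b2] Ls Lb h.
have {Ls} [Ls Lb2] := sorted_rcons_le Ls => Lbi.
have bi2 : i.+1%:Z < b2.
  move/allPn: Lbi => [e]; rewrite mem_rcons inE => /orP[/eqP->/=|/Lb2 ? /=]; lia.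
have [/goodpairE gb2 _] := goodword_fst h bi2.
by have := Lb b2; rewrite mem_rcons mem_head => /(_ isT); lia.
Qed.

(** A negative letter is never the larger one of a good pair, so each of the two letters survives or
    is paired with a letter on its left. Since the left part is increasing, the partner of the first
    letter is the larger one, and in every case z (i+1) < z i, against [z_asc]. *)
Lemma goodword_adj_neg L R : ~ goodword z (L ++ - i.+1%:Z :: - i%:Z :: R).
Proof.
move=> h.
have {h} [L' [R' [Ls Rs _ _ h]]] := goodword_context (m := [:: - i.+1%:Z; - i%:Z]) h.
have neg x a : x < 0 -> ~ goodpair z (x, a) by move=> ? /goodpairE; lia.
clear L R.
have [Li|] := boolP (all (<= - i.+1%:Z) L').
  have := @goodword_front (rcons L' (- i.+1%:Z)) (- i%:Z) R'; rewrite cat_rcons.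
  case=> // [||[a [R2 [_ _ ga _]]]|gl].
  - rewrite -cats1; apply: sorted_cat_le => // e f /(allP Li) /= ei.
    by rewrite inE => /eqP->.
  - by move=> e; rewrite mem_rcons inE => /orP[/eqP->|/(allP Li) /=]; lia.
  - by apply: neg ga; lia.
  have := gl (- i%:Z); have := gl (- i.+1%:Z); rewrite !mem_cat !inE !eqxx !orbT.
  by move=> /(_ isT) /goodletE ? /(_ isT) /goodletE; have := zN i; have := zN i.+1; lia.
case/lastP: L' Ls h => [//|L2 b] Ls h.
have {Ls} [Ls Lb] := sorted_rcons_le Ls => Lbi.
have bi : - i.+1%:Z < b.
  move/allPn: Lbi => [e]; rewrite mem_rcons inE => /orP[/eqP->/=|/Lb ? /=]; lia.
have [/goodpairE gb {}h] := goodword_fst h bi.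
have [Li|] := boolP (all (<= - i%:Z) L2).
  case: (goodword_front h) => // [e /(allP Li)//|[a [R2 [_ _ ga _]]]|gl].
    by apply: neg ga; lia.
  have := gl (- i%:Z); rewrite mem_cat mem_head orbT => /(_ isT) /goodletE.
  by have := zN i; have := zN i.+1; lia.
case/lastP: L2 Ls Lb h {Lbi} => [//|L2 b2] Ls Lb h.
have {Ls} [Ls Lb2] := sorted_rcons_le Ls => Lbi.
have bi2 : - i%:Z < b2.
  move/allPn: Lbi => [e]; rewrite mem_rcons inE => /orP[/eqP->/=|/Lb2 ? /=]; lia.
have [/goodpairE gb2 _] := goodword_fst h bi2.
have := Lb b2; rewrite mem_rcons mem_head => /(_ isT).
by have := zN i; have := zN i.+1; lia.
Qed.

End Adjacent.

(** Holds for words of signed permutations: the absolute values are distinct, and the 0 in front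
    excludes the letter 0. *)
Definition regular (u : seq int) := uniq (0%N :: [seq absz x | x <- u]).

Lemma regular_sub u v : subseq u v -> regular v -> regular u.
Proof.
move=> s; apply: subseq_uniq => /=.
exact: (map_subseq (fun x : int => absz x)).
Qed.

Lemma regular_cat2 L x y R : regular (L ++ x :: y :: R) ->
  [/\ x != 0, y != 0, `|x| != `|y| &
      forall e, e \in L ++ R -> [/\ e != 0, `|e| != `|x| & `|e| != `|y|]].
Proof.
move=> reg; have : regular (x :: y :: L ++ R).
  rewrite /regular (perm_uniq (s2 := 0%N :: map absz (L ++ x :: y :: R))) //.
  rewrite perm_cons; apply: perm_map; rewrite -(cat1s x) -(cat1s y) catA perm_catC.
  by rewrite -catA perm_cat2l perm_catC.
rewrite /regular /= !inE !negb_or => /and4P[/and3P[x0 y0 u0] /andP[xy xu] yu _].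
split; [lia|lia|lia|] => e eu.
have ae : absz e \in map absz (L ++ R) by apply: map_f.
have e0 : absz e <> 0%N by move=> E; rewrite E in ae; rewrite ae in u0.
have ex : absz e <> absz x by move=> E; rewrite E in ae; rewrite ae in xu.
have ey : absz e <> absz y by move=> E; rewrite E in ae; rewrite ae in yu.
by split; lia.
Qed.

Lemma red_regular u D x : red u D x -> regular u ->
  forall d, d \in D -> [/\ d.1 != 0, d.2 != 0 & `|d.1| != `|d.2| ].
Proof.
elim=> [//|L R b a {}D {}x ab _ IH reg] d; rewrite inE => /orP[/eqP->|]; last first.
  apply: IH; apply: regular_sub reg; apply: cat_subseq => //.
  exact: subseq_trans (subseq_cons R a) (subseq_cons _ b).
by have [? ? ? _] := regular_cat2 reg.
Qed.

Definition sig2 (i : nat) (d : int * int) := (sig i d.1, sig i d.2).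

(** * Relabelling a reduction by t_i *)

Section Step.
Variables (z : int -> int) (i : nat).
Hypotheses (zN : forall x, z (- x) = - z x) (zK : involutive z).
Hypothesis z_asc : z i < z i.+1.

Definition fix2 := [&& (0 < i)%N, z i == i & z i.+1 == i.+1].

(** By [sig_inversion] few pairs of values are reversed by t_i. The ascents among them are excluded
    by the two adjacency lemmas; a descent among them would be a good pair and contradict [z_asc].
    For i = 0 the reversed pairs contain 0 or two opposite letters, which [regular] forbids. *)
Lemma sig_adjacent L x y R : ~~ fix2 -> goodword z (L ++ x :: y :: R) ->
  regular (L ++ x :: y :: R) -> (sig i y < sig i x) = (y < x).
Proof.
move=> nf h reg; have [x0 y0 xy av] := regular_cat2 reg.
have [i0|i_gt0] := posnP i; first by have := sigE i x; have := sigE i y; lia.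
have ndes b a : b :: a :: R = x :: y :: R -> a < b -> goodpair z (b, a).
  by case=> -> -> ab; have [] := goodword_step h ab.
have [|[|[|]]] : (sig i y < sig i x) = (y < x) \/ x = i /\ y = i.+1 \/
   x = - i.+1%:Z /\ y = - i%:Z \/ y < x /\ (x = i.+1 /\ y = i \/
   x = - i%:Z /\ y = - i.+1%:Z).
  have [lt1|le1] := ltP (sig i y) (sig i x); have [lt2|le2] := ltP y x; try by left.
    have lt : x < y by clear -le2 xy; lia.
    by right; have := sig_inversion lt (ltW lt1); clear -i_gt0; lia.
  by right; have := sig_inversion lt2 le1; clear -lt2 i_gt0; lia.
- by [].
- case=> E E'; subst x y; case/negP: nf; rewrite /fix2 i_gt0.
  have [|-> ->] := goodword_adj_pos zK i_gt0 z_asc h; rewrite ?eqxx // => e /av[]; lia.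
- by case=> E E'; subst x y; case: (goodword_adj_neg zN zK i_gt0 z_asc h).
- case=> yx E; have /(goodpairE zK) := ndes x y erefl yx.
  by move: yx; case: E => -[-> ->]; have := zN i; lia.
Qed.

(** Goodness is assumed of the relabelled word: in a chain [map (sig i) v] is the word before the
    step, whose invariant is known, while that of [v] is derived from this lemma. *)
Lemma red_sig v D x : ~~ fix2 -> red v D x -> goodword z (map (sig i) v) ->
  regular (map (sig i) v) ->
  red (map (sig i) v) (map (sig2 i) D) (map (sig i) x).
Proof.
move=> nf; elim=> [{}x xs h reg|L R b a {}D {}x ab r IH].
  apply: red_nil; apply/sorted_adjP => L R a b E.
  rewrite leNgt -(sig_adjacent nf (L := L) (R := R)) -?E // -leNgt.
  have {}E : x = map (sig i) L ++ sig i a :: sig i b :: map (sig i) R.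
    by rewrite -[x](mapK (sigK i)) E map_cat.
  by move/sorted_adjP: xs; apply; exact: E.
rewrite !map_cat /= => h reg; apply: red_step.
  by rewrite -(sig_adjacent nf h) // !sigK.
rewrite -map_cat; apply: IH; rewrite map_cat.
  have [] := goodword_step h; rewrite // -(sig_adjacent nf h) // !sigK //.
apply: regular_sub reg; apply: cat_subseq => //.
exact: subseq_trans (subseq_cons _ _) (subseq_cons _ _).
Qed.

(** Neither alternative of [goodpair] admits a fixed point or its negative, so a positive fixed
    point is never deleted and survives with its sign. *)
Lemma fix_mem u D x j : z j = j -> 0 < j -> goodword z u -> red u D x ->
  [/\ forall d, d \in D -> `|d.1| != j /\ `|d.2| != j,
    forall e, e \in x -> e != - j & j \in u -> j \in x].
Proof.
move=> zj j0 h r; have [/allP hD /allP hx] := h _ _ r.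
have D1 d : d \in D -> `|d.1| != j /\ `|d.2| != j.
  case: d => b a /hD /(goodpairE zK) /= H; have zNj := zN j.
  suff : b <> j /\ a <> j /\ a <> - j by lia.
  by split; [|split] => E; move: H zj zNj; rewrite -?E ?opprK; try rewrite E; lia.
split=> // [e /hx /goodletE|ju].
  by case: eqP => // -> ; have := zN j; lia.
have /orP[//|/hasP[d /D1]] := red_mem r ju.
by lia.
Qed.

End Step.

Lemma cat_split2 (T : Type) (L R L1 R1 : seq T) b a : L ++ R = L1 ++ b :: a :: R1 ->
  [\/ exists R', L = L1 ++ b :: a :: R' /\ R1 = R' ++ R,
      exists L', R = L' ++ b :: a :: R1 /\ L1 = L ++ L' |
      L = rcons L1 b /\ R = a :: R1].
Proof.
elim: L L1 => [|x L IH] [|y L1] /=.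
- by move=> ->; apply: Or32; exists [::].
- by move=> ->; apply: Or32; exists (y :: L1).
- case=> <-; case: L {IH} => [/= -> |y L /= [<- <-]]; first exact: Or33.
  by apply: Or31; exists L.
- case=> <- /IH[[R' [-> ->]]|[L' [-> ->]]|[-> ->]].
  + by apply: Or31; exists R'.
  + by apply: Or32; exists L'.
  + exact: Or33.
Qed.

(** * Steps at two fixed points i and i+1 *)

Section StepFix.
Variables (z : int -> int) (i : nat).
Hypotheses (zN : forall x, z (- x) = - z x) (zK : involutive z).
Hypothesis z_fix : fix2 z i.

Let i_gt0 : (0 < i)%N. Proof. by case/and3P: z_fix. Qed.
Let zi : z i = i. Proof. by case/and3P: z_fix => _ /eqP. Qed.
Let zi1 : z i.+1 = i.+1. Proof. by case/and3P: z_fix => _ _ /eqP. Qed.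

Let fixN (j : nat) (zj : z j = j) (j0 : (0 < j)%N) b a : goodpair z (b, a) ->
  `|b| != j%:Z /\ `|a| != j%:Z.
Proof.
move=> /(goodpairE zK) /= H; have zNj := zN j.
suff : b <> j /\ a <> j /\ a <> - j%:Z by lia.
by split; [|split] => E; move: H zj zNj; rewrite -?E ?opprK; try rewrite E; lia.
Qed.

(** A good pair contains no fixed point, so the left neighbour of the inserted letters is always at
    most i and the right one at least i+1. Thus no deletion of [v] straddles the place of insertion,
    and all of them remain possible. *)
Lemma red_insert v D x : red v D x -> forall L R, v = L ++ R ->
  goodword z (L ++ i%:Z :: i.+1%:Z :: R) -> regular (L ++ i%:Z :: i.+1%:Z :: R) ->
  exists A B, x = A ++ B /\
    red (L ++ i%:Z :: i.+1%:Z :: R) D (A ++ i%:Z :: i.+1%:Z :: B).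
Proof.
have junction L R b a : goodword z (rcons L b ++ i%:Z :: i.+1%:Z :: a :: R) ->
    b <= i /\ i.+1%:Z <= a.
  move=> h; split; rewrite leNgt; apply/negP => lt.
    by have [/(fixN zi i_gt0)] := goodword_fst h lt; rewrite eqxx => -[].
  move: h; rewrite -(cat_rcons i%:Z) => h.
  by have [/(fixN zi1 isT)] := goodword_step h lt; rewrite eqxx => -[].
elim=> [{}x xs L R E h reg|L1 R1 b a {}D {}x ab r IH L R E h reg].
  exists L, R; split=> //; apply: red_nil; subst x.
  have [Ls Rs] := cat_sorted2 xs.
  have Li e : e \in L -> e <= i%:Z.
    case/lastP: L Ls h {xs reg} => [//|L b] /sorted_rcons_le [_ Lb] h.
    have bi : b <= i%:Z.
      rewrite leNgt; apply/negP => lt.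
      by have [/(fixN zi i_gt0)] := goodword_fst h lt; rewrite eqxx => -[].
    by rewrite mem_rcons inE => /orP[/eqP->|/Lb]; lia.
  have Ri e : e \in R -> i.+1%:Z <= e.
    case: R Rs h {xs reg} => [//|a R] /sorted_cons_le [_ aR] h.
    have ai : i.+1%:Z <= a.
      rewrite leNgt; apply/negP => lt; move: h; rewrite -(cat_rcons i%:Z) => h.
      by have [/(fixN zi1 isT)] := goodword_step h lt; rewrite eqxx => -[].
    by rewrite inE => /orP[/eqP->|/aR]; lia.
  apply: sorted_cat_le => //=.
    rewrite (path_sortedE le_trans) Rs; apply/and3P; split; [lia| |done].
    by apply/allP => e /Ri.
  move=> e f /Li ei; rewrite !inE => /or3P[/eqP->//|/eqP->|/Ri]; lia.
case: (cat_split2 (esym E)) => [[R' [EL ER]]|[L' [ER EL]]|[EL ER]].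
- have h' : goodword z ((L1 ++ R') ++ i%:Z :: i.+1%:Z :: R).
    move: h; rewrite EL -!catA /= => h; exact: (goodword_step h ab).2.
  have reg' : regular ((L1 ++ R') ++ i%:Z :: i.+1%:Z :: R).
    apply: regular_sub reg; rewrite EL -!catA; apply: cat_subseq => //=.
    exact: subseq_trans (subseq_cons _ _) (subseq_cons _ _).
  have [|A [B [-> r']]] := IH (L1 ++ R') R _ h' reg'; first by rewrite ER catA.
  exists A, B; split=> //; rewrite EL -catA /=; apply: red_step => //.
  by rewrite catA.
- have h' : goodword z (L ++ i%:Z :: i.+1%:Z :: L' ++ R1).
    move: h; rewrite ER -[L ++ _]/(L ++ [:: i%:Z, i.+1%:Z & L'] ++ _) catA => h.
    by have := (goodword_step h ab).2; rewrite -catA.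
  have reg' : regular (L ++ i%:Z :: i.+1%:Z :: L' ++ R1).
    apply: regular_sub reg; rewrite ER; apply: cat_subseq => //=.
    rewrite !eqxx; apply: cat_subseq => //.
    exact: subseq_trans (subseq_cons _ _) (subseq_cons _ _).
  have [|A [B [-> r']]] := IH L (L' ++ R1) _ h' reg'; first by rewrite EL catA.
  exists A, B; split=> //; rewrite ER.
  rewrite -[L ++ _]/(L ++ [:: i%:Z, i.+1%:Z & L'] ++ _) catA; apply: red_step => //.
  by rewrite -catA.
- by move: h; rewrite EL ER => /junction; lia.
Qed.

(** In [v] the letter i+1 precedes i. As long as both are there, every other deletion is also one of
    the old word and avoids the values i, i+1 and their negatives; once the pair (i+1, i) is
    deleted, [red_insert] puts the two fixed points back. *)
Lemma red_create v D x : red v D x -> goodword z (map (sig i) v) ->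
  regular (map (sig i) v) -> i%:Z \in map (sig i) v -> i.+1%:Z \in map (sig i) v ->
  exists D0 A B, [/\ x = A ++ B, D =i (i.+1%:Z, i%:Z) :: D0 &
    red (map (sig i) v) D0 (A ++ i%:Z :: i.+1%:Z :: B)].
Proof.
have sigi : sig i i = i.+1 by case_sig i i%:Z; lia.
have sigi1 : sig i i.+1 = i by case_sig i i.+1%:Z; lia.
have sig_id e : `|e| != i%:Z -> `|e| != i.+1%:Z -> sig i e = e.
  by case_sig i e; lia.
have sig_id' e : `|sig i e| != i%:Z -> `|sig i e| != i.+1%:Z -> sig i e = e.
  by case_sig i e; lia.
have mem_sig e u : (e \in map (sig i) u) = (sig i e \in u).
  by rewrite -{1}(sigK i e) (mem_map (inv_inj (sigK i))).
elim=> [{}x xs h reg|L R b a {}D {}x ab r IH h reg].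
  (* The reduction cannot stop here: in an increasing regular word i and i+1 would be neighbours,
     and the relabelled word would have the two fixed points as a descent. *)
  rewrite !mem_sig sigi sigi1 => x1 x0; exfalso.
  case/splitPr: x0 xs h reg x1 => P Q xs h reg x1.
  move: xs; rewrite (sorted_pairwise le_trans) pairwise_cat /= allrel_consr.
  case/and4P=> /andP[Pi _] _ iQ Qs.
  move: x1; rewrite mem_cat inE => /or3P[/(allP Pi)/=|/eqP|]; [lia|lia|].
  case: Q iQ Qs h reg => [//|a Q] /= /andP[ia _] /andP[aQ _] h reg.
  move: h reg; rewrite !map_cat /= sigi => h reg.
  have [_ _ aa _] := regular_cat2 reg.
  have {}aa : a != i by apply: contraNneq aa => ->; rewrite sigi.
  rewrite inE => /orP[/eqP E|/(allP aQ) /= ai].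
    move: h; rewrite -E sigi1 => h.
    by have [|/(fixN zi i_gt0)] := goodword_step h _; [lia|rewrite eqxx => -[]].
  have E : a = i.+1 by lia.
  move: h; rewrite E sigi1 => h.
  by have [|/(fixN zi i_gt0)] := goodword_step h _; [lia|rewrite eqxx => -[]].
move: h reg; rewrite !map_cat /= => h reg i0 i1.
have [sb0 sa0 sab av] := regular_cat2 reg.
have [E|nE] := eqVneq (b, a) (i.+1%:Z, i%:Z).
  move: E h reg av => [-> ->]; rewrite sigi sigi1 => h reg av.
  have id_map u : {subset map (sig i) u <= map (sig i) L ++ map (sig i) R} ->
      map (sig i) u = u.
    move=> su; rewrite -[RHS]map_id; apply/eq_in_map => e eu.
    have [_ ? ?] := av (sig i e) (su _ (map_f (sig i) eu)).
    by apply: sig_id'.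
  have EL : map (sig i) L = L by apply: id_map => e; rewrite mem_cat => ->.
  have ER : map (sig i) R = R by apply: id_map => e; rewrite mem_cat orbC => ->.
  move: h reg; rewrite EL ER => h reg.
  have [A [B [-> r']]] := red_insert r erefl h reg.
  by exists D, A, B.
(* The other descent that t_i reverses is -i, -(i+1); regularity excludes it because i+1 also
   occurs. *)
have lt : sig i a < sig i b.
  have [//|le] := ltP (sig i a) (sig i b).
  have [[Eb Ea]|[Eb Ea]] : (b = i.+1 /\ a = i) \/ (b = - i%:Z /\ a = - i.+1%:Z).
    by have := sig_inversion ab le; clear -i_gt0; lia.
    by rewrite Eb Ea eqxx in nE.
  move: i1 av; rewrite Eb Ea !sigN sigi sigi1 => i1 av.
  have : i.+1%:Z \in map (sig i) L ++ map (sig i) R.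
    by move: i1; rewrite !mem_cat !inE => /or4P[->|/eqP|/eqP|->]; rewrite ?orbT //; lia.
  by case/av; lia.
have [gp gw] := goodword_step h lt.
have [b0 a0] := fixN zi i_gt0 gp; have [b1 a1] := fixN zi1 isT gp.
have sub j : j \in map (sig i) L ++ [:: sig i b, sig i a & map (sig i) R] ->
    `|sig i b| != `|j| -> `|sig i a| != `|j| -> j \in map (sig i) (L ++ R).
  rewrite map_cat !mem_cat !inE => /or4P[->//|/eqP->|/eqP->|->]; rewrite ?orbT ?eqxx //.
have [||||D0 [A [B [-> ED r']]]] := IH.
- by rewrite map_cat.
- rewrite map_cat; apply: regular_sub reg; apply: cat_subseq => //.
  exact: subseq_trans (subseq_cons _ _) (subseq_cons _ _).
- by apply: sub; rewrite // lia.
- by apply: sub; rewrite // lia.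
exists ((b, a) :: D0), A, B; split=> //.
  by move=> d; rewrite !inE ED !inE orbCA.
move: r'; rewrite map_cat !(sig_id' _ b0 b1) !(sig_id' _ a0 a1).
by apply: red_step.
Qed.

End StepFix.

(** For an involution with z i < z (i+1) this says that z commutes with t_i, that is, fixes its
    simple root. For i = 0 it amounts to z 1 = 1. *)
Definition comm2 (z : int -> int) (i : nat) : bool :=
  (z i == i) && (z i.+1 == i.+1) || (z i == - i.+1%:Z) && (z i.+1 == - i%:Z).

(** The Demazure conjugate of z by t_i at an ascent, as a map of integers: one of the two factors is
    absorbed when z and t_i commute. *)
Definition dcz (z : int -> int) (i : nat) (x : int) : int :=
  if comm2 z i then sig i (z x) else sig i (z (sig i x)).

Definition negpair (d : int * int) : bool := (0 < d.1) && (d.1 < - d.2).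

Lemma sig_evals (i : nat) : [/\ sig 0 1 = -1, sig 0 (-1) = 1, (0 < i)%N -> sig i i = i.+1,
  (0 < i)%N -> sig i i.+1 = i & forall x : int, `|x| != i -> `|x| != i.+1 -> sig i x = x].
Proof.
split=> [||i0|i0|x x0 x1]; first by [].
- by [].
- by case_sig i i%:Z; lia.
- by case_sig i i.+1%:Z; lia.
- by case_sig i x; lia.
Qed.

(** * Good pairs and letters under Demazure conjugation *)

Section StepGood.
Variables (z : int -> int) (i : nat).
Hypotheses (zN : forall x, z (- x) = - z x) (zK : involutive z).
Hypothesis z_asc : z i < z i.+1.

Let z0 : z 0 = 0. Proof. by have := zN 0; move/eqP; rewrite oppr0 -addr_eq0 -mulr2n mulrn_eq0 => /eqP. Qed.

Lemma comm2E : comm2 z i ->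
  (z i = i /\ z i.+1 = i.+1) \/ ((0 < i)%N /\ z i = - i.+1%:Z /\ z i.+1 = - i%:Z).
Proof.
case/orP=> /andP[/eqP zi /eqP zi1]; [by left|right; split=> //].
by case: posnP zi => // ->; rewrite z0.
Qed.

Let pairE b a : goodpair z (b, a) -> b != 0 -> a != 0 ->
  [/\ b = i -> z b = z i /\ z i = z b, b = i.+1 -> z b = z i.+1,
     a = i -> z a = z i, a = i.+1 -> z a = z i.+1 &
     (a = - i%:Z -> z a = - z i) /\ (a = - i.+1%:Z -> z a = - z i.+1)].
Proof. by move=> *; split=> [->|->|->|->|] //; split=> ->; rewrite zN. Qed.

(** The order conditions could fail only if both letters have absolute values i and i+1, or if i = 0
    and b = 1. Then the values of z at these letters contradict [z_asc] or put z in the commuting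
    case. *)
Lemma goodpair_noncomm b a : ~~ comm2 z i -> b != 0 -> a != 0 -> `|b| != `|a| ->
  goodpair z (b, a) -> goodpair (dcz z i) (sig i b, sig i a) /\
    negpair (sig i b, sig i a) = negpair (b, a).
Proof.
move=> ncm b0 a0 ab gp.
have [E1 E2 E3 E4 [E5 E6]] := pairE gp b0 a0.
have := goodpairE zK gp; rewrite /goodpair /negpair /dcz (negPf ncm) /= !sigK.
case=> bp [[lt [za zb]]|[lt [zb za]]]; rewrite za zb ?sigN !eqxx ?andbT.
  have [s1 s2] : 0 < sig i b /\ `|sig i a| < sig i b.
    have ns : ~ (b = i.+1 /\ (a = i \/ a = - i%:Z)).
      case=> Eb; move: (E2 Eb) => zb'; case=> Ea.
        by move: (E3 Ea); lia.
      case/negP: ncm; rewrite /comm2; apply/orP; right.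
      by move: (E5 Ea); lia.
    by clear -bp lt ns a0; case_sig i b; case_sig i a; lia.
  by split; lia.
have [s1 s2] : 0 < sig i b /\ sig i b < - sig i a.
  have ns : ~ (b = i /\ a = - i.+1%:Z).
    by case=> Eb Ea; have := E1 Eb; have := E6 Ea; lia.
  have ns1 : ~ (i = 0%N /\ b = 1).
    move=> [i0 Eb]; have := E2 (etrans Eb _); rewrite i0 => /(_ erefl).
    by move: z_asc; rewrite i0 z0; lia.
  by clear -bp lt ns ns1; case_sig i b; case_sig i a; lia.
by split; lia.
Qed.

Lemma goodlet_noncomm e : ~~ comm2 z i -> goodlet z e ->
  goodlet (dcz z i) (sig i e) /\ (sig i e < 0) = (e < 0).
Proof.
move=> ncm /goodletE; rewrite /goodlet /dcz (negPf ncm) sigK.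
have ns : ~ (i = 0%N /\ (`|e| = 1 /\ (e < 0 /\ z e = - e \/ 0 < e /\ z e = e))).
  move=> [i0 [e1 ze]].
  have [E|E] : e = 1%N%:Z \/ e = - 1%N%:Z by lia.
    case/negP: ncm; rewrite /comm2 i0 z0 eqxx /=.
    by move: ze; rewrite E; lia.
  by move: ze z_asc ncm; rewrite E i0 zN z0 /comm2 z0 /=; lia.
by case=> -[ep ze]; rewrite ze ?sigN eqxx ?andbT; clear -ep ze ns; case_sig i e; lia.
Qed.

(** Either i = 0 and z 1 = 1, or z i = -(i+1). In the second case the 2-cycle (i+1, -i) turns into
    the pair (i, -(i+1)) of negated points; all other pairs avoid the values moved by t_i. *)
Lemma goodpair_comm b a : comm2 z i -> ~~ fix2 z i -> b != 0 -> a != 0 ->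
  goodpair z (b, a) -> goodpair (dcz z i) (sig i b, sig i a) /\
    (((b, a) = (i.+1%:Z, - i%:Z) /\ z i = - i.+1%:Z /\ (0 < i)%N) \/
     sig i b = b /\ sig i a = a).
Proof.
move=> cm nf b0 a0 gp.
have [E1 E2 E3 E4 [E5 E6]] := pairE gp b0 a0.
have H := goodpairE zK gp.
have [_ _ si si1 s_id] := sig_evals i.
have [[zi zi1]|[i0 [zi zi1]]] := comm2E cm.
  have i0 : i = 0%N by case: (posnP i) => // i0; move: nf; rewrite /fix2 i0 zi zi1 !eqxx.
  have [nb na] : (`|b| != i /\ `|b| != i.+1) /\ (`|a| != i /\ `|a| != i.+1).
    by clear -H i0 zi zi1 b0 a0 E1 E2 E3 E4 E5 E6; lia.
  have [sb sa] : sig i b = b /\ sig i a = a.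
    by case: nb na => ? ? [? ?]; split; apply: s_id.
  rewrite sb sa; split; last by right.
  move: gp; rewrite /goodpair /dcz cm /=.
  by case: H => bp [[lt [za zb]]|[lt [zb za]]]; rewrite za zb ?sigN ?sb ?sa.
have [[Eb Ea]|ne] : (b = i.+1 /\ a = - i%:Z) \/
  (`|b| != i /\ `|b| != i.+1 /\ `|a| != i /\ `|a| != i.+1) by lia.
  rewrite Eb Ea sigN si // si1 //; split; last by left.
  rewrite /goodpair /dcz cm /= zN zi zi1 opprK sigN si // si1 //.
  by rewrite !eqxx; lia.
have [sb sa] : sig i b = b /\ sig i a = a.
  by case: ne => ? [? [? ?]]; split; apply: s_id.
rewrite sb sa; split; last by right.
move: gp; rewrite /goodpair /dcz cm /=.
by case: H => bp [[lt [za zb]]|[lt [zb za]]]; rewrite za zb ?sigN ?sb ?sa.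
Qed.

Lemma goodlet_comm e : comm2 z i -> ~~ fix2 z i -> goodlet z e ->
  goodlet (dcz z i) (sig i e) /\ 
  ((e = 1 /\ i = 0%N) \/ sig i e = e /\ ((0 < i)%N \/ `|e| != 1)).
Proof.
move=> cm nf gl; have H := goodletE gl.
have [s1 _ si si1 s_id] := sig_evals i.
have [[zi zi1]|[i0 [zi zi1]]] := comm2E cm.
  have i0 : i = 0%N by case: (posnP i) => // i0; move: nf; rewrite /fix2 i0 zi zi1 !eqxx.
  have [E|ne] : e = 1%N%:Z \/ `|e| != 1.
    have ne1 : e <> - 1%N%:Z.
      by move=> E; move: H zi1; rewrite E zN i0; clear; lia.
    by clear -ne1; lia.
    move: zi1 cm; rewrite E i0 => z1 cm; split; last by left.
    by rewrite s1 /goodlet /dcz cm zN z1 sigN s1; lia.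
  have se : sig i e = e by apply: s_id; lia.
  rewrite se; split; last by right; split=> //; right.
  by move: gl; rewrite /goodlet /dcz cm; case: H => -[ep ->]; rewrite ?sigN se.
have ne : `|e| != i /\ `|e| != i.+1.
  have h1 : e <> i by move=> E; move: H; rewrite E; lia.
  have h2 : e <> i.+1 by move=> E; move: H; rewrite E; lia.
  have h3 : e <> - i%:Z by move=> E; move: H; rewrite E zN; lia.
  have h4 : e <> - i.+1%:Z by move=> E; move: H; rewrite E zN; lia.
  by lia.
have se : sig i e = e by apply: s_id; lia.
rewrite se; split; last by right; split=> //; left.
by move: gl; rewrite /goodlet /dcz cm; case: H => -[ep ->]; rewrite ?sigN se.
Qed.

End StepGood.

Section StepWord.
Variables (z : int -> int) (i : nat).
Hypotheses (zN : forall x, z (- x) = - z x) (zK : involutive z).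
Hypothesis z_asc : z i < z i.+1.
Variable u : seq int.
Hypotheses (u_good : goodword z u) (u_reg : regular u).
Hypothesis u_full : forall j : nat, (0 < j)%N -> (j == i) || (j == i.+1) ->
  j%:Z \in u \/ - j%:Z \in u.

Let z0 : z 0 = 0.
Proof. by have := zN 0; move/eqP; rewrite oppr0 -addr_eq0 -mulr2n mulrn_eq0 => /eqP. Qed.

Let su_red D x : ~~ fix2 z i -> red (map (sig i) u) D x ->
  exists D0 x0, [/\ red u D0 x0, D = map (sig2 i) D0 & x = map (sig i) x0].
Proof.
move=> nf r; exists (map (sig2 i) D), (map (sig i) x).
rewrite !mapK; [|exact: sigK|by case=> b a; rewrite /sig2 /= !sigK]; split=> //.
by have := red_sig zN zK z_asc nf r; rewrite (mapK (sigK i)); apply.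
Qed.

Let su_fix D x : fix2 z i -> red (map (sig i) u) D x ->
  exists D0 A B, [/\ x = A ++ B, D =i (i.+1%:Z, i%:Z) :: D0 &
    red u D0 (A ++ i%:Z :: i.+1%:Z :: B)].
Proof.
move=> zf r; case/and3P: (zf) => i_gt0 /eqP zi /eqP zi1.
have Nu (j : nat) : (0 < j)%N -> z j = j -> - j%:Z \notin u.
  move=> j0 zj; have [D1 [y r1]] := red_exists u.
  have [hD hx _] := fix_mem zN zK z_asc zj j0 u_good r1.
  apply/negP => ju; have /orP[/hx|/hasP[d /hD [d1 d2]]] := red_mem r1 ju.
    by rewrite eqxx.
  by move: d1 d2; clear; lia.
have := u_full i_gt0; rewrite eqxx => /(_ isT) [ui|]; last by rewrite (negPf (Nu _ _ _)).
have := @u_full i.+1 isT; rewrite eqxx orbT => /(_ isT) [ui1|]; last by rewrite (negPf (Nu _ _ _)).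
by have := red_create zN zK zf r; rewrite (mapK (sigK i)); apply.
Qed.

(** Only the pairs in [negpair] and the negative letters matter for the shape. The pair (i+1, i)
    created at fixed points is invisible there; a 2-cycle (i+1, -i) becomes visible as (i, -(i+1)),
    and a fixed letter 1 as -1. *)
Lemma red_step_cases D x : red (map (sig i) u) D x ->
  exists D0 x0, red u D0 x0 /\
  [\/ [/\ ~~ comm2 z i, D = map (sig2 i) D0 & x = map (sig i) x0],
      [/\ fix2 z i, forall d, negpair d -> (d \in D) = (d \in D0) &
          forall e, e < 0 -> (e \in x) = (e \in x0)],
      [/\ (0 < i)%N, z i = - i.+1%:Z,
          forall d, negpair d -> (d \in D) = (d == (i%:Z, - i.+1%:Z)) || (d \in D0) &
          forall e, e < 0 -> (e \in x) = (e \in x0)] |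
      [/\ i = 0%N, z 1 = 1, forall d, negpair d -> (d \in D) = (d \in D0) &
          forall e, e < 0 -> (e \in x) = (e == -1) || (e \in x0)]].
Proof.
move=> r; have [zf|nf] := boolP (fix2 z i).
  have [D0 [A [B [-> ED r0]]]] := su_fix zf r.
  exists D0, (A ++ i%:Z :: i.+1%:Z :: B); split=> //; apply: Or42; split=> //.
    move=> d nd; rewrite ED inE; case: eqP nd => // ->.
    by rewrite /negpair /=; clear; lia.
  move=> e e0; rewrite !mem_cat !inE.
  by have [-> ->] : e == i%:Z = false /\ e == i.+1%:Z = false by clear -e0; lia.
have [D0 [x0 [r0 -> ->]]] := su_red nf r; exists D0, x0; split=> //.
have [hD hx] := u_good r0; have rD := red_regular r0 u_reg.
have mem_sig e v : (e \in map (sig i) v) = (sig i e \in v).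
  by rewrite -{1}(sigK i e) (mem_map (inv_inj (sigK i))).
have sig2K : involutive (sig2 i) by case=> b a; rewrite /sig2 /= !sigK.
have mem_sig2 d v : (d \in map (sig2 i) v) = (sig2 i d \in v).
  by rewrite -{1}(sig2K d) (mem_map (inv_inj sig2K)).
have [cm|ncm] := boolP (comm2 z i); last by apply: Or41.
have pairs b a : (b, a) \in D0 ->
    ((b, a) = (i.+1%:Z, - i%:Z) /\ z i = - i.+1%:Z /\ (0 < i)%N) \/
     sig i b = b /\ sig i a = a.
  move=> dD; have [b0 a0 _] := rD _ dD.
  by have [_] := goodpair_comm zN zK z_asc cm nf b0 a0 (allP hD _ dD).
have lets e : e \in x0 ->
    ((e = 1 /\ i = 0%N) \/ sig i e = e /\ ((0 < i)%N \/ `|e| != 1)).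
  by move=> ex; have [_] := goodlet_comm zN z_asc cm nf (allP hx _ ex).
have [s1 sN1 si si1 s_id] := sig_evals i.
have [[zi zi1]|[i0 [zi zi1]]] := comm2E zN cm.
  have i0 : i = 0%N by case: (posnP i) => // i0; move: nf; rewrite /fix2 i0 zi zi1 !eqxx.
  apply: Or44; split=> //; first by rewrite i0 in zi1.
    move=> [b a] nd; rewrite mem_sig2 /sig2 /=.
    apply/idP/idP => dD; last by have [[_ []]|[-> ->]] := pairs _ _ dD; rewrite ?i0.
    have [[_ []]|] := pairs _ _ dD; first by rewrite i0.
    by rewrite !sigK => -[Eb Ea]; move: dD; rewrite -Eb -Ea.
  (* One of the letters 1, -1 occurs; no deleted pair contains it, and -1 cannot survive since z 1 =
     1. *)
  have x1 : 1%N%:Z \in x0.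
    have nd d : d \in D0 -> `|d.1| != 1 /\ `|d.2| != 1.
      case: d => b a dD; have [[_ [_]]|[/= Eb Ea]] := pairs _ _ dD; first by rewrite i0.
      have [b0 a0 _] := rD _ dD; move: Eb Ea b0 a0; rewrite i0 /=; clear.
      by have := sigE 0 b; have := sigE 0 a; lia.
    have nx : - 1%N%:Z \notin x0.
      apply/negP => /(allP hx) /goodletE; rewrite zN; move: zi1; rewrite i0; clear; lia.
    have [|ux|ux] := @u_full 1%N isT; first by rewrite i0.
      have /orP[//|/hasP[d /nd]] := red_mem r0 ux; clear; lia.
    have /orP[h|/hasP[d /nd]] := red_mem r0 ux; last by clear; lia.
    by rewrite h in nx.
  move=> e e0; rewrite mem_sig.
  have [->|ne] := eqVneq e (-1); first by rewrite i0 sN1.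
  by have -> : sig i e = e by clear -ne e0 i0; case_sig i e; lia.
apply: Or43; split=> //; last first.
  move=> e e0; rewrite mem_sig.
  apply/idP/idP => ex; last first.
    have [[_ ii]|[-> _]] := lets _ ex => //; move: i0; rewrite ii; clear; lia.
  have [[_ ii]|[]] := lets _ ex; first by move: i0; rewrite ii; clear; lia.
  by rewrite sigK => E _; move: ex; rewrite -E.
(* One of the letters i, -i occurs and cannot survive, because z i = -(i+1); the only pair that can
   contain it is this one. *)
have iD : (i.+1%:Z, - i%:Z) \in D0.
  have nx e : e \in x0 -> `|e| != i.
    move=> /(allP hx) /goodletE H; apply/negP => /eqP E.
    have [Ee|Ee] : e = i \/ e = - i%:Z by clear -E; lia.
      by move: H; rewrite Ee zi; clear -i0; lia.
    by move: H; rewrite Ee zN zi; clear -i0; lia.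
  have [j ju ji] : exists2 j, j \in u & `|j| = i.
    have [|ux|ux] := @u_full i i0; first by rewrite eqxx.
      by exists i%:Z.
    by exists (- i%:Z); rewrite // normrN.
  have /orP[/nx|/hasP[[b a] dD /= H]] := red_mem r0 ju; first by rewrite ji eqxx.
  have [[<- _] //|[Eb Ea]] := pairs _ _ dD.
  by case/orP: H => /eqP E; move: ji; rewrite E; clear -Eb Ea i0;
    case_sig i a; case_sig i b; lia.
move=> [b a] nd; rewrite mem_sig2 /sig2 /=.
have [[-> ->]|ne] := eqVneq (b, a) (i%:Z, - i.+1%:Z).
  by rewrite sigN si // si1.
apply/idP/idP => dD /=; last first.
  have [[[Eb Ea] _]|[-> ->]] := pairs _ _ dD; last by [].
  by move: nd; rewrite /negpair /= Eb Ea; clear; lia.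
have [[[Eb Ea] _]|[]] := pairs _ _ dD.
  case/eqP: ne; rewrite -(sigK i b) -(sigK i a) Eb Ea sigN si // si1 //.
by rewrite !sigK => Eb Ea; rewrite Eb Ea.
Qed.

(** At two fixed points the one new pair (i+1, i) is a 2-cycle of the new involution; otherwise the
    reductions correspond by relabelling. *)
Lemma goodword_sig : goodword (dcz z i) (map (sig i) u).
Proof.
move=> D x r; have [zf|nf] := boolP (fix2 z i); last first.
  have [D0 [x0 [r0 -> ->]]] := su_red nf r.
  have [/allP hD /allP hx] := u_good r0; have rD := red_regular r0 u_reg.
  split; [apply/allP => _ /mapP[[b a] dD ->]|apply/allP => _ /mapP[f fx ->]].
    have [b0 a0 ab] := rD _ dD; have gp := hD _ dD.
    have [cm|ncm] := boolP (comm2 z i).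
      by have [] := goodpair_comm zN zK z_asc cm nf b0 a0 gp.
    by have [] := goodpair_noncomm zN zK z_asc ncm b0 a0 ab gp.
  have [cm|ncm] := boolP (comm2 z i).
    by have [] := goodlet_comm zN z_asc cm nf (hx _ fx).
  by have [] := goodlet_noncomm zN z_asc ncm (hx _ fx).
have [D0 [A [B [-> ED r0]]]] := su_fix zf r.
have [/allP hD /allP hx] := u_good r0.
case/and3P: (zf) => i_gt0 /eqP zi /eqP zi1.
have cm : comm2 z i by rewrite /comm2 zi zi1 !eqxx.
have [_ _ si si1 s_id] := sig_evals i.
have [D1 _ _] := fix_mem zN zK z_asc zi i_gt0 u_good r0.
have [D2 _ _] := fix_mem (j := i.+1) zN zK z_asc zi1 isT u_good r0.
have [_ _ _ avx] := regular_cat2 (regular_sub (red_sub r0) u_reg).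
split; [apply/allP => -[b a]|apply/allP => e].
  rewrite ED inE => /orP[/eqP[-> ->]|dD].
    by rewrite /goodpair /dcz cm /= zi si // eqxx; clear; lia.
  have [/= b1 a1] := D1 _ dD; have [/= b2 a2] := D2 _ dD.
  have := goodpairE zK (hD _ dD); have := hD _ dD; rewrite /goodpair /dcz cm /=.
  move=> h [bp [[lt [za zb]]|[lt [zb za]]]]; move: h; rewrite za zb ?sigN.
    by rewrite !s_id.
  by rewrite !s_id.
move=> eAB; have [e0 e1 e2] := avx _ eAB.
have ex : e \in A ++ [:: i%:Z, i.+1%:Z & B].
  by move: eAB; rewrite !mem_cat !inE => /orP[->//|->]; rewrite !orbT.
have := hx _ ex; have := goodletE (hx _ ex); rewrite /goodlet /dcz cm.
by move=> [[ep ->]|[ep ->]]; rewrite ?sigN !s_id.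
Qed.

End StepWord.

(** * Signed permutations and their length *)

Section Evaluation.
Variable n : nat.
Implicit Types (u v w y : {perm (idx n)}) (s : 'I_n) (x : int).

(** A permutation as a map of labels, extended by the identity beyond n so that composition and
    inversion need no range conditions. *)
Definition ev w x : int := if `|x| <= n%:Z then lab (w (pos n x)) else x.

Lemma lab_bound (i : idx n) : `|lab i| <= n%:Z.
Proof. by rewrite /lab; have := ltn_ord i; lia. Qed.

Lemma pos_K x : `|x| <= n%:Z -> lab (pos n x) = x.
Proof. by move=> h; apply: lab_pos; lia. Qed.

Lemma lab_inj : injective (@lab n).
Proof. exact: can_inj (@pos_lab n). Qed.

Lemma lab_rev (i : idx n) : lab (rev_ord i) = - lab i.
Proof. by rewrite /lab /= subSS; have := ltn_ord i; lia. Qed.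

Lemma pos_opp x : `|x| <= n%:Z -> pos n (- x) = rev_ord (pos n x).
Proof. by move=> h; apply: lab_inj; rewrite lab_rev !pos_K // normrN. Qed.

Lemma pos_eq a b : `|a| <= n%:Z -> `|b| <= n%:Z -> (pos n a == pos n b) = (a == b).
Proof.
move=> ha hb; apply/eqP/eqP => [|-> //] /(congr1 (@lab n)).
by rewrite !pos_K.
Qed.

Lemma WP w : reflect (forall i, w (rev_ord i) = rev_ord (w i)) (w \in W n).
Proof.
apply: (iffP cent1P) => [h i|h].
  by have := congr1 (fun f : {perm _} => f i) h; rewrite !permM !permE.
by apply/permP => i; rewrite !permM !permE h.
Qed.

Lemma ev_lab w i : ev w (lab i) = lab (w i).
Proof. by rewrite /ev lab_bound pos_lab. Qed.

Lemma ev_pos w x : `|x| <= n%:Z -> w (pos n x) = pos n (ev w x).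
Proof. by move=> h; rewrite /ev h pos_lab. Qed.

Lemma ev_out w x : n%:Z < `|x| -> ev w x = x.
Proof. by rewrite /ev ltNge => /negPf->. Qed.

Lemma ev_bound w x : (`|ev w x| <= n%:Z) = (`|x| <= n%:Z).
Proof. by rewrite /ev; case: ifP => h; rewrite ?lab_bound ?h. Qed.

Lemma evM u v x : ev (wmul u v) x = ev u (ev v x).
Proof.
by rewrite [ev v x]/ev; case: ifP => h; rewrite ?ev_lab /ev h // /wmul permM.
Qed.

Lemma ev1 x : ev 1%g x = x.
Proof. by rewrite /ev; case: ifP => // h; rewrite perm1 pos_K. Qed.

Lemma evVK w : cancel (ev w) (ev w^-1%g).
Proof. by move=> x; rewrite -evM /wmul mulgV ev1. Qed.

Lemma evKV w : cancel (ev w^-1%g) (ev w).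
Proof. by move=> x; rewrite -evM /wmul mulVg ev1. Qed.

Lemma ev_inj w : injective (ev w).
Proof. exact: can_inj (evVK w). Qed.

Lemma ev_eq u v : (forall x, `|x| <= n%:Z -> ev u x = ev v x) -> u = v.
Proof.
move=> h; apply/permP => i; apply: lab_inj.
by rewrite -!ev_lab h // lab_bound.
Qed.

Lemma evN w x : w \in W n -> ev w (- x) = - ev w x.
Proof.
move/WP=> h; rewrite /ev normrN; case: ifP => // hx.
by rewrite pos_opp // h lab_rev.
Qed.

Lemma ev0 w : w \in W n -> ev w 0 = 0.
Proof.
move=> wW; have /eqP := evN 0 wW.
by rewrite oppr0 -addr_eq0 -mulr2n mulrn_eq0 => /eqP.
Qed.

Lemma ev_W w : (forall x, `|x| <= n%:Z -> ev w (- x) = - ev w x) -> w \in W n.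
Proof.
move=> h; apply/WP => i; apply: lab_inj; rewrite lab_rev -!ev_lab lab_rev.
by rewrite h // lab_bound.
Qed.

Lemma tperm_pos a b x : `|a| <= n%:Z -> `|b| <= n%:Z -> `|x| <= n%:Z ->
  tperm (pos n a) (pos n b) (pos n x) =
  pos n (if x == a then b else if x == b then a else x).
Proof.
move=> ha hb hx; case: tpermP => [/eqP|/eqP|].
- by rewrite pos_eq // => ->.
- by rewrite pos_eq // => /eqP ->; rewrite eqxx; case: (altP eqP) => // ->.
- move=> /eqP; rewrite pos_eq // => /negPf -> /eqP.
  by rewrite pos_eq // => /negPf ->.
Qed.

Lemma ev_sgen s x : ev (sgen s) x = sig s x.
Proof.
have sn := ltn_ord s.
have [h|h] := boolP (`|x| <= n%:Z); last first.
  by rewrite ev_out; last lia; case_sig s x; lia.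
rewrite /ev h /sgen /sig; case: eqP => [s0|/eqP s0].
  rewrite tperm_pos //; [|lia|lia].
  by rewrite pos_K; do ![case: eqP => ?]; lia.
rewrite permM !tperm_pos ?pos_K //; try lia;
  case: (x =P s%:Z) => ?; case: (x =P s.+1%:Z) => ?; case: (x =P - s%:Z) => ?;
  case: (x =P - s.+1%:Z) => ?; do ?case: eqP => ?; lia.
Qed.

Lemma sgen_W s : sgen s \in W n.
Proof. by apply: ev_W => x _; rewrite !ev_sgen sigN. Qed.

Lemma wmul_W u v : u \in W n -> v \in W n -> wmul u v \in W n.
Proof. by move=> hu hv; rewrite /wmul groupM. Qed.

Lemma sgenK s : wmul (sgen s) (sgen s) = 1%g.
Proof. by apply: ev_eq => x _; rewrite evM !ev_sgen sigK ev1. Qed.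

Lemma wmulA : associative (@wmul n).
Proof. by move=> u v w; rewrite /wmul mulgA. Qed.

Lemma wmul1 w : wmul w 1%g = w. Proof. by rewrite /wmul mul1g. Qed.
Lemma wmul1l w : wmul 1%g w = w. Proof. by rewrite /wmul mulg1. Qed.

Lemma wmulsK s w : wmul (wmul w (sgen s)) (sgen s) = w.
Proof. by rewrite -wmulA sgenK wmul1. Qed.

Lemma wmulKs s w : wmul (sgen s) (wmul (sgen s) w) = w.
Proof. by rewrite wmulA sgenK wmul1l. Qed.

Lemma sgenV s : ((sgen s)^-1 = sgen s)%g.
Proof. by apply/eqP; rewrite eq_invg_mul; apply/eqP/(sgenK s). Qed.

Lemma wprod_foldl w (t : seq 'I_n) :
  foldl (fun w s => wmul (sgen s) w) w t = wmul (wprod t) w.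
Proof.
rewrite /wprod; elim/last_ind: t => [|t s IH]; first by rewrite /= wmul1l.
by rewrite !foldl_rcons IH wmulA.
Qed.

Lemma wprod_cons s (t : seq 'I_n) : wprod (s :: t) = wmul (wprod t) (sgen s).
Proof. by rewrite {1}/wprod /= wprod_foldl wmul1. Qed.

Lemma wprod_rcons s (t : seq 'I_n) : wprod (rcons t s) = wmul (sgen s) (wprod t).
Proof. by rewrite /wprod foldl_rcons. Qed.

Lemma wprod_W (t : seq 'I_n) : wprod t \in W n.
Proof.
elim: t => [|s t IH]; first by rewrite /wprod /= group1.
by rewrite wprod_cons wmul_W ?sgen_W.
Qed.

Lemma wprod_rev (t : seq 'I_n) : wprod (rev t) = ((wprod t)^-1)%g.
Proof.
elim: t => [|s t IH]; first by rewrite /wprod /= invg1.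
by rewrite rev_cons wprod_rcons wprod_cons IH /wmul invMg sgenV.
Qed.

End Evaluation.

(** * Length as a number of inversions *)

Section Length.
Variable n : nat.
Implicit Types (u v w y : {perm (idx n)}) (s : 'I_n) (x : int) (t : seq 'I_n).

(* As w fixes 0, this is also the right condition for s = 0. *)
Definition asc s w : bool := ev w s < ev w s.+1.

(* (x, y) with |x| < y stands for the positive root e_y - e_x, where e_0 = 0 and
   e_(-x) = - e_x. *)
Definition invset w : {set idx n * idx n} :=
  [set p | (`|lab p.1| < lab p.2) && (lab (w p.2) < lab (w p.1))].

Definition invB w : nat := #|invset w|.

Lemma bound_s s : (`|s%:Z| <= n%:Z) /\ (`|s.+1%:Z| <= n%:Z).
Proof. by have := ltn_ord s; lia. Qed.

Lemma wmul_asc s w : w \in W n -> asc s (wmul w (sgen s)) = ~~ asc s w.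
Proof.
move=> wW; rewrite /asc !evM !ev_sgen -leNgt le_eqVlt.
case: (posnP s) => [s0|s0].
  have -> : sig s s = 0 by case_sig s s%:Z; lia.
  have -> : sig s s.+1 = - s.+1%:Z by case_sig s s.+1%:Z; lia.
  rewrite evN // s0 !ev0 //; case: eqP => [h|_ /=]; last by lia.
  by have /(@ev_inj _ _) := etrans h (esym (ev0 wW)).
have -> : sig s s = s.+1 by case_sig s s%:Z; lia.
have -> : sig s s.+1 = s by case_sig s s.+1%:Z; lia.
by case: eqP => [/(@ev_inj _ _)|//]; lia.
Qed.

Let simple s : idx n * idx n := (pos n s, pos n s.+1).

(** The action of t_s on the positive roots other than its simple root. The pair (-s, s+1) stands
    for the root e_(s+1) + e_s, which t_s fixes, but relabelling would give it the inadmissible form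
    (-(s+1), s); so it is kept. *)
Let flip s (p : idx n * idx n) :=
  if `|lab (sgen s p.1)| < lab (sgen s p.2) then (sgen s p.1, sgen s p.2) else p.

Let flipP s w p : w \in W n -> p \in invset (wmul w (sgen s)) :\ simple s ->
  flip s p \in invset w :\ simple s /\ flip s (flip s p) = p.
Proof.
move=> wW; case: p => i j; rewrite !inE /= => /and3P[ne lt].
have [hs hs1] := bound_s s.
have {ne}ne : ~ (lab i = s /\ lab j = s.+1).
  by case=> li lj; case/negP: ne; rewrite /simple -li -lj !pos_lab.
rewrite -!ev_lab !evM !ev_sgen => winv.
rewrite /flip /= -!ev_lab !ev_sgen.
case: ifP => [lt'|nlt]; last first.
  rewrite /= nlt; split=> //.
  have [li [lj s0]] : lab i = - s%:Z /\ lab j = s.+1 /\ (0 < s)%N.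
    by clear -nlt lt ne; case_sig s (lab i); case_sig s (lab j); lia.
  rewrite lt li lj; apply/andP; split; last first.
    move: winv; rewrite li lj sigN.
    have -> : sig s s = s.+1 by case_sig s s%:Z; lia.
    have -> : sig s s.+1 = s by case_sig s s.+1%:Z; lia.
    by rewrite !evN //; lia.
  apply/eqP => -[/(congr1 (@lab n))]; rewrite pos_K //; lia.
rewrite /= -!ev_lab !ev_sgen !sigK lt winv lt'; split=> //; last first.
  by congr (_, _); apply: lab_inj; rewrite -!ev_lab !ev_sgen sigK.
rewrite !andbT; apply/eqP => -[/(congr1 (@lab n)) + /(congr1 (@lab n))].
rewrite !pos_K // -!ev_lab !ev_sgen.
by clear -lt lt' ne; case_sig s (lab i); case_sig s (lab j); lia.
Qed.

Let flip_le s w : w \in W n ->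
  (#|invset (wmul w (sgen s)) :\ simple s| <= #|invset w :\ simple s|)%N.
Proof.
move=> wW.
have /card_in_imset <- : {in invset (wmul w (sgen s)) :\ simple s &, injective (flip s)}.
  move=> p q pI qI E; have [_ <-] := flipP wW pI; have [_ <-] := flipP wW qI.
  by rewrite E.
apply: subset_leq_card; apply/fintype.subsetP => _ /imsetP[p pI ->].
by have [] := flipP wW pI.
Qed.

(** [flip] maps the inversions of w t_s other than the simple root injectively into those of w, and
    conversely; so only the simple root is gained. *)
Lemma invB_asc s w : w \in W n -> asc s w -> invB (wmul w (sgen s)) = (invB w).+1.
Proof.
move=> wW aw; have [hs hs1] := bound_s s.
have E : #|invset (wmul w (sgen s)) :\ simple s| = #|invset w :\ simple s|.
  apply/eqP; rewrite eqn_leq flip_le //=.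
  by rewrite -{1}(wmulsK s w); apply: flip_le; rewrite wmul_W ?sgen_W.
have simpleE v : v \in W n -> (simple s \in invset v) = ~~ asc s v.
  move=> vW; rewrite inE /simple /= -!ev_lab !pos_K // /asc -leNgt le_eqVlt.
  have -> : `|s%:Z| < s.+1%:Z by lia.
  by case: eqP => [/(@ev_inj _ _)|//]; lia.
rewrite /invB (cardsD1 (simple s)) simpleE ?wmul_asc ?wmul_W ?sgen_W // aw E.
by rewrite [in RHS](cardsD1 (simple s)) simpleE // aw.
Qed.

Lemma invB1 : invB 1%g = 0%N.
Proof.
apply/eqP; rewrite cards_eq0; apply/eqP/setP => -[i j].
by rewrite !inE /= !perm1; lia.
Qed.

(** Strictly increasing from w 0 = 0 and bounded by n, the values on 0, ..., n are squeezed onto the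
    identity. *)
Lemma asc_all w : w \in W n -> (forall s, asc s w) -> w = 1%g.
Proof.
move=> wW h; have lt (i : nat) : (i < n)%N -> ev w i < ev w i.+1.
  by move=> hi; apply: (h (Ordinal hi)).
have up (i : nat) : (i <= n)%N -> i%:Z <= ev w i.
  elim: i => [|i IH] hi; first by rewrite ev0.
  by have := lt i hi; have := IH (ltnW hi); lia.
have dn (d : nat) : (d <= n)%N -> ev w (n - d)%N <= (n - d)%N.
  elim: d => [|d IH] hd.
    have : `|ev w (n - 0)%N| <= n%:Z by rewrite ev_bound; lia.
    by lia.
  have := IH (ltnW hd); have := lt (n - d.+1)%N.
  have -> : (n - d.+1).+1 = (n - d)%N by lia.
  by lia.
have fixp (i : nat) : (i <= n)%N -> ev w i = i.
  move=> hi; have := up i hi; have := dn (n - i)%N (leq_subr _ _).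
  by rewrite subKn //; lia.
apply: ev_eq => x hx; rewrite ev1.
have [j hj] : exists j : nat, `|x| = j by exists `|x|%N.
have hjn : (j <= n)%N by lia.
have [->|->] : x = j \/ x = - j%:Z by lia.
  exact: fixp.
by rewrite evN // fixp.
Qed.

Lemma invB_word w : w \in W n -> exists2 t, wprod t = w & size t = invB w.
Proof.
move: {2}(invB w) (erefl (invB w)) => m; elim: m w => [|m IH] w Em wW.
  have [/forallP h|] := boolP [forall s, asc s w].
    by exists [::]; rewrite ?Em // (asc_all wW h).
  rewrite negb_forall => /existsP[s]; rewrite -wmul_asc // => h.
  have := invB_asc (wmul_W wW (sgen_W s)) h.
  by rewrite wmulsK Em.
have [/forallP h|] := boolP [forall s, asc s w].
  by move: Em; rewrite (asc_all wW h) invB1.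
rewrite negb_forall => /existsP[s]; rewrite -wmul_asc // => h.
have := invB_asc (wmul_W wW (sgen_W s)) h; rewrite wmulsK Em => -[Em'].
have [t Et st] := IH _ (esym Em') (wmul_W wW (sgen_W s)).
by exists (s :: t); rewrite ?wprod_cons ?Et ?wmulsK //= st -Em'.
Qed.

Lemma invB_step s w : w \in W n -> (invB (wmul w (sgen s)) <= (invB w).+1)%N.
Proof.
move=> wW; have [h|h] := boolP (asc s w); first by rewrite invB_asc.
have wsW := wmul_W wW (sgen_W s).
have := invB_asc (s := s) wsW; rewrite wmul_asc // h wmulsK => /(_ isT) ->.
by rewrite -addn2 leq_addr.
Qed.

Lemma invB_wprod t : (invB (wprod t) <= size t)%N.
Proof.
elim: t => [|s t IH]; first by rewrite /wprod /= invB1.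
by rewrite wprod_cons (leq_trans (invB_step s (wprod_W t))).
Qed.

(** One more letter raises [invB] by at most one, so the suffixes of a reduced word take all values
    from 0 to [invB w], which gives that many distinct elements. This keeps the length within the
    search range of [len]. *)
Lemma invB_card w : w \in W n -> (invB w < #|W n|)%N.
Proof.
move=> wW.
have ex (j : 'I_(invB w).+1) : exists v, (v \in W n) && (invB v == j).
  have [t Et st] := invB_word wW.
  suff H : forall t', (exists t'', t = t'' ++ t') -> forall j : nat,
      (j <= invB (wprod t'))%N -> exists v, (v \in W n) && (invB v == j).
    by apply: (H t); [exists [::]|rewrite Et -ltnS].
  elim=> [|s t' IH] [t'' E] i.
    by rewrite /wprod /= invB1 leqn0 => /eqP->; exists 1%g; rewrite group1 invB1.
  rewrite leq_eqVlt => /orP[/eqP->|]; first by exists (wprod (s :: t')); rewrite wprod_W /=.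
  rewrite wprod_cons => h; apply: IH; first by exists (rcons t'' s); rewrite cat_rcons.
  by have := invB_step s (wprod_W t'); move: h; lia.
have f_inj : injective (fun j => xchoose (ex j)).
  move=> i j E; apply: val_inj => /=.
  have /andP[_ /eqP Ei] := xchooseP (ex i).
  have /andP[_ /eqP Ej] := xchooseP (ex j).
  by rewrite -[RHS]Ej -E.
rewrite -[X in (X <= _)%N]card_ord -(card_imset _ f_inj); apply: subset_leq_card.
by apply/fintype.subsetP => _ /imsetP[j _ ->]; have /andP[] := xchooseP (ex j).
Qed.

Lemma lenE w : w \in W n -> len w = invB w.
Proof.
move=> wW; rewrite /len; set p := (fun m => _).
have [t Et st] := invB_word wW.
have pw : p (invB w).
  by apply/existsP; exists (tcast st (in_tuple t)); rewrite val_tcast Et.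
have hs : has p (iota 0 #|W n|.+1).
  apply/hasP; exists (invB w) => //; rewrite mem_iota add0n.
  exact: ltnW (invB_card wW).
have lt : (find p (iota 0 #|W n|.+1) < #|W n|.+1)%N by rewrite -[X in (_ < X)%N](size_iota 0) -has_find.
apply/eqP; rewrite eqn_leq; apply/andP; split.
  rewrite leqNgt; apply/negP => h.
  have := before_find 0%N h; rewrite nth_iota ?add0n ?pw //.
  by rewrite (ltn_trans h).
have := nth_find 0%N hs; rewrite nth_iota // add0n => /existsP[t' /eqP E].
by rewrite -[in X in (X <= _)%N]E -[X in (_ <= X)%N](size_tuple t'); apply: invB_wprod.
Qed.

Lemma invB_inv w : w \in W n -> invB w^-1%g = invB w.
Proof.
suff le v : v \in W n -> (invB v^-1%g <= invB v)%N.
  move=> wW; apply/eqP; rewrite eqn_leq le //=.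
  by rewrite -{1}(invgK w) le // groupV.
move=> vW; have [t <- <-] := invB_word vW.
by rewrite -wprod_rev -(size_rev t) invB_wprod.
Qed.

End Length.

(** * Demazure conjugation and atoms *)

Section InvolutionOrder.
Variable n : nat.
Implicit Types (u v w y z : {perm (idx n)}) (s : 'I_n) (x : int) (t : seq 'I_n).

Definition involW y : bool := (y \in W n) && (y^-1 == y)%g.

Definition dconj s y : {perm (idx n)} :=
  if asc s y then
    if comm2 (ev y) s then wmul (sgen s) y
    else wmul (sgen s) (wmul y (sgen s))
  else y.

Lemma involWP y : reflect (y \in W n /\ forall x, ev y (ev y x) = x) (involW y).
Proof.
apply: (iffP andP) => [[yW /eqP yV]|[yW yK]]; split=> //.
  by move=> x; rewrite -{1}yV evVK.
by apply/eqP/ev_eq => x _; apply: (@ev_inj _ y); rewrite evKV yK.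
Qed.

Lemma ev_dconj s y x : asc s y -> ev (dconj s y) x = dcz (ev y) s x.
Proof.
by move=> a; rewrite /dconj a /dcz; case: ifP => _; rewrite !evM !ev_sgen.
Qed.

Lemma dconj_desc s y : ~~ asc s y -> dconj s y = y.
Proof. by rewrite /dconj => /negPf->. Qed.

Lemma comm2_sig s y x : involW y -> comm2 (ev y) s ->
  ev y (sig s x) = sig s (ev y x).
Proof.
move=> /involWP[yW yK]; have yN x' := evN x' yW; have y0 := ev0 yW.
have [_ _ si si1 s_id] := sig_evals s.
have s1 : sig 0 1%N%:Z = - 1%N%:Z by [].
have inv j : ev y x = j -> x = ev y j by move=> <-; rewrite yK.
have [->|x0] := eqVneq x 0.
  by have E0 : sig s 0 = 0 by [case_sig s (0 : int); lia]; rewrite E0 y0 E0.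
case/comm2E => // [[e1 e2]|[sp [e1 e2]]].
  have [s0|sp] := posnP s.
    move: e2; rewrite s0 => e2.
    have [->|n1] := eqVneq x 1%N%:Z; first by rewrite e2 s1 yN e2.
    have [->|n2] := eqVneq x (- 1%N%:Z); first by rewrite sigN s1 opprK yN e2 sigN s1 opprK.
    have h1 : ev y x <> 1%N%:Z by move/inv; rewrite e2; clear -n1; lia.
    have h2 : ev y x <> - 1%N%:Z by move/inv; rewrite yN e2; clear -n2; lia.
    rewrite -s0 !s_id //; clear -h1 h2 n1 n2 s0 x0 inv y0; try lia.
    by have h0 : ev y x <> 0 by [move/inv; rewrite y0; move: x0; lia]; lia.
  have [->|n1] := eqVneq x s%:Z; first by rewrite si // e1 e2 si.
  have [->|n2] := eqVneq x s.+1%:Z; first by rewrite si1 // e1 e2 si1.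
  have [->|n3] := eqVneq x (- s%:Z); first by rewrite sigN si // !yN e1 e2 sigN si.
  have [->|n4] := eqVneq x (- s.+1%:Z); first by rewrite sigN si1 // !yN e1 e2 sigN si1.
  have h1 : ev y x <> s%:Z by move/inv; rewrite e1; clear -n1; lia.
  have h2 : ev y x <> - s%:Z by move/inv; rewrite yN e1; clear -n3; lia.
  have h3 : ev y x <> s.+1%:Z by move/inv; rewrite e2; clear -n2; lia.
  have h4 : ev y x <> - s.+1%:Z by move/inv; rewrite yN e2; clear -n4; lia.
  by rewrite !s_id //; clear -h1 h2 h3 h4 n1 n2 n3 n4; lia.
have [->|n1] := eqVneq x s%:Z; first by rewrite si // e1 e2 sigN si1.
have [->|n2] := eqVneq x s.+1%:Z; first by rewrite si1 // e1 e2 sigN si.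
have [->|n3] := eqVneq x (- s%:Z); first by rewrite sigN si // !yN e1 e2 !opprK si1.
have [->|n4] := eqVneq x (- s.+1%:Z); first by rewrite sigN si1 // !yN e1 e2 !opprK si.
have h1 : ev y x <> s%:Z by move/inv; rewrite e1; clear -n4; lia.
have h2 : ev y x <> - s%:Z by move/inv; rewrite yN e1; clear -n2; lia.
have h3 : ev y x <> s.+1%:Z by move/inv; rewrite e2; clear -n3; lia.
have h4 : ev y x <> - s.+1%:Z by move/inv; rewrite yN e2; clear -n1; lia.
by rewrite !s_id //; clear -h1 h2 h3 h4 n1 n2 n3 n4; lia.
Qed.

Lemma dconj_invol s y : involW y -> involW (dconj s y).
Proof.
move=> yI; have /involWP[yW yK] := yI.
have [a|na] := boolP (asc s y); last by rewrite dconj_desc.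
apply/involWP; split.
  by rewrite /dconj a; case: ifP => _; rewrite !wmul_W ?sgen_W.
move=> x; rewrite !ev_dconj // /dcz; case: ifP => cm.
  by rewrite cm comm2_sig // yK sigK.
by rewrite cm sigK yK sigK.
Qed.

(** If y fixes the simple root of t_s, then t_s y makes it negative; otherwise y sends it to a
    different positive root, which t_s leaves positive. *)
Lemma asc_wmul_l s y : involW y -> asc s y ->
  asc s (wmul (sgen s) y) = ~~ comm2 (ev y) s.
Proof.
move=> /involWP[yW yK] a; rewrite /asc !evM !ev_sgen; apply/idP/idP.
  move=> lt; apply/negP => /comm2E [||]; first by move=> x; apply: evN.
    case=> e1 e2; move: lt; rewrite e1 e2; clear.
    by case_sig s s%:Z; case_sig s s.+1%:Z; lia.
  case=> s0 [e1 e2]; move: lt; rewrite e1 e2 !sigN; clear -s0.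
  by case_sig s s%:Z; case_sig s s.+1%:Z; lia.
have y0 := ev0 yW.
have sy0 : s = 0%N :> nat -> ev y s = 0 by move=> ->.
move: a; rewrite /asc /comm2; clear -sy0.
move: (ev y s) (ev y s.+1) sy0 => a b sy0 lt ncm.
by case_sig s a; case_sig s b; lia.
Qed.

Lemma invB_dconj s y : involW y -> asc s y ->
  invB (dconj s y) = (invB y + (if comm2 (ev y) s then 1 else 2))%N.
Proof.
move=> yI a; have /andP[yW /eqP yV] := yI.
have Esy : invB (wmul (sgen s) y) = (invB y).+1.
  rewrite -invB_inv ?wmul_W ?sgen_W // /wmul invMg sgenV yV -[(_ * _)%g]/(wmul y (sgen s)).
  exact: invB_asc.
rewrite /dconj a; case: ifP => [_|/negbT ncm]; first by rewrite Esy addn1.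
by rewrite wmulA invB_asc ?Esy ?addn2 // ?wmul_W ?sgen_W // asc_wmul_l.
Qed.

(** Summed over i with j = y i for an involution y, this is 1 plus four times the absolute length of
    y: points i, -i exchanged by y give 2 + 2, a pair of 2-cycles (a,b), (-a,-b) gives 4, and the
    position 0 gives 1. *)
Definition rk_term (i j : idx n) : nat := ((j != i) + (j == rev_ord i))%N.

(* A strict step raises the length by 2, or by 1 when s commutes with y; in the
   latter case the sum below grows by 4, so every step raises [rk] by 8. *)
Definition rk y : nat := (4 * invB y + \sum_(i : idx n) rk_term i (y i))%N.

Lemma card_moved s : (#|[set i | sgen s i != i]| = if s == 0%N :> nat then 2 else 4)%N.
Proof.
have sn := ltn_ord s.
pose L : seq int := if s == 0%N :> nat then [:: 1; -1]
  else [:: s%:Z; s.+1%:Z; - s%:Z; - s.+1%:Z].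
have Lb x : x \in L -> `|x| <= n%:Z.
  by rewrite /L; case: ifP => _; rewrite !inE; lia.
transitivity #|[set i in map (pos n) L]|.
  apply: eq_card => i; rewrite !inE -(inj_eq (@lab_inj n)) -ev_lab ev_sgen.
  have -> : (i \in map (pos n) L) = (lab i \in L).
    apply/mapP/idP => [[x xL ->]|iL]; first by rewrite pos_K ?Lb.
    by exists (lab i); rewrite ?pos_lab.
  rewrite /L; case: (nat_of_ord s =P 0%N) => s0; rewrite !inE; clear -s0;
    by case_sig s (lab i); lia.
rewrite cardsE; have /card_uniqP -> : uniq (map (pos n) L).
  rewrite map_inj_in_uniq; last first.
    by move=> x y xL yL /(congr1 (@lab n)); rewrite !pos_K ?Lb.
  rewrite /L; case: (nat_of_ord s =P 0%N) => s0 //=; rewrite ?inE; clear -s0; lia.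
by rewrite size_map /L; case: ifP.
Qed.

Lemma rk_dconj s y : involW y -> asc s y -> rk (dconj s y) = (rk y + 8)%N.
Proof.
move=> yI a; have /involWP[yW yK] := yI.
rewrite /rk invB_dconj //; case: ifP => cm; last first.
  have -> : (\sum_i rk_term i (dconj s y i) = \sum_i rk_term i (y i))%N.
    rewrite (reindex_inj (@perm_inj _ (sgen s))); apply: eq_bigr => i _.
    have -> : dconj s y (sgen s i) = sgen s (y i).
      apply: lab_inj; rewrite -!ev_lab ev_dconj // /dcz cm.
      by rewrite !ev_sgen sigK.
    have /WP sW := sgen_W s.
    by rewrite /rk_term -sW !(inj_eq (@perm_inj _ _)).
  by rewrite mulnDr addnAC.
suff -> : (\sum_i rk_term i (dconj s y i) = \sum_i rk_term i (y i) + 4)%N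
  by rewrite mulnDr addnACA.
(* Growth by 4 in both cases: for s = 0 two points gain 2 each, for s > 0 four points gain 1
   each. *)
pose m := if s == 0%N :> nat then 2%N else 1%N.
transitivity (\sum_i (rk_term i (y i) + (if sgen s i != i then m else 0)))%N; last first.
  rewrite big_split /= -big_mkcond sum_nat_const -cardsE card_moved /m.
  by case: ifP.
apply: eq_bigr => i _.
have -> : (dconj s y) i = sgen s (y i).
  by rewrite /dconj a cm /wmul permM.
rewrite /rk_term -!(inj_eq (@lab_inj n)) !lab_rev -!ev_lab !ev_sgen.
move: (lab i) => x; have C := comm2_sig x yI cm.
have [fx|nfx] := eqVneq (sig s x) x.
  by rewrite -C fx addn0.
have X : x = s \/ x = s.+1 \/ x = - s%:Z \/ x = - s.+1%:Z.
  by clear -nfx; case_sig s x; lia.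
have Y : ev y x = x \/ ((0 < s)%N /\ ev y x = - sig s x).
  have yN x' := evN x' yW; have y0 := ev0 yW.
  have [_ _ si si1 _] := sig_evals s.
  have [[e1 e2]|[sp [e1 e2]]] := comm2E yN cm.
    by left; case: X => [|[|[|]]] ->; rewrite ?yN ?e1 ?e2.
  right; split=> //.
  by case: X => [|[|[|]]] ->; rewrite ?sigN ?yN ?e1 ?e2 ?si ?si1 ?opprK.
have xx : (x == - x) = false by apply/negP; clear -nfx; case_sig s x; lia.
have sx : (sig s x == - x) = (s == 0%N :> nat).
  by apply/idP/idP; clear -nfx; case_sig s x; lia.
case: Y => [->|[sp ->]].
  by rewrite nfx sx eqxx xx /m; case: eqP.
have s0 : (s == 0%N :> nat) = false by case: eqP sp => // ->.
rewrite sigN sigK !eqr_opp eqxx (negPf nfx) /m s0.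
have -> : (- x == x) = false by rewrite eq_sym xx.
by have -> : (- sig s x == x) = false by rewrite -eqr_opp opprK sx s0.
Qed.
End InvolutionOrder.

(** * Atoms as products of the labels of chains *)

Section Demazure.
Variable n : nat.
Variable dem : {perm (idx n)} -> {perm (idx n)} -> {perm (idx n)}.
Hypothesis dem_ax : is_demazure dem.
Implicit Types (u v w y z : {perm (idx n)}) (s : 'I_n) (t : seq 'I_n).

Let demW u v : u \in W n -> v \in W n -> dem u v \in W n.
Proof. by case: dem_ax => h _ _ _; apply: h. Qed.
Let demA u v w : u \in W n -> v \in W n -> w \in W n ->
  dem u (dem v w) = dem (dem u v) w.
Proof. by case: dem_ax => _ h _ _; apply: h. Qed.
Let dems s : dem (sgen s) (sgen s) = sgen s.
Proof. by case: dem_ax. Qed.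
Let dem_add u v : u \in W n -> v \in W n ->
  invB (wmul u v) = (invB u + invB v)%N -> dem u v = wmul u v.
Proof.
by case: dem_ax => _ _ _ h uW vW E; apply: h; rewrite ?lenE ?wmul_W.
Qed.

Lemma invB_sgen s : invB (sgen s) = 1%N.
Proof.
have := @invB_asc n s 1%g (group1 _); rewrite invB1 wmul1l; apply.
by rewrite /asc !ev1; lia.
Qed.

Lemma dem1l w : w \in W n -> dem 1%g w = w.
Proof. by move=> wW; rewrite dem_add ?wmul1l ?group1 // invB1. Qed.

Lemma dem1r w : w \in W n -> dem w 1%g = w.
Proof. by move=> wW; rewrite dem_add ?wmul1 ?group1 // invB1 addn0. Qed.

(** At a descent w is the Demazure product of w t_s and t_s by additivity of lengths, and
    idempotence absorbs another t_s. *)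
Lemma dem_sgen_r s w : w \in W n ->
  dem w (sgen s) = if asc s w then wmul w (sgen s) else w.
Proof.
move=> wW; case: ifP => a.
  by rewrite dem_add ?sgen_W // invB_asc // invB_sgen addn1.
have wsW := wmul_W wW (sgen_W s).
have E : dem (wmul w (sgen s)) (sgen s) = w.
  rewrite -[RHS](wmulsK s) dem_add ?sgen_W // invB_asc ?wmul_asc ?a //.
  by rewrite invB_sgen addn1.
by rewrite -[in LHS]E -demA ?sgen_W // dems E.
Qed.

Lemma dem_sgen_l s w : w \in W n ->
  dem (sgen s) w = if asc s w^-1%g then wmul (sgen s) w else w.
Proof.
move=> wW; have wVW : w^-1%g \in W n by rewrite groupV.
have swE v : wmul (sgen s) v = (wmul v^-1%g (sgen s))^-1%g.
  by rewrite /wmul invMg invgK sgenV.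
have swW := wmul_W (sgen_W s) wW.
case: ifP => a.
  rewrite dem_add ?sgen_W // invB_sgen swE invB_inv ?wmul_W ?sgen_W //.
  by rewrite invB_asc // invB_inv.
have E : dem (sgen s) (wmul (sgen s) w) = w.
  rewrite -[RHS](wmulKs s) dem_add ?sgen_W // invB_sgen wmulKs.
  rewrite -[LHS]invB_inv // -[in LHS](wmulsK s w^-1%g).
  rewrite invB_asc ?wmul_asc ?a ?wmul_W ?sgen_W // add1n.
  by rewrite -[in RHS]invB_inv // swE invgK.
by rewrite -[in LHS]E demA ?sgen_W // dems E.
Qed.

Lemma dem_dconj s y : involW y -> dem (dem (sgen s) y) (sgen s) = dconj s y.
Proof.
move=> yI; have /andP[yW /eqP yV] := yI.
rewrite dem_sgen_l // yV /dconj; have [a|na] := boolP (asc s y).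
  rewrite dem_sgen_r ?wmul_W ?sgen_W // asc_wmul_l //.
  by case: (comm2 _ _); rewrite /= ?wmulA.
by rewrite dem_sgen_r // (negPf na).
Qed.

Fixpoint dem_word t : {perm (idx n)} :=
  if t is s :: t' then dem (dem_word t') (sgen s) else 1%g.

Lemma dem_wordW t : dem_word t \in W n.
Proof. by elim: t => [|s t IH] /=; rewrite ?group1 // demW ?sgen_W. Qed.

Lemma invB_dem_word t : (invB (dem_word t) <= size t)%N /\
  (invB (dem_word t) = size t -> dem_word t = wprod t).
Proof.
elim: t => [|s t [IH1 IH2]] /=; first by rewrite invB1.
rewrite dem_sgen_r ?dem_wordW // wprod_cons; case: ifP => a.
  by rewrite invB_asc ?dem_wordW //; split=> // -[/IH2 ->].
by split; [exact: leqW|move=> E; move: IH1; rewrite E ltnn].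
Qed.

Lemma dem_word_reduced t : invB (wprod t) = size t -> dem_word t = wprod t.
Proof.
elim: t => [//|s t IH]; rewrite wprod_cons /= => E.
have E2 : invB (wprod t) = size t.
  apply/eqP; rewrite eqn_leq invB_wprod.
  by have := invB_step s (wprod_W t); rewrite E ltnS => ->.
have a : asc s (wprod t).
  apply/negPn/negP => na.
  have := @invB_asc n s _ (wmul_W (wprod_W t) (sgen_W s)).
  by rewrite wmul_asc ?wprod_W // na wmulsK E E2 => /(_ isT); lia.
by rewrite IH // dem_sgen_r ?wprod_W // a.
Qed.

Lemma dem_word_inv t :
  (dem_word t)^-1%g \in W n /\ forall s, dem (sgen s) (dem_word t)^-1%g = (dem_word (s :: t))^-1%g.
Proof.
have DW := dem_wordW t; split=> [|s]; first by rewrite groupV.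
rewrite dem_sgen_l ?groupV // invgK /= dem_sgen_r //; case: ifP => // _.
by rewrite /wmul invMg sgenV.
Qed.

Lemma dem_word_conj y t : involW y ->
  dem (dem (dem_word t)^-1%g y) (dem_word t) = foldr (@dconj n) y t.
Proof.
move=> yI; have /andP[yW _] := yI.
elim: t => [|s t IH]; first by rewrite /= invg1 dem1l // dem1r.
have [DVW E] := dem_word_inv t; have DW := dem_wordW t.
rewrite -E /= -IH -dem_dconj; last first.
  rewrite IH; elim: (t) => [|s' t' IH'] //=; exact: dconj_invol.
rewrite !demA ?demW ?sgen_W // -!demA ?demW ?sgen_W //.
Qed.

Lemma foldr_dconj_invol y t : involW y -> involW (foldr (@dconj n) y t).
Proof. by move=> yI; elim: t => [|s t IH] //=; apply: dconj_invol. Qed.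

(** A strict chain from [y] up to [z] with labels listed from the top; in [wprod] the top label
    becomes the rightmost factor. *)
Fixpoint ichain y z t : Prop :=
  if t is s :: t' then
    exists z', [/\ involW z', asc s z', z = dconj s z' & ichain y z' t']
  else z = y.

Lemma ichain_foldr y z t : ichain y z t -> z = foldr (@dconj n) y t.
Proof. by elim: t z => [|s t IH] z //= [z' [_ _ -> /IH ->]]. Qed.

Lemma ichain_rk y z t : involW y -> ichain y z t -> rk z = (rk y + 8 * size t)%N.
Proof.
move=> yI; elim: t z => [|s t IH] z /=; first by move=> ->; rewrite muln0 addn0.
by move=> [z' [zI a -> /IH E]]; rewrite rk_dconj // E mulnS; lia.
Qed.

Lemma ichain_drop y t : involW y -> exists2 t',
  ichain y (foldr (@dconj n) y t) t' & (size t' < size t)%N \/ t' = t.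
Proof.
move=> yI; elim: t => [|s t [t' ch le]] /=; first by exists [::]; [|right].
have zI := foldr_dconj_invol t yI.
have [a|na] := boolP (asc s (foldr (@dconj n) y t)).
  exists (s :: t'); first by exists (foldr (@dconj n) y t).
  by case: le => [?|->]; [left|right].
rewrite dconj_desc //; exists t' => //; left.
by case: le => [/ltnW|->]; rewrite ltnS.
Qed.

Lemma rk_foldr y t : involW y ->
  (rk (foldr (@dconj n) y t) <= rk y + 8 * size t)%N.
Proof.
move=> yI; have [t' /(ichain_rk yI) ->] := ichain_drop t yI.
by case=> [/ltnW h|-> //]; rewrite leq_add2l leq_mul2l h.
Qed.

Lemma dem_conj_word y z v : involW y ->
  (v \in W n) && (dem (dem v^-1%g y) v == z) ->
  exists t, [/\ wprod t = v, size t = invB v & foldr (@dconj n) y t = z].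
Proof.
move=> yI /andP[vW /eqP E]; have [t Et st] := invB_word vW.
exists t; split=> //; rewrite -dem_word_conj // dem_word_reduced; last by rewrite Et.
by rewrite Et.
Qed.

(* A chain cannot be longer than a reduced word of the Demazure product of its
   labels, because every step of the weak order raises the rank by 8. *)
Lemma ichain_reduced y z t : involW y -> ichain y z t ->
  [/\ dem_word t = wprod t, invB (wprod t) = size t &
      dem (dem (wprod t)^-1%g y) (wprod t) = z].
Proof.
move=> yI ch; have E := ichain_foldr ch; have := dem_word_conj t yI; rewrite -E => Eu.
have [|t2 [Et2 st2 f2]] := @dem_conj_word y z (dem_word t) yI.
  by rewrite dem_wordW Eu /=.
have [le eq] := invB_dem_word t.
have Es : invB (dem_word t) = size t.
  apply/eqP; rewrite eqn_leq le /= -st2.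
  by have := rk_foldr t2 yI; rewrite f2 (ichain_rk yI ch) leq_add2l leq_mul2l.
by rewrite -(eq Es).
Qed.

(** A reduced word of a minimal solution has no idle letter, since dropping it would yield a shorter
    solution by [ichain_reduced]. Conversely, the rank shows that no word leading from y to z is
    shorter than a chain. *)
Lemma atomsP y z w : involW y ->
  (w \in atoms dem y z) <-> exists2 t, ichain y z t & wprod t = w.
Proof.
move=> yI; rewrite /atoms inE inE; split.
  case/andP=> wsol /forallP min.
  have [t [Et st ft]] := dem_conj_word yI wsol.
  have [t' ch' le] := ichain_drop t yI; rewrite ft in ch'.
  have [_ E2 E3] := ichain_reduced yI ch'.
  have := min (wprod t'); rewrite inE wprod_W E3 eqxx /=.
  case/andP: wsol => wW _.
  rewrite !lenE ?wprod_W // E2 -st => le'.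
  case: le => [lt|Et']; first by move: le'; rewrite leqNgt lt.
  by exists t => //; rewrite -Et'.
case=> t ch Et; have [E1 E2 E3] := ichain_reduced yI ch.
rewrite -Et wprod_W E3 eqxx /=.
apply/forallP => v; apply/implyP; rewrite inE => vsol.
have [t3 [E s3 f3]] := dem_conj_word yI vsol; case/andP: vsol => vW _.
rewrite !lenE ?wprod_W // E2 -s3.
by have := rk_foldr t3 yI; rewrite f3 (ichain_rk yI ch) leq_add2l leq_mul2l.
Qed.

End Demazure.

(** * Words and shapes along a chain *)

Section ChainWords.
Variable n : nat.
Implicit Types (u v w y z : {perm (idx n)}) (s : 'I_n) (t : seq 'I_n).

Lemma ev_yBC k x : (k <= n)%N -> ev (yBC n k) x = if `|x| <= k%:Z then - x else x.
Proof.
move=> kn; have [hx|hx] := boolP (`|x| <= n%:Z); last first.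
  by rewrite ev_out; last lia; case: ifP => //; lia.
rewrite /ev hx.
suff H m : (m <= k)%N ->
    (\prod_(i < m) tperm (pos n (- (i.+1)%:Z)) (pos n (i.+1)%:Z))%g (pos n x) =
    pos n (if `|x| <= m%:Z then - x else x).
  by rewrite /yBC H // pos_K //; case: ifP => _; lia.
elim: m => [|m IH] mk; first by rewrite big_ord0 perm1; case: ifP => // h; congr pos; lia.
rewrite big_ord_recr permM IH /=; last exact: ltnW.
rewrite tperm_pos; [|lia|lia|by case: ifP => _; lia].
congr pos; do !case: eqP; case: ifP; case: ifP; lia.
Qed.

Lemma yBC_involW k : (k <= n)%N -> involW (yBC n k).
Proof.
move=> kn; apply/involWP; split.
  by apply: ev_W => x _; rewrite !ev_yBC // normrN; case: ifP.
move=> x; rewrite !ev_yBC //; case: (boolP (`|x| <= k%:Z)) => h.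
  by rewrite normrN h opprK.
by rewrite (negPf h).
Qed.

Lemma wwordE w : wword w = [seq ev w i%:Z | i <- iota 1 n].
Proof.
apply/eq_in_map => i; rewrite mem_iota => /andP[i0 ilt].
by rewrite -ev_lab pos_K //; lia.
Qed.

Lemma wword_sgen s u : wword (wmul (sgen s) u) = map (sig s) (wword u).
Proof. by rewrite !wwordE -map_comp; apply: eq_map => i /=; rewrite evM ev_sgen. Qed.

Definition signed_word (l : seq int) :=
  regular l /\ forall j : nat, (0 < j <= n)%N -> j%:Z \in l \/ - j%:Z \in l.

Lemma absz_sig s (e : int) : absz (sig s e) = absz (sig s (absz e)%:Z).
Proof.
have [->|->] : e = absz e \/ e = - (absz e)%:Z by lia.
  by rewrite absz_nat.
by rewrite abszN absz_nat sigN abszN.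
Qed.

Lemma signed_word_sig s l : signed_word l -> signed_word (map (sig s) l).
Proof.
case=> reg full; split.
  rewrite /regular -map_comp (eq_map (g := (fun j : nat => absz (sig s j%:Z)) \o absz)); last first.
    by move=> e /=; exact: absz_sig.
  have -> : 0%N = absz (sig s 0%N%:Z) by case_sig s (0%N : int); lia.
  rewrite (map_comp (fun j : nat => absz (sig s j%:Z))) -[X in uniq X]/(map _ (0%N :: _)).
  rewrite map_inj_uniq // => i j; case_sig s i%:Z; case_sig s j%:Z; lia.
move=> j /andP[j0 jn].
have [i /andP[i0 ilt] E] : exists2 i, (0 < i <= n)%N & sig s i%:Z = j \/ sig s i%:Z = - j%:Z.
  have sn := ltn_ord s; exists (absz (sig s j)); first by case_sig s j%:Z; lia.
  have [->|->] : (absz (sig s j))%:Z = sig s j \/ (absz (sig s j))%:Z = - sig s j by lia.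
    by left; rewrite sigK.
  by right; rewrite sigN sigK.
have [|h|h] := full i; rewrite ?i0 //; have := map_f (sig s) h; rewrite ?sigN.
  by case: E => ->; [left|right].
by case: E => ->; rewrite ?opprK; [right|left].
Qed.

Lemma red_sortedE l D x : red l D x -> sorted <=%R l -> D = [::] /\ x = l.
Proof.
by case=> // L R b a {}D {}x ab _ /sorted_adjP h; have := h _ _ _ _ erefl; lia.
Qed.

(** The word is increasing and admits no deletion, so goodness concerns its letters only: y_k
    negates 1, ..., k and fixes the rest. *)
Lemma gBC_word k : (k <= n)%N -> let l := wword (gBC n k) in
  [/\ signed_word l, sorted <=%R l, goodword (ev (yBC n k)) l &
   forall e : int, e < 0 -> (e \in l) = (`|e| <= k%:Z)].
Proof.
move=> kn /=; rewrite wword_gBC //; set l := _ ++ _.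
have mem e : (e \in l) = if e < 0 then `|e| <= k%:Z else k%:Z < e <= n%:Z.
  rewrite mem_cat; apply/orP/idP => [[]/mapP[j]|].
  - by rewrite mem_rev mem_iota => ? ->; case: ifP; lia.
  - by rewrite mem_iota => ? ->; case: ifP; lia.
  case: ifP => [e0 ek|e0 ek]; [left|right]; apply/mapP; exists (absz e).
  - by rewrite mem_rev mem_iota; lia.
  - by lia.
  - by rewrite mem_iota; lia.
  - by lia.
have ls : sorted <=%R l.
  apply: sorted_cat_le.
  - rewrite map_rev -rev_sorted revK sorted_map.
    apply: sub_sorted (iota_ltn_sorted 1 k) => i j ij.
    by change (is_true (- j%:Z <= - i%:Z)); move: ij => /=; lia.
  - rewrite sorted_map; apply: sub_sorted (iota_ltn_sorted _ _) => i j ij.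
    by change (is_true (i%:Z <= j%:Z)); move: ij => /=; lia.
  - move=> a b /mapP[i _ ->] /mapP[j _ ->]; lia.
split=> //; last by move=> e e0; rewrite mem e0.
  split.
    rewrite /regular /l map_cat -!map_comp.
    rewrite (eq_map (g := id)); last by move=> j /=; lia.
    rewrite [X in _ ++ X](eq_map (g := id)); last by move=> j /=; lia.
    rewrite !map_id /= cat_uniq rev_uniq !iota_uniq andbT /=.
    rewrite mem_cat mem_rev !mem_iota negb_or /=.
    by apply/hasPn => j; rewrite mem_rev !mem_iota; lia.
  move=> j jn; rewrite !mem; case: (leqP j k) => h; [right|left].
    have e : (- j%:Z < 0) = true by lia.
    by rewrite e normrN; move: h; clear; lia.
  have -> : (j%:Z < 0) = false by lia.
  by move: h jn; clear; lia.
move=> D x /red_sortedE /(_ ls) [-> ->]; split=> //.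
apply/allP => e; rewrite mem /goodlet ev_yBC //; case: ifP => e0 h.
  by rewrite h; lia.
by case: ifP; lia.
Qed.

Definition chain_word k t : seq int := wword (wmul (wprod t)^-1%g (gBC n k)).

Lemma chain_word_cons k s t : chain_word k (s :: t) = map (sig s) (chain_word k t).
Proof.
by rewrite /chain_word wprod_cons -wword_sgen /wmul invMg sgenV mulgA.
Qed.

Lemma goodword_eq (z1 z2 : int -> int) l : z1 =1 z2 -> goodword z1 l -> goodword z2 l.
Proof.
move=> E h D x /h [/allP hD /allP hx]; split.
  by apply/allP => d /hD; rewrite /goodpair !E.
by apply/allP => e /hx; rewrite /goodlet !E.
Qed.

Lemma chain_good k z t : (k <= n)%N -> ichain (yBC n k) z t ->
  signed_word (chain_word k t) /\ goodword (ev z) (chain_word k t).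
Proof.
move=> kn; elim: t z => [|s t IH] z /=.
  move=> ->; rewrite /chain_word /wprod /= invg1 wmul1l.
  by have [] := gBC_word kn.
case=> z' [zI a -> /IH [sw gw]]; rewrite chain_word_cons.
have sw' := signed_word_sig s sw; split=> //.
have /involWP[zW zK] := zI.
apply: (goodword_eq (z1 := dcz (ev z') s)).
  by move=> x; rewrite ev_dconj.
apply: goodword_sig => //.
- by move=> x; apply: evN.
- by case: sw.
- move=> j j0 jE; apply: (sw.2); have := ltn_ord s.
  by case/orP: jE => /eqP E; lia.
Qed.

End ChainWords.

Lemma red_letters l D x : red l D x ->
  (forall d, d \in D -> d.1 \in l /\ d.2 \in l) /\ {subset x <= l}.
Proof.
elim=> [y|L R b a {}D {}x ab _ [h1 h2]]; first by split.
have sub : {subset L ++ R <= L ++ [:: b, a & R]}.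
  by move=> e; rewrite !mem_cat !inE => /orP[->//|->]; rewrite !orbT.
split=> [d|e /h2/sub //]; rewrite inE => /orP[/eqP->|/h1[/sub ? /sub ?]] //=.
by rewrite !mem_cat !inE !eqxx !orbT.
Qed.

(** * Shapes along a chain *)

Section Shapes.
Variable n : nat.
Implicit Types (u v w y z : {perm (idx n)}) (s : 'I_n) (t : seq 'I_n).
Implicit Types (S : {set idx n}) (D : seq (int * int)) (x : seq int).

Definition pairblk (d : int * int) S : bool :=
  [&& 0 < d.1, d.1 < - d.2 & (S == [set pos n d.1; pos n (- d.2)])
                  || (S == [set pos n (- d.1); pos n d.2])].

Definition letblk (e : int) S : bool := (e < 0) && (S == [set pos n e; pos n (- e)]).

Definition redshape D x : {set {set idx n}} :=
  [set S | has (pairblk^~ S) D || has (letblk^~ S) x].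

Lemma shape_red u : exists D x, red (wword u) D x /\ Defs.shape u = redshape D x.
Proof.
have [D [h1 h2]] := @greedy_red [::] [::] (wword u) erefl.
exists D, (delete_descents [::] [::] (wword u)).1; split=> //.
rewrite /Defs.shape /NDes /xi h2 /redshape; apply/setP => S; rewrite !inE.
by rewrite -[catrev D [::]]/(rev D) has_rev.
Qed.

Lemma wword_bound u e : e \in wword u -> `|e| <= n%:Z.
Proof. by case/mapP => i _ ->; apply: lab_bound. Qed.

Lemma redshapeP D x S : reflect
  ((exists2 d, d \in D & [/\ 0 < d.1, d.1 < - d.2 &
       S = [set pos n d.1; pos n (- d.2)] \/ S = [set pos n (- d.1); pos n d.2]]) \/
   exists2 e, e \in x & e < 0 /\ S = [set pos n e; pos n (- e)])
  (S \in redshape D x).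
Proof.
rewrite inE; apply: (iffP orP) => -[].
- case/hasP => d dD /and3P[h1 h2 h]; left; exists d => //; split=> //.
  by case/orP: h => /eqP; [left|right].
- by case/hasP => e ex /andP[e0 /eqP ->]; right; exists e.
- case=> d dD [h1 h2 h]; left; apply/hasP; exists d => //.
  by rewrite /pairblk h1 h2; case: h => ->; rewrite eqxx ?orbT.
- by case=> e ex [e0 ->]; right; apply/hasP; exists e => //; rewrite /letblk e0 eqxx.
Qed.

(** Serves to keep the blocks away from the points moved by a commuting step, and to show that the
    other steps preserve the order of the matched points. *)
Lemma redshape_neg z l D x S i : involW z -> goodword (ev z) l ->
  (forall e, e \in l -> `|e| <= n%:Z) -> red l D x ->
  S \in redshape D x -> i \in S -> ev z (lab i) = - lab i /\ lab i != 0.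
Proof.
move=> /involWP[zW zK] gw bd r; have [rD rx] := red_letters r.
have [/allP hD /allP hx] := gw _ _ r; have zN e := evN e zW.
case/redshapeP => [[[b a] /= dD [b0 ba h]]|[e ex [e0 ->]]] iS.
  have /= [/bd b1 /bd a1] := rD _ dD.
  have := goodpairE zK (hD _ dD) => -[_ [|[_ [zb za]]]]; first by lia.
  have : (lab i = b \/ lab i = - a) \/ (lab i = - b \/ lab i = a).
    case: h iS => ->; rewrite !inE => /orP[] /eqP ->; rewrite pos_K ?normrN //; tauto.
  by case=> [[->|->]|[->|->]]; rewrite ?zN ?za ?zb; split=> //; lia.
have e1 := bd _ (rx _ ex).
have := goodletE (hx _ ex) => ge.
have : lab i = e \/ lab i = - e.
  by move: iS; rewrite !inE => /orP[] /eqP ->; rewrite pos_K ?normrN //; tauto.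
by case=> ->; rewrite ?zN; split; lia.
Qed.

Lemma sgen_pos s (x : int) : `|x| <= n%:Z -> sgen s (pos n x) = pos n (sig s x).
Proof. by move=> h; rewrite ev_pos // ev_sgen. Qed.

Lemma sgen_sgen s i : sgen s (sgen s i) = i.
Proof. by apply: lab_inj; rewrite -!ev_lab !ev_sgen sigK. Qed.

Lemma imset_sgenK s : involutive (fun S => sgen s @: S).
Proof.
by move=> S; rewrite -imset_comp -[RHS]imset_id; apply: eq_imset => i /=; rewrite sgen_sgen.
Qed.

Definition sgen_blocks s (M : {set {set idx n}}) : {set {set idx n}} :=
  (fun S => sgen s @: S) @: M.

Lemma mem_imset_sgen s (M : {set {set idx n}}) S :
  (S \in sgen_blocks s M) = (sgen s @: S \in M).
Proof.
by rewrite /sgen_blocks -{1}(imset_sgenK s S) (mem_imset _ _ (inv_inj (imset_sgenK s))).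
Qed.

Lemma imset_set2 (T1 T2 : finType) (f : T1 -> T2) a b : f @: [set a; b] = [set f a; f b].
Proof. by rewrite imsetU !imset_set1. Qed.

Lemma redshape_step k z' s t D x : (k <= n)%N -> involW z' -> asc s z' ->
  ichain (yBC n k) z' t -> red (chain_word k (s :: t)) D x ->
  exists D0 x0, red (chain_word k t) D0 x0 /\
  [\/ ~~ comm2 (ev z') s /\ redshape D x = sgen_blocks s (redshape D0 x0),
      [/\ (0 < s)%N, ev z' s = s, ev z' s.+1 = s.+1 & redshape D x = redshape D0 x0],
      [/\ (0 < s)%N, ev z' s = - s.+1%:Z, ev z' s.+1 = - s%:Z & redshape D x =
         [set pos n s; pos n s.+1] |: ([set pos n (- s%:Z); pos n (- s.+1%:Z)] |:
            redshape D0 x0)] |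
      [/\ s = 0%N :> nat, ev z' 1 = 1 &
         redshape D x = [set pos n (-1); pos n 1] |: redshape D0 x0]].
Proof.
move=> kn zI a ch; have [[reg full] gw] := chain_good kn ch.
have /involWP[zW zK] := zI; have zN e := evN e zW.
have bd e : e \in chain_word k t -> `|e| <= n%:Z by apply: wword_bound.
rewrite chain_word_cons => r.
have fl (j : nat) : (0 < j)%N -> (j == s) || (j == s.+1) ->
    j%:Z \in chain_word k t \/ - j%:Z \in chain_word k t.
  by move=> j0 jE; apply: full; have := ltn_ord s; case/orP: jE => /eqP E; lia.
have [D0 [x0 [r0 H]]] := red_step_cases zN zK a gw reg fl r.
exists D0, x0; split=> //; have [rD rx] := red_letters r0.
have [/allP hD /allP hx] := gw _ _ r0; have rr := red_regular r0 reg.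
(* If the visible part of the reduction grows by the pairs in [E1] and the letters in [E2], the
   shape grows by their blocks. The cases below use a singleton or nothing. *)
have ext E1 E2 : (forall d, negpair d -> (d \in D) = E1 d || (d \in D0)) ->
    (forall e, e < 0 -> (e \in x) = E2 e || (e \in x0)) -> forall S,
    (S \in redshape D x) = [|| S \in redshape D0 x0,
       `[< exists2 d, E1 d & pairblk d S >] | `[< exists2 e, E2 e & letblk e S >]].
  move=> h1 h2 S; rewrite inE; apply/idP/idP.
    case/orP => /hasP[d dD dS].
      move: (dD); rewrite h1; last by case/and3P: dS => d1 d2 _; rewrite /negpair d1 d2.
      case/orP=> dE; first by apply/or3P/Or32/asboolP; exists d.
      by rewrite inE; apply/or3P/Or31/orP; left; apply/hasP; exists d.
    move: (dD); rewrite h2; last by case/andP: dS.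
    case/orP=> dE; first by apply/or3P/Or33/asboolP; exists d.
    by rewrite inE; apply/or3P/Or31/orP; right; apply/hasP; exists d.
  case/or3P => [|/asboolP[d dE dS]|/asboolP[e eE eS]].
  - rewrite inE => /orP[] /hasP[d dD dS]; apply/orP; [left|right];
      apply/hasP; exists d => //.
    + by rewrite h1 ?dD ?orbT //; case/and3P: dS => d1 d2 _; rewrite /negpair d1 d2.
    + by rewrite h2 ?dD ?orbT //; case/andP: dS.
  - apply/orP; left; apply/hasP; exists d => //; rewrite h1 ?dE //.
    by case/and3P: dS => d1 d2 _; rewrite /negpair d1 d2.
  - apply/orP; right; apply/hasP; exists e => //; rewrite h2 ?eE //.
    by case/andP: eS.
case: H => [[ncm ED Ex]|[zf ED Ex]|[s0 zs ED Ex]|[s0 z1 ED Ex]].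
- apply: Or41; split=> //; apply/setP => S; rewrite mem_imset_sgen.
  rewrite !inE ED Ex !has_map; congr (_ || _); apply: eq_in_has.
    move=> [b c] dD /=; have /= [/bd b1 /bd c1] := rD _ dD.
    have [b0 c0 bc] := rr _ dD.
    have [_] := goodpair_noncomm zN zK a ncm b0 c0 bc (hD _ dD).
    rewrite /pairblk /negpair /= => E; rewrite !andbA E; congr (_ && _).
    rewrite -!sigN -!sgen_pos ?normrN // -!imset_set2.
    by rewrite !(can2_eq (imset_sgenK s) (imset_sgenK s)).
  move=> e ex /=; have e1 := bd _ (rx _ ex).
  have [_ E] := goodlet_noncomm zN a ncm (hx _ ex).
  rewrite /letblk E -sigN -!sgen_pos ?normrN // -imset_set2; congr (_ && _).
  by rewrite (can2_eq (imset_sgenK s) (imset_sgenK s)).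
- case/and3P: zf => s0 /eqP zs /eqP zs1.
  apply: Or42; split=> //; apply/setP => S.
  rewrite (ext xpred0 xpred0) //.
  have -> : `[< exists2 d : int * int, false & pairblk d S >] = false by apply/asboolP => -[].
  have -> : `[< exists2 e : int, false & letblk e S >] = false by apply/asboolP => -[].
  by rewrite !orbF.
- have zs1 : ev z' s.+1 = - s%:Z by rewrite -[s.+1%:Z]opprK -zs zN zK.
  apply: Or43; split=> //; apply/setP => S.
  rewrite (ext (pred1 (s%:Z, - s.+1%:Z)) xpred0) // !in_setU1.
  have -> : `[< exists2 e : int, false & letblk e S >] = false by apply/asboolP => -[].
  rewrite orbF orbC orbA; congr (_ || _).
  transitivity (pairblk (s%:Z, - s.+1%:Z) S).
    apply/idP/idP => [/asboolP[d /eqP ->]//|h].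
    by apply/asboolP; exists (s%:Z, - s.+1%:Z) => //=.
  rewrite /pairblk opprK [(s%:Z, _).1]/= [(s%:Z, _).2]/=.
  have -> : 0 < s%:Z by lia.
  by have -> : s%:Z < s.+1%:Z by lia.
- apply: Or44; split=> //; apply/setP => S.
  rewrite (ext xpred0 (pred1 (-1))) // in_setU1 /=.
  have -> : `[< exists2 d : int * int, false & pairblk d S >] = false by apply/asboolP => -[].
  rewrite orbC; congr (_ || _).
  apply/idP/idP => [/asboolP[e /eqP ->]|h].
    by rewrite /letblk opprK.
  by apply/asboolP; exists (-1) => //=; rewrite /letblk opprK h.
Qed.

End Shapes.

(** * Clans *)

Section ClanStructure.
Variable n : nat.
Implicit Types (c : clan n) (i j : idx n) (s : 'I_n) (y : {perm (idx n)}).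

Lemma lab0P i : (lab i == 0) = (i == pos n 0).
Proof. by rewrite -(inj_eq (@lab_inj n)) pos_K. Qed.

Lemma clan_invE c i : clan_inv c i = mate c i.
Proof. by rewrite permE. Qed.

Lemma clan_invK c i : clan_inv c (clan_inv c i) = i.
Proof. by rewrite !clan_invE mateK. Qed.

Lemma is_signE c i : is_sign (c i) = (clan_inv c i == i).
Proof.
rewrite clan_invE /mate; case E: (c i) => [b|j] /=; first by rewrite eqxx.
by have /forallP/(_ i) := csymP c; rewrite E => /andP[/negPf->].
Qed.

Definition sgn c i : bool := c i == inl true.

Lemma clanE c i : c i = if clan_inv c i == i then inl (sgn c i) else inr (clan_inv c i).
Proof.
rewrite -is_signE clan_invE /mate /sgn; case: (c i) => [[]|j] //=.
Qed.

Lemma clan_ext c c' : clan_inv c = clan_inv c' ->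
  (forall i, clan_inv c i = i -> sgn c i = sgn c' i) -> c = c'.
Proof.
move=> E h; apply: val_inj; apply/ffunP => i /=.
by rewrite [LHS]clanE [RHS]clanE -E; case: eqP => // /h ->.
Qed.

Lemma signsE c : signs c = [seq sgn c i | i <- enum (idx n) & clan_inv c i == i].
Proof.
rewrite /signs; elim: (enum _) => [//|i l IH] /=.
by rewrite -is_signE IH; case E: (c i) => [[]|j] //=; rewrite /sgn E.
Qed.

Lemma clan_signs_inj c c' : clan_inv c = clan_inv c' -> signs c = signs c' -> c = c'.
Proof.
move=> E; rewrite !signsE E => h; apply: clan_ext => // i; rewrite E => /eqP ic.
have {}ic : i \in [seq i <- enum (idx n) | clan_inv c' i == i].
  by rewrite mem_filter ic mem_enum.
by move/eq_in_map: h; apply.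
Qed.

Definition clan_of c y (f : idx n -> bool) : clan n :=
  insubd c [ffun i => if y i == i then inl (f i) else inr (y i)].

Lemma clan_ofE c y f i : (forall i, y (y i) = i) ->
  clan_of c y f i = if y i == i then inl (f i) else inr (y i).
Proof.
move=> yK; rewrite /clan_of -[csym _]/(val _) val_insubd ifT ?ffunE //.
apply/forallP => j; rewrite !ffunE; case: eqP => // /eqP nj.
by rewrite nj /= ffunE yK [j == _]eq_sym (negPf nj) eqxx.
Qed.

Lemma clan_of_inv c y f : (forall i, y (y i) = i) -> clan_inv (clan_of c y f) = y.
Proof.
move=> yK; apply/permP => i; rewrite clan_invE /mate clan_ofE //.
by case: eqP.
Qed.

Lemma sgn_clan_of c y f i : (forall i, y (y i) = i) -> y i = i ->
  sgn (clan_of c y f) i = f i.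
Proof. by move=> yK yi; rewrite /sgn clan_ofE // yi eqxx; case: (f i). Qed.

Lemma reversalP c : clan_reversal c = c <->
  (clan_inv c \in W n /\ forall i, sgn c (rev_ord i) = sgn c i).
Proof.
split=> [h|[/WP h1 h2]].
  have hi i := congr1 (fun f : {ffun idx n -> symbol n} => f i) h.
  split=> [|i].
    apply/WP => i; rewrite !clan_invE /mate -[X in match X with inr j => _ | _ => _ end]hi.
    by rewrite ffunE rev_ordK; case: (c i).
  by rewrite /sgn -hi ffunE rev_ordK; case: (c i).
apply/ffunP => i; rewrite ffunE [RHS]clanE clanE h1 h2 (inj_eq rev_ord_inj).
by case: eqP => //; rewrite rev_ordK.
Qed.

Definition sval (x : symbol n) : int :=
  match x with inl true => 1 | inl false => -1 | inr _ => 0 end.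

Lemma sval_sum c : #|[set i | c i == inl true]|%:Z - #|[set i | c i == inl false]|%:Z
  = \sum_i sval (c i).
Proof.
have card_sum (P : pred (idx n)) : #|[set i | P i]|%:Z = \sum_i (P i : nat)%:Z.
  by rewrite -sum1_card big_mkcond (big_morph Posz PoszD erefl) /=;
    apply: eq_bigr => i _; rewrite inE; case: (P i).
rewrite !card_sum -sumrB; apply: eq_bigr => i _.
by case: (c i) => [[]|j].
Qed.

End ClanStructure.

Lemma sig_moved (i : nat) x : sig i x != x ->
  x = i \/ x = i.+1 \/ x = - i%:Z \/ x = - i.+1%:Z.
Proof. by move=> nfx; case_sig i x; lia. Qed.

(** * The action of the generators on clans *)

Section ClanAction.
Variable n : nat.
Variable dem : {perm (idx n)} -> {perm (idx n)} -> {perm (idx n)}.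
Hypothesis dem_ax : is_demazure dem.
Implicit Types (c : clan n) (i j : idx n) (s : 'I_n) (y : {perm (idx n)}).

(* For s = 0 the first condition always holds, as c_0 is a sign. *)
Definition both_signs s c : bool :=
  (ev (clan_inv c) s == s) && (ev (clan_inv c) s.+1 == s.+1).

Definition allowed s c : bool := both_signs s c ==> (c (pos n s) != c (pos n s.+1)).

(* The rules (i)-(iii) in one formula: signs are moved by t_s, and the last factor
   reverses c_0 in case (iii). *)
Definition cstep s c : clan n :=
  clan_of c (dconj s (clan_inv c)) (fun i =>
    sgn c (sgen s i) (+) [&& s == 0%N :> nat, i == pos n 0 & both_signs s c]).

Lemma sign_pos c x : `|x| <= n%:Z -> is_sign (c (pos n x)) = (ev (clan_inv c) x == x).
Proof. by move=> hx; rewrite is_signE ev_pos // pos_eq // ev_bound. Qed.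

Lemma clan_involW c : clan_reversal c = c -> involW (clan_inv c).
Proof.
case/reversalP => cW _; apply/involWP; split=> // x.
have [h|h] := boolP (`|x| <= n%:Z); last by rewrite !ev_out //; lia.
by rewrite -(pos_K h) !ev_lab clan_invK.
Qed.

Lemma both_asc s c : both_signs s c -> asc s (clan_inv c).
Proof. by case/andP => /eqP e1 /eqP e2; rewrite /asc e1 e2; lia. Qed.

Lemma both_comm s c : both_signs s c -> comm2 (ev (clan_inv c)) s.
Proof. by rewrite /comm2 /both_signs => ->. Qed.

Section Symmetric.
Variables (s : 'I_n) (c : clan n).
Hypothesis c_rev : clan_reversal c = c.
Hypothesis c_asc : asc s (clan_inv c).

Let y := clan_inv c.
Let yI : involW y. Proof. exact: clan_involW. Qed.
Let yW : y \in W n. Proof. by case/andP: yI. Qed.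
Let yK x : ev y (ev y x) = x. Proof. by have /involWP[] := yI. Qed.
Let c_sgn i : sgn c (rev_ord i) = sgn c i. Proof. by have /reversalP[] := c_rev. Qed.

Lemma dconjK i : dconj s y (dconj s y i) = i.
Proof.
have /involWP[_ h] := dconj_invol s yI.
by apply: lab_inj; rewrite -!ev_lab h.
Qed.

Lemma both_moved x : both_signs s c -> sig s x != x -> ev y x = x.
Proof.
case/andP=> /eqP e1 /eqP e2 /sig_moved.
by case=> [->|[->|[->|->]]]; rewrite ?evN // ?e1 ?e2.
Qed.

Lemma dconj_both i : both_signs s c -> dconj s y i = sgen s (y i).
Proof. by move=> b; rewrite /dconj c_asc both_comm // /wmul permM. Qed.

Lemma fixed_both i : both_signs s c ->
  (dconj s y i == i) = (y i == i) && (sgen s i == i).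
Proof.
move=> b; rewrite dconj_both // -!(inj_eq (@lab_inj n)) -!ev_lab !ev_sgen.
move: (lab i) => x; have C := comm2_sig x yI (both_comm b).
have [fx|nfx] := eqVneq (sig s x) x; first by rewrite -C fx andbT.
by rewrite andbF both_moved // (negPf nfx).
Qed.

Lemma fixed_conj i : ~~ both_signs s c ->
  (dconj s y i == i) = (y (sgen s i) == sgen s i).
Proof.
move=> nb; rewrite -!(inj_eq (@lab_inj n)) -!ev_lab ev_sgen ev_dconj // /dcz.
move: (lab i) => x; case: ifP => cm; last by rewrite (can2_eq (sigK s) (sigK s)).
have C := comm2_sig x yI cm.
have [fx|nfx] := eqVneq (sig s x) x; first by rewrite -C fx.
have yN e := evN e yW.
have [[e1 e2]|[s0 [e1 e2]]] := comm2E yN cm.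
  by case/negP: nb; rewrite /both_signs -/y e1 e2 !eqxx.
have [_ _ si si1 _] := sig_evals s.
by case: (sig_moved nfx) => [->|[->|[->|->]]];
  rewrite ?sigN ?yN ?si ?si1 // ?e1 ?e2 ?sigN ?opprK ?si ?si1 //; lia.
Qed.

Lemma cstep_inv : clan_inv (cstep s c) = dconj s y.
Proof. by rewrite clan_of_inv //; exact: dconjK. Qed.

Lemma sgn_cstep i : dconj s y i = i ->
  sgn (cstep s c) i = sgn c (sgen s i) (+) [&& s == 0%N :> nat, i == pos n 0 & both_signs s c].
Proof. by move=> h; rewrite sgn_clan_of //; exact: dconjK. Qed.

Lemma sgn_nfix c' i : clan_inv c' i != i -> sgn c' i = false.
Proof. by move=> h; rewrite /sgn clanE (negPf h). Qed.

Lemma sval_clan c' i : sval (c' i) =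
  if clan_inv c' i == i then (-1) ^+ (~~ sgn c' i) else 0.
Proof. by rewrite clanE; case: ifP => //= h; case: (sgn c' i). Qed.

Lemma rev_pos0 i : (rev_ord i == pos n 0) = (i == pos n 0).
Proof. by rewrite -!lab0P lab_rev oppr_eq0. Qed.

Lemma cstep_rev : clan_reversal (cstep s c) = cstep s c.
Proof.
have /involWP[dW _] := dconj_invol s yI.
apply/reversalP; rewrite cstep_inv; split=> // i.
have [h|h] := eqVneq (dconj s y i) i; last first.
  rewrite !sgn_nfix ?cstep_inv //.
  by have /WP -> := dW; rewrite (inj_eq rev_ord_inj).
rewrite !sgn_cstep //; last by have /WP -> := dW; rewrite h.
by have /WP -> := sgen_W s; rewrite c_sgn rev_pos0.
Qed.

Lemma cstep_neq : cstep s c != c.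
Proof.
apply/eqP => E; have := rk_dconj yI c_asc.
by rewrite -cstep_inv E -/y; lia.
Qed.

(** Two signs whose positions are reversed by t_s would, by symmetry of the clan, force s and s+1 to
    be signs. This is why the sequence of signs survives the relabelling. *)
Lemma sgen_mono i j : ~~ both_signs s c -> y i == i -> y j == j ->
  (i < j)%N -> (sgen s i < sgen s j)%N.
Proof.
move=> nb iy jy ij.
have lab_lt (a b : idx n) : (a < b)%N = (lab a < lab b) by rewrite /lab; lia.
move: iy jy ij; rewrite !lab_lt -!(inj_eq (@lab_inj n)) -!ev_lab !ev_sgen.
move: (lab i) (lab j) => a b /eqP ea /eqP eb ab.
have yN e := evN e yW.
rewrite ltNge; apply/negP => le; case/negP: nb; rewrite /both_signs -/y.
have [[E1 E2]|[[E1 E2]|[s0 [E1 E2]]]] : (a = s /\ b = s.+1) \/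
  (a = - s.+1%:Z /\ b = - s%:Z) \/ (s = 0%N :> nat /\ (a = - 1%N%:Z /\ b = 1%N%:Z)).
  exact: sig_inversion ab le.
- by rewrite -E1 -E2 ea eb !eqxx.
- have -> : s%:Z = - b by rewrite E2 opprK.
  have -> : s.+1%:Z = - a by rewrite E1 opprK.
  by rewrite !yN ea eb !eqxx.
- by rewrite s0 ev0 // -E2 eb !eqxx.
Qed.

Lemma signs_cstep : ~~ both_signs s c -> signs (cstep s c) = signs c.
Proof.
move=> nb; rewrite !signsE cstep_inv -/y.
set L := [seq i <- enum (idx n) | y i == i].
pose lt_ord := relpre (@nat_of_ord n.*2.+1) ltn.
have lt_tr : transitive lt_ord by move=> a b d; apply: ltn_trans.
have lt_irr : irreflexive lt_ord by move=> a; apply: ltnn.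
have enum_s : sorted lt_ord (enum (idx n)).
  by rewrite -sorted_map val_enum_ord iota_ltn_sorted.
have -> : [seq i <- enum (idx n) | dconj s y i == i] = map (sgen s) L.
  apply: (irr_sorted_eq lt_tr lt_irr).
  - exact: sorted_filter.
  - rewrite sorted_map; apply: (@sub_in_sorted _ [pred i | y i == i] lt_ord).
    + by move=> i j; rewrite !inE => iy jy; apply: sgen_mono.
    + by apply/allP => i; rewrite mem_filter => /andP[].
    + exact: sorted_filter.
  move=> i; rewrite mem_filter mem_enum andbT fixed_conj //.
  have -> : i = sgen s (sgen s i) by rewrite sgen_sgen.
  by rewrite (mem_map (@perm_inj _ _)) mem_filter mem_enum andbT sgen_sgen.
rewrite -map_comp; apply/eq_in_map => i; rewrite mem_filter => /andP[/eqP iy _] /=.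
rewrite sgn_cstep ?sgen_sgen ?(negPf nb) ?andbF ?addbF //.
by apply/eqP; rewrite fixed_conj // sgen_sgen iy.
Qed.

End Symmetric.
End ClanAction.

Section ClanStep.
Variable n : nat.
Variable dem : {perm (idx n)} -> {perm (idx n)} -> {perm (idx n)}.
Hypothesis dem_ax : is_demazure dem.
Implicit Types (c : clan n) (i j : idx n) (s : 'I_n) (y : {perm (idx n)}).

Lemma rev_symbol c (x : int) : clan_reversal c = c -> `|x| <= n%:Z ->
  is_sign (c (pos n x)) -> c (pos n (- x)) = c (pos n x).
Proof.
move=> cr hx; have [cW cs] := (reversalP c).1 cr.
rewrite is_signE => /eqP E; rewrite pos_opp // clanE [RHS]clanE.
by have /WP -> := cW; rewrite E !eqxx cs.
Qed.

Lemma both_signsE s c : both_signs s c =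
  is_sign (c (pos n s)) && is_sign (c (pos n s.+1)).
Proof. by have [? ?] := bound_s s; rewrite !sign_pos. Qed.

Lemma sign0 c : clan_reversal c = c -> is_sign (c (pos n 0)).
Proof. by move=> cr; have /andP[cW _] := clan_involW cr; rewrite sign_pos // ev0. Qed.

Lemma cstep_unmoved s c i : clan_reversal c = c -> both_signs s c ->
  sig s (lab i) = lab i ->
  cstep s c i = if (s == 0%N :> nat) && (i == pos n 0)
    then (if c i is inl b then inl (~~ b) else c i) else c i.
Proof.
move=> cr b m; have yI := clan_involW cr; have /andP[yW _] := yI.
have ca := both_asc b.
have si : sgen s i = i by apply: lab_inj; rewrite -ev_lab ev_sgen.
rewrite clan_ofE; last exact: dconjK.
rewrite fixed_both // si eqxx andbT dconj_both // b andbT [c i]clanE.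
case: (clan_inv c i =P i) => [_|ni]; first by case: ifP; rewrite ?addbT ?addbF.
case: ifP => [/andP[_ /eqP i0]|_].
  by case: ni; apply: lab_inj; rewrite -ev_lab i0 pos_K // ev0.
congr inr; apply: lab_inj; rewrite -ev_lab ev_sgen -ev_lab.
by rewrite -(comm2_sig _ yI (both_comm b)) m.
Qed.

Lemma cstep_act s c : clan_reversal c = c -> asc s (clan_inv c) -> allowed s c ->
  clan_act dem s c (cstep s c).
Proof.
move=> cr ca al; have yI := clan_involW cr; have /andP[yW _] := yI.
have conj : ~~ both_signs s c ->
    clan_inv (cstep s c) = dem (dem (sgen s) (clan_inv c)) (sgen s) /\
    signs (cstep s c) = signs c.
  by move=> nb; rewrite cstep_inv // dem_dconj // signs_cstep.
have [b0 b1] := bound_s s; have sn := ltn_ord s.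
have symb i : cstep s c i = if dconj s (clan_inv c) i == i then
    inl (sgn c (sgen s i) (+) [&& s == 0%N :> nat, i == pos n 0 & both_signs s c])
    else inr (dconj s (clan_inv c) i).
  by rewrite clan_ofE //; exact: dconjK.
have moved (x : int) : `|x| <= n%:Z -> both_signs s c -> sig s x != x ->
    cstep s c (pos n x) = inr (pos n (sig s x)).
  move=> hx b m; rewrite symb dconj_both // (ev_pos (clan_inv c)) // (both_moved cr b m).
  have hb : `|sig s x| <= n%:Z by rewrite -ev_sgen ev_bound.
  by rewrite sgen_pos // [pos n (sig s x) == _]pos_eq // (negPf m).
have eqpos i (x : int) : `|x| <= n%:Z -> (i == pos n x) = (lab i == x).
  by move=> hx; rewrite -(inj_eq (@lab_inj n)) pos_K.
rewrite /clan_act; case: (posnP s) => s0.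
  rewrite s0 /=; have := both_signsE s c; rewrite s0 sign0 //= => <-.
  case: (boolP (both_signs s c)) => [b|]; last exact: conj.
  have := al; rewrite /allowed b /= s0 => ne; rewrite (negPf ne) andbF => x.
  rewrite !eqpos //; try lia.
  have [E|n1] := eqVneq (lab x) 1.
    rewrite -[x]pos_lab E moved; [by rewrite s0|lia|exact: b|by rewrite s0].
  have [E|n2] := eqVneq (lab x) (-1).
    rewrite -[x]pos_lab E moved; [by rewrite s0|lia|exact: b|by rewrite s0].
  rewrite cstep_unmoved // s0 /= ?eqpos //.
  by clear -n1 n2; case_sig 0%N (lab x); lia.
have -> : (s%:Z == 0) = false by lia.
have -> : s%:Z + 1 = s.+1%:Z by lia.
rewrite -both_signsE; case: (boolP (both_signs s c)) => [b|]; last exact: conj.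
have := al; rewrite /allowed b /= => ne; rewrite (negPf ne) => x.
have [_ _ si si1 _] := sig_evals s.
rewrite !eqpos ?normrN //.
have [E|n1] := eqVneq (lab x) s.
  by rewrite -[x]pos_lab E moved ?si //; lia.
have [E|n2] := eqVneq (lab x) s.+1.
  by rewrite -[x]pos_lab E moved ?si1 //; lia.
have [E|n3] := eqVneq (lab x) (- s.+1%:Z).
  by rewrite -[x]pos_lab E moved ?sigN ?si1 ?normrN //; lia.
have [E|n4] := eqVneq (lab x) (- s%:Z).
  by rewrite -[x]pos_lab E moved ?sigN ?si ?normrN //; lia.
rewrite cstep_unmoved //; first by have -> : (s == 0%N :> nat) = false by lia.
by clear -n1 n2 n3 n4; case_sig s (lab x); lia.
Qed.

Lemma clan_act_fun s c c1 c2 : clan_act dem s c c1 -> clan_act dem s c c2 -> c1 = c2.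
Proof.
have ffun_eq (f : idx n -> symbol n) : (forall i, c1 i = f i) ->
    (forall i, c2 i = f i) -> c1 = c2.
  by move=> h1 h2; apply: val_inj; apply/ffunP => i; rewrite /= h1 h2.
rewrite /clan_act; do !case: ifP => _.
all: try (by move=> -> ->).
all: try exact: ffun_eq.
all: by case=> e1 e2 [e3 e4]; apply: clan_signs_inj; congruence.
Qed.

(** At a descent the conjugation rule leaves the clan as it is, and so do two equal signs; every
    proper action is therefore an allowed ascent. *)
Lemma clan_actP s c c' : clan_reversal c = c -> clan_act dem s c c' -> c' <> c ->
  [/\ asc s (clan_inv c), allowed s c & c' = cstep s c].
Proof.
move=> cr ca ne; have yI := clan_involW cr.
have sn := ltn_ord s.
have conj : clan_inv c' = dem (dem (sgen s) (clan_inv c)) (sgen s) /\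
    signs c' = signs c -> asc s (clan_inv c).
  rewrite dem_dconj // => -[e1 e2]; apply/negPn/negP => na.
  by apply: ne; apply: clan_signs_inj => //; rewrite e1 dconj_desc.
suff [a al] : asc s (clan_inv c) /\ allowed s c.
  by split=> //; apply: clan_act_fun ca _; apply: cstep_act.
have [b|nb] := boolP (both_signs s c); last first.
  split; last by rewrite /allowed (negPf nb).
  move: ca; rewrite /clan_act; case: (posnP s) => s0.
    have := both_signsE s c; rewrite s0 sign0 //= => <-.
    by rewrite (negPf nb).
  have -> : (s%:Z == 0) = false by lia.
  have -> : s%:Z + 1 = s.+1%:Z by lia.
  by rewrite -both_signsE (negPf nb).
split; first exact: both_asc.
rewrite /allowed b /=; apply/negP => /eqP E; apply: ne.
move: ca; rewrite /clan_act; case: (posnP s) => s0.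
  have := both_signsE s c; rewrite b s0 sign0 //= => b1.
  rewrite -b1 rev_symbol ?b1 //; last by lia.
  by move: E; rewrite s0 => ->; rewrite eqxx.
have -> : (s%:Z == 0) = false by lia.
have -> : s%:Z + 1 = s.+1%:Z by lia.
by rewrite -both_signsE b E eqxx.
Qed.

Lemma symclan_cstep p q s c : symclan p q c -> asc s (clan_inv c) -> allowed s c ->
  symclan p q (cstep s c).
Proof.
move=> [cr np cnt] ca al; split=> //; first exact: cstep_rev.
have yI := clan_involW cr; have /andP[yW _] := yI.
rewrite -cnt !sval_sum.
have [b|nb] := boolP (both_signs s c); last first.
  rewrite [RHS](reindex_inj (@perm_inj _ (sgen s))); apply: eq_bigr => i _.
  rewrite !sval_clan cstep_inv // fixed_conj //; case: ifP => // h.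
  rewrite sgn_cstep ?(negPf nb) ?andbF ?addbF //.
  by apply/eqP; rewrite fixed_conj.
have [b0 b1] := bound_s s; have sn := ltn_ord s.
rewrite (bigID (fun i => sgen s i == i)) [RHS](bigID (fun i => sgen s i == i)) /=.
have -> : \sum_(i | sgen s i != i) sval (cstep s c i) = 0.
  apply: big1 => i m; rewrite sval_clan cstep_inv // fixed_both //.
  by rewrite (negPf m) andbF.
rewrite addr0.
have opp (a d : symbol n) : is_sign a -> is_sign d -> a != d -> sval a = - sval d.
  by case: a d => [[]|?] [[]|?].
have ne : c (pos n s) != c (pos n s.+1) by move: al; rewrite /allowed b.
have [S0 S1] : is_sign (c (pos n s)) /\ is_sign (c (pos n s.+1)).
  by move: b; rewrite both_signsE => /andP.
have movedE i : sgen s i != i -> lab i = s \/ lab i = s.+1 \/ lab i = - s%:Z \/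
    lab i = - s.+1%:Z.
  by rewrite -(inj_eq (@lab_inj n)) -ev_lab ev_sgen; apply: sig_moved.
(* For s = 0 let v be the value of c_0. The signs at 1 and -1 have value -v and disappear, while c_0
   becomes -v; this agrees with v - 2v. *)
case: (posnP s) => s0.
  have c0 : sgen s (pos n 0) == pos n 0.
    by rewrite -(inj_eq (@lab_inj n)) -ev_lab ev_sgen pos_K // s0.
  rewrite (bigD1 (pos n 0)) //= [in RHS](bigD1 (pos n 0)) //=.
  have -> : sval (cstep s c (pos n 0)) = - sval (c (pos n 0)).
    rewrite cstep_unmoved // ?pos_K // ?s0 //= eqxx.
    by move: (sign0 cr); case: (c (pos n 0)) => [[]|].
  have -> : \sum_(i | (sgen s i == i) && (i != pos n 0)) sval (cstep s c i) =
      \sum_(i | (sgen s i == i) && (i != pos n 0)) sval (c i).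
    apply: eq_bigr => i /andP[/eqP si /negPf ni]; rewrite cstep_unmoved //.
      by rewrite ni andbF.
    by rewrite -ev_sgen ev_lab si.
  have -> : \sum_(i | sgen s i != i) sval (c i) =
      \sum_(i in [set i | sgen s i != i]) (- sval (c (pos n 0))).
    apply: eq_big => i; first by rewrite inE.
    move=> si; have i0 : lab i <> 0.
      move=> li; case/negP: si; rewrite -(pos_lab i) li.
      by rewrite -(inj_eq (@lab_inj n)) -ev_lab ev_sgen pos_K // s0.
    have -> : c i = c (pos n s.+1).
      have [li|li] : lab i = s.+1%:Z \/ lab i = - s.+1%:Z.
        by have := movedE i si; clear -i0 s0; rewrite s0; lia.
      - by rewrite -(pos_lab i) li.
      - by rewrite -(pos_lab i) li rev_symbol.
    by rewrite eq_sym in ne; rewrite (opp _ _ S1 S0 ne) s0.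
  rewrite sumr_const card_moved s0 /= mulr2n.
  by move: (sval _) (\sum_(i | _) _) => v X; lia.
(* For s > 0, t_s exchanges moved positions with opposite signs, so their values cancel. *)
have -> : \sum_(i | sgen s i != i) sval (c i) = 0.
  set X := \sum_(i | _) _; suff : X = - X by lia.
  rewrite {1}/X (reindex_inj (@perm_inj _ (sgen s))) -sumrN /=.
  apply: eq_big => i; first by rewrite sgen_sgen eq_sym.
  rewrite sgen_sgen eq_sym => si.
  have E (x : int) : `|x| <= n%:Z -> c (sgen s (pos n x)) = c (pos n (sig s x)).
    by move=> hx; rewrite sgen_pos.
  have [_ _ ss ss1 _] := sig_evals s.
  rewrite -(pos_lab i); case: (movedE i si) => [->|[->|[->|->]]];
    rewrite E ?normrN // ?sigN ?ss ?ss1 // ?rev_symbol //; apply: opp => //.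
  - by rewrite eq_sym.
  - by rewrite eq_sym.
rewrite addr0; apply: eq_bigr => i /eqP si; rewrite cstep_unmoved //.
  by have -> : (s == 0%N :> nat) = false by lia.
by rewrite -ev_sgen ev_lab si.
Qed.

End ClanStep.

(** * Noncrossing symmetric perfect matchings *)

Section Noncrossing.
Variable n : nat.
Implicit Types (c : clan n) (i j : idx n) (s : 'I_n) (M : {set {set idx n}}).

Definition ord_lt : rel (idx n) := relpre (@nat_of_ord n.*2.+1) ltn.

Lemma ord_lt_trans : transitive ord_lt.
Proof. by move=> a b d; apply: ltn_trans. Qed.

Lemma ord_lt_irr : irreflexive ord_lt.
Proof. by move=> a; apply: ltnn. Qed.

Lemma lab_lt i j : (i < j)%N = (lab i < lab j).
Proof. by rewrite /lab; lia. Qed.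

Lemma tb_sorted M : sorted ord_lt (trivial_blocks M).
Proof.
apply: sorted_filter; first exact: ord_lt_trans.
by rewrite -sorted_map val_enum_ord iota_ltn_sorted.
Qed.

Lemma mem_tb M i : (i \in trivial_blocks M) = (0 < lab i) && ([set i; rev_ord i] \in M).
Proof. by rewrite mem_filter mem_enum andbT. Qed.

Lemma tb_eq M (l : seq (idx n)) : sorted ord_lt l ->
  (forall i, (i \in l) = (0 < lab i) && ([set i; rev_ord i] \in M)) ->
  trivial_blocks M = l.
Proof.
move=> ls lm; apply: (irr_sorted_eq ord_lt_trans ord_lt_irr (tb_sorted M) ls).
by move=> i; rewrite mem_tb lm.
Qed.

Definition blocks (f : {perm idx n}) M : {set {set idx n}} :=
  (fun S : {set idx n} => f @: S) @: M.

Lemma mem_blocks (f : {perm idx n}) M i j : ([set f i; f j] \in blocks f M) = ([set i; j] \in M).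
Proof.
by rewrite -imset_set2 (mem_imset _ _ (imset_inj (@perm_inj _ f))).
Qed.

Lemma perfect_block X M i j : perfect_matching X M -> [set i; j] \in M ->
  i \in X /\ j \in X.
Proof.
case/andP=> pM _ ijM; have /fintype.subsetP sX := partitionS pM ijM.
by rewrite !sX ?inE ?eqxx ?orbT.
Qed.

Lemma perfect_blocks (f : {perm idx n}) X M : perfect_matching X M -> perfect_matching (f @: X) (blocks f M).
Proof.
have fi := @perm_inj _ f.
case/andP=> pM /forallP card2; rewrite /perfect_matching.
rewrite -[blocks f M]/((fun S : {set idx n} => f @: S) @: M) imset_partition // pM /=.
apply/forallP => S; apply/implyP => /imsetP[S' S'M ->].
by rewrite card_imset //; have := card2 S'; rewrite S'M.
Qed.

Lemma tb_blocks (P : pred (idx n)) (f : {perm idx n}) M : f \in W n -> P (pos n 0) ->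
  (forall i j, [set i; j] \in M -> P i /\ P j) ->
  (forall i j, P i -> P j -> (i < j)%N -> (f i < f j)%N) ->
  trivial_blocks (blocks f M) = map f (trivial_blocks M).
Proof.
move=> fW P0 PM H3; have /WP fr := fW.
have f0 : f (pos n 0) = pos n 0 by rewrite ev_pos // ev0.
have lab0 i : (0 < lab i) = (pos n 0 < i)%N by rewrite lab_lt pos_K.
apply: tb_eq.
  rewrite sorted_map; apply: (@sub_in_sorted _ P ord_lt).
  - exact: H3.
  - by apply/allP => i; rewrite mem_tb => /andP[_ /PM[]].
  - exact: tb_sorted.
move=> i; rewrite -(permKV f i) (mem_map (@perm_inj _ _)) mem_tb -fr mem_blocks.
have [/PM[hi _]|] := boolP (_ \in M); last by rewrite !andbF.
rewrite !andbT !lab0 -{2}f0; apply/idP/idP => [|lt]; first exact: H3.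
rewrite ltnNge leq_eqVlt; apply/negP => /orP[/eqP/val_inj E|/(H3 _ _ hi P0) lt'].
  by rewrite E ltnn in lt.
by have := ltn_trans lt lt'; rewrite ltnn.
Qed.

(** The conditions involve only signs and the order of their positions, which [f] preserves;
    commuting with negation, it fixes 0 and keeps trivial blocks trivial. *)
Lemma NCSP_transport k c c' (f : {perm idx n}) M : f \in W n ->
  (forall i, is_sign (c i) -> c' (f i) = c i) ->
  (forall i, is_sign (c' (f i)) -> is_sign (c i)) ->
  (forall i j, is_sign (c i) -> is_sign (c j) -> (i < j)%N -> (f i < f j)%N) ->
  is_sign (c (pos n 0)) ->
  NCSP k c M -> NCSP k c' (blocks f M).
Proof.
move=> fW H1 H2 H3 c0 [pM sM nM oM [kM aM]]; have /WP fr := fW.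
have f0 : f (pos n 0) = pos n 0 by rewrite ev_pos // ev0.
have Xin i j : [set i; j] \in M -> is_sign (c i) /\ is_sign (c j).
  by move/(perfect_block pM); rewrite !inE => -[/andP[_ ->] /andP[_ ->]].
have mono i j : is_sign (c i) -> is_sign (c j) -> (f i < f j)%N = (i < j)%N.
  move=> hi hj; apply/idP/idP => [lt|]; last exact: H3.
  rewrite ltnNge leq_eqVlt; apply/negP => /orP[/eqP/val_inj E|/(H3 _ _ hj hi) lt'].
    by rewrite E ltnn in lt.
  by have := ltn_trans lt lt'; rewrite ltnn.
have tbE := @tb_blocks (fun i => is_sign (c i)) f M fW c0 Xin H3.
split.
- have -> : [set i | (lab i != 0) && is_sign (c' i)] =
      f @: [set i | (lab i != 0) && is_sign (c i)].
    apply/setP => i; rewrite -(permKV f i) (mem_imset _ _ (@perm_inj _ _)) !inE !lab0P.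
    rewrite -{1}f0 (inj_eq (@perm_inj _ f)); congr (_ && _).
    by apply/idP/idP => [/H2//|h]; rewrite H1.
  exact: perfect_blocks.
- move=> i j; rewrite -(permKV f i) -(permKV f j) -!fr !mem_blocks; exact: sM.
- move=> a b d e; rewrite -(permKV f a) -(permKV f b) -(permKV f d) -(permKV f e).
  rewrite !mem_blocks => h1 h2; have [ha hd] := Xin _ _ h1; have [hb he] := Xin _ _ h2.
  by rewrite !mono //; exact: nM.
- move=> i j; rewrite -(permKV f i) -(permKV f j) mem_blocks => h.
  have [hi hj] := Xin _ _ h; rewrite !H1 // => ne; apply: oM => //.
  apply: contraNneq ne => /eqP; rewrite addr_eq0 -lab_rev => /eqP /lab_inj ->.
  by rewrite fr lab_rev addNr.
- rewrite tbE size_map; split=> //.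
  rewrite -map_take -map_comp -{1}f0 H1 //.
  have -> : [seq (c' \o f) i | i <- take (size (trivial_blocks M) - k) (trivial_blocks M)] =
    [seq c i | i <- take (size (trivial_blocks M) - k) (trivial_blocks M)].
    apply/eq_in_map => i /mem_take; rewrite mem_tb => /andP[_ /Xin[hi _]] /=.
    exact: H1.
  exact: aM.
Qed.

End Noncrossing.

(** * Inserting and removing blocks *)

Section Insertion.
Variable n : nat.
Implicit Types (c : clan n) (i j : idx n) (s : 'I_n) (M : {set {set idx n}})
  (X B : {set idx n}).

Lemma perfectU1 X M B : perfect_matching X M -> #|B| = 2%N ->
  (forall i, i \in B -> i \notin X) -> perfect_matching (B :|: X) (B |: M).
Proof.
case/andP=> pM /forallP card2 B2 BX; apply/andP; split.
  apply: partitionU1 => //; first by rewrite -card_gt0 B2.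
  rewrite -setI_eq0; apply/eqP/setP => i; rewrite !inE.
  by apply/negP => /andP[/BX/negP].
apply/forallP => S; apply/implyP; rewrite in_setU1 => /orP[/eqP->|SM].
  by rewrite B2.
by have := card2 S; rewrite SM.
Qed.

Lemma perfectD1 X M B : perfect_matching X (B |: M) -> B \notin M ->
  perfect_matching (X :\: B) M.
Proof.
case/andP=> pM /forallP card2 BM; apply/andP; split.
  by have := partitionD1 pM (setU11 B M); rewrite setU1K.
by apply/forallP => S; apply/implyP => SM; have := card2 S; rewrite in_setU1 SM orbT.
Qed.

Lemma set2_eq i j a b : [set i; j] = [set a; b] -> i = a /\ j = b \/ i = b /\ j = a.
Proof.
move=> E; have : i \in [set a; b] /\ j \in [set a; b] by rewrite -E !inE !eqxx orbT.
have : a \in [set i; j] /\ b \in [set i; j] by rewrite E !inE !eqxx orbT.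
by rewrite !inE => -[/orP[]/eqP h1 /orP[]/eqP h2] [/orP[]/eqP h3 /orP[]/eqP h4];
  first [left; split; congruence|right; split; congruence].
Qed.

Lemma rev_set2 i j : [set rev_ord i; rev_ord j] = (@rev_ord n.*2.+1) @: [set i; j].
Proof. by rewrite imset_set2. Qed.

Lemma setU2_diff (A B Y : {set idx n}) :
  (forall i, i \in Y -> i \notin A /\ i \notin B) ->
  ((A :|: (B :|: Y)) :\: A) :\: B = Y.
Proof.
move=> h; apply/setP => i; rewrite !(finset.in_setD, finset.in_setU).
have [/h[/negPf -> /negPf ->]|] := boolP (i \in Y); first by [].
by case: (i \in A); case: (i \in B).
Qed.

Section Common.
Variables (s : 'I_n) (c : clan n).
Hypotheses (c_rev : clan_reversal c = c) (b : both_signs s c).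
Let sn : (s < n)%N := ltn_ord s.

Definition moved i : bool := sig s (lab i) != lab i.

Lemma moved_rev i : moved (rev_ord i) = moved i.
Proof. by rewrite /moved lab_rev sigN eqr_opp. Qed.

Lemma cstep_sign i : is_sign (cstep s c i) = is_sign (c i) && ~~ moved i.
Proof.
have ca := both_asc b.
rewrite !is_signE cstep_inv // fixed_both //; congr (_ && _).
by rewrite /moved negbK -(inj_eq (@lab_inj n)) -ev_lab ev_sgen.
Qed.

Lemma moved_sign i : moved i -> is_sign (c i).
Proof.
move=> m; rewrite is_signE -(inj_eq (@lab_inj n)) -ev_lab.
by rewrite (both_moved c_rev b).
Qed.

Lemma cstep_val i : ~~ moved i -> lab i != 0 -> cstep s c i = c i.
Proof.
rewrite negbK => /eqP m i0; rewrite cstep_unmoved //.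
by rewrite -lab0P (negPf i0) andbF.
Qed.

Variable M' : {set {set idx n}}.
Hypothesis M'_unmoved : forall S i, S \in M' -> i \in S -> ~~ moved i /\ lab i != 0.

Lemma unmoved2 i j : [set i; j] \in M' ->
  (~~ moved i /\ lab i != 0) /\ (~~ moved j /\ lab j != 0).
Proof. by move=> h; split; apply: M'_unmoved h _; rewrite !inE eqxx ?orbT. Qed.

Lemma tb_unmoved i : i \in trivial_blocks M' -> ~~ moved i /\ lab i != 0.
Proof. by rewrite mem_tb => /andP[_ /unmoved2[]]. Qed.

Lemma map_tb m : [seq c i | i <- take m (trivial_blocks M')] =
  [seq cstep s c i | i <- take m (trivial_blocks M')].
Proof.
apply/eq_in_map => i /mem_take /tb_unmoved [m0 i0].
by rewrite cstep_val.
Qed.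

End Common.

Section Pair.
Variables (s : 'I_n) (c : clan n) (k : nat) (M' : {set {set idx n}}).
Hypotheses (c_rev : clan_reversal c = c) (b : both_signs s c) (s0 : (0 < s)%N).
Hypothesis M'_unmoved : forall S i, S \in M' -> i \in S -> ~~ moved s i /\ lab i != 0.
Let hs : `|s%:Z| <= n%:Z := (bound_s s).1.
Let hs1 : `|s.+1%:Z| <= n%:Z := (bound_s s).2.

Let B1 := [set pos n s; pos n s.+1].
Let B2 := [set pos n (- s%:Z); pos n (- s.+1%:Z)].
Let M := B1 |: (B2 |: M').

Let posK (x : int) : `|x| <= n%:Z -> lab (pos n x) = x. Proof. exact: pos_K. Qed.

Let labB1 i : (i \in B1) = (lab i == s) || (lab i == s.+1).
Proof. by rewrite !inE -!(inj_eq (@lab_inj n)) !posK //; lia. Qed.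

Let labB2 i : (i \in B2) = (lab i == - s%:Z) || (lab i == - s.+1%:Z).
Proof. by rewrite !inE -!(inj_eq (@lab_inj n)) !posK //; lia. Qed.

Let movedE i : moved s i = (i \in B1) || (i \in B2).
Proof.
rewrite labB1 labB2 /moved; clear -s0.
by apply/idP/idP; case_sig s (lab i); lia.
Qed.

Let tbE : trivial_blocks M = trivial_blocks M'.
Proof.
apply: tb_eq; first exact: tb_sorted.
move=> i; rewrite mem_tb; have [i0|] := boolP (0 < lab i) => //=.
rewrite !in_setU1; case: eqP => [E|_] /=.
  have : rev_ord i \in B1 by rewrite -E !inE eqxx orbT.
  by rewrite labB1 lab_rev; lia.
case: eqP => [E|//].
have : i \in B2 by rewrite -E !inE eqxx.
by rewrite labB2; lia.
Qed.

Let B1M' : B1 \notin M'.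
Proof.
apply/negP => BM; have iB : pos n s \in B1 by rewrite !inE eqxx.
by have [] := M'_unmoved BM iB; rewrite movedE iB.
Qed.

Let B2M' : B2 \notin M'.
Proof.
apply/negP => BM; have iB : pos n (- s%:Z) \in B2 by rewrite !inE eqxx.
by have [] := M'_unmoved BM iB; rewrite movedE iB orbT.
Qed.

Let B1B2 : B1 != B2.
Proof.
apply/eqP => E; have : pos n s \in B2 by rewrite -E !inE eqxx.
by rewrite labB2 posK; lia.
Qed.

Let XE : [set i | (lab i != 0) && is_sign (c i)] =
  B1 :|: (B2 :|: [set i | (lab i != 0) && is_sign (cstep s c i)]).
Proof.
apply/setP => i; rewrite [in RHS]finset.in_setU [in RHS]finset.in_setU orbA -movedE inE [in RHS]inE.
rewrite cstep_sign //; case m: (moved s i) => /=; last by rewrite andbT.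
rewrite (moved_sign c_rev b m) andbT; move: m; rewrite movedE labB1 labB2; lia.
Qed.

Let revB1 : (@rev_ord n.*2.+1) @: B1 = B2.
Proof. by rewrite imset_set2 -!pos_opp //; lia. Qed.

Let revB2 : (@rev_ord n.*2.+1) @: B2 = B1.
Proof. by rewrite imset_set2 -!pos_opp ?opprK //; lia. Qed.

Let adjacent i j l B : B = B1 \/ B = B2 -> [set i; l] = B -> (i < j)%N -> (j < l)%N -> False.
Proof.
rewrite !lab_lt => HB E.
have : i \in B /\ l \in B by rewrite -E !inE !eqxx orbT.
by case: HB => ->; rewrite ?labB1 ?labB2; lia.
Qed.

(** The inequality of signs is condition (1) for the block {s, s+1}; the trivial blocks stay the
    same. *)
Lemma NCSP_pair_remove : NCSP k c M ->
  c (pos n s) != c (pos n s.+1) /\ NCSP k (cstep s c) M'.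
Proof.
case=> pM sM nM oM [kM aM]; rewrite tbE in kM aM.
have sub S : S \in M' -> S \in M by rewrite !in_setU1 => ->; rewrite !orbT.
split.
  apply: oM; first by rewrite in_setU1 eqxx.
  by rewrite !posK; lia.
split.
- rewrite XE in pM; have := perfectD1 pM; rewrite in_setU1 negb_or B1B2 B1M' => /(_ isT) p1.
  have := perfectD1 p1 B2M'; set Y := [set i | _ && is_sign (cstep s c i)].
  have -> // : ((B1 :|: (B2 :|: Y)) :\: B1) :\: B2 = Y.
  apply: setU2_diff => i; rewrite inE cstep_sign // => /and3P[_ _].
  by rewrite movedE => /norP.
- move=> i j ijM'; have := sM i j (sub _ ijM'); rewrite !in_setU1.
  have [[mi _] _] := unmoved2 M'_unmoved ijM'; rewrite -moved_rev movedE in mi.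
  case/norP: mi => m1 m2.
  case/or3P => // /eqP E; [move: m1|move: m2]; by rewrite -E !inE eqxx.
- by move=> i j l m /sub h1 /sub h2; apply: nM.
- move=> i j ijM' ne; have [[mi i0] [mj j0]] := unmoved2 M'_unmoved ijM'.
  by rewrite !cstep_val //; apply: oM => //; apply: sub.
- split=> //; rewrite -map_tb // cstep_unmoved //; last first.
    by rewrite posK //; clear -s0; case_sig s (0 : int); lia.
  by have -> : (s == 0%N :> nat) = false by [clear -s0; lia].
Qed.

(** No position lies between the two ends of an inserted block, so it crosses nothing. *)
Lemma NCSP_pair_insert : c (pos n s) != c (pos n s.+1) ->
  NCSP k (cstep s c) M' -> NCSP k c M.
Proof.
move=> ne [pM sM nM oM [kM aM]].
have memM S : S \in M -> [\/ S = B1, S = B2 | S \in M'].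
  by rewrite !in_setU1 => /or3P[/eqP|/eqP|]; [apply: Or31|apply: Or32|apply: Or33].
have [S0 S1] : is_sign (c (pos n s)) /\ is_sign (c (pos n s.+1)).
  by move: b; rewrite both_signsE => /andP.
split.
- rewrite XE; apply: perfectU1; [apply: perfectU1 => //| |].
  + rewrite cards2 pos_eq ?normrN // eqr_opp; clear; lia.
  + move=> i iB; rewrite inE cstep_sign // movedE iB orbT.
    by rewrite !andbF.
  + rewrite cards2 pos_eq //; clear; lia.
  + move=> i iB; rewrite finset.in_setU inE cstep_sign // movedE iB !andbF orbF.
    by move: iB; rewrite labB1 labB2; clear -s0; lia.
- move=> i j; rewrite rev_set2 => /memM[->|->|h]; rewrite ?revB1 ?revB2 !in_setU1 ?eqxx ?orbT //.
  by rewrite -rev_set2 sM // !orbT.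
- move=> i j l m /memM h1 /memM h2; apply/negP => /and3P[ij jl lm].
  case: h1 => [h1|h1|h1].
  + exact: adjacent (or_introl _ erefl) h1 ij jl.
  + exact: adjacent (or_intror _ erefl) h1 ij jl.
  case: h2 => [h2|h2|h2].
  + exact: adjacent (or_introl _ erefl) h2 jl lm.
  + exact: adjacent (or_intror _ erefl) h2 jl lm.
  by have := nM _ _ _ _ h1 h2; rewrite ij jl lm.
- have ne' : c (pos n (- s%:Z)) != c (pos n (- s.+1%:Z)) by rewrite !rev_symbol.
  move=> i j /memM[/set2_eq h|/set2_eq h|h] ne0.
  + by case: h => -[-> ->] //; rewrite eq_sym.
  + by case: h => -[-> ->] //; rewrite eq_sym.
  have [[mi i0] [mj j0]] := unmoved2 M'_unmoved h.
  by rewrite -(cstep_val c_rev b mi i0) -(cstep_val c_rev b mj j0); apply: oM.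
- rewrite tbE; split=> //; rewrite (map_tb c_rev b M'_unmoved).
  move: aM; rewrite cstep_unmoved //; last first.
    by rewrite posK //; clear -s0; case_sig s (0 : int); lia.
  by have -> : (s == 0%N :> nat) = false by [clear -s0; lia].
Qed.

End Pair.
End Insertion.

Section TrivialBlock.
Variable n : nat.
Implicit Types (i j : idx n).
Variables (s : 'I_n) (c : clan n) (k : nat) (M' : {set {set idx n}}).
Hypotheses (c_rev : clan_reversal c = c) (b : both_signs s c) (s0 : s = 0%N :> nat).
Hypothesis M'_unmoved : forall S i, S \in M' -> i \in S -> ~~ moved s i /\ lab i != 0.
Let sn : (s < n)%N := ltn_ord s.

Let B := [set pos n (-1); pos n 1].
Let M := B |: M'.

Let posK (x : int) : `|x| <= n%:Z -> lab (pos n x) = x. Proof. exact: pos_K. Qed.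

Let labB i : (i \in B) = (lab i == -1) || (lab i == 1).
Proof. by rewrite !inE -!(inj_eq (@lab_inj n)) !posK //; lia. Qed.

Let movedE i : moved s i = (i \in B).
Proof.
rewrite labB /moved s0; clear.
by apply/idP/idP; case_sig 0%N (lab i); lia.
Qed.

Let BM' : B \notin M'.
Proof.
apply/negP => BM; have iB : pos n (-1) \in B by rewrite !inE eqxx.
by have [] := M'_unmoved BM iB; rewrite movedE iB.
Qed.

Lemma tb_trivial : trivial_blocks M = pos n 1 :: trivial_blocks M'.
Proof.
have p1 : rev_ord (pos n 1) = pos n (-1) by rewrite pos_opp //; lia.
apply: tb_eq.
  rewrite /= (path_sortedE (@ord_lt_trans n)) tb_sorted andbT; apply/allP => i.
  move=> iM; have [mi i0] := tb_unmoved M'_unmoved iM.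
  move: iM mi; rewrite mem_tb movedE labB => /andP[ip _].
  by change (~~ ((lab i == -1) || (lab i == 1)) -> (pos n 1 < i)%N); rewrite lab_lt posK; lia.
move=> i; rewrite inE mem_tb in_setU1; have [->|ne] := eqVneq i (pos n 1).
  have -> : [set pos n 1; rev_ord (pos n 1)] = B by rewrite p1 finset.setUC.
  by rewrite !eqxx posK //; lia.
rewrite /=; case: eqP => [E|//]; rewrite andbT.
have : i \in B by rewrite -E !inE eqxx.
rewrite labB; move: ne; rewrite -(inj_eq (@lab_inj n)) posK; last lia.
move=> ne /orP[/eqP ->|]; last by rewrite (negPf ne).
by rewrite ltr0N1.
Qed.

Let XE : [set i | (lab i != 0) && is_sign (c i)] =
  B :|: [set i | (lab i != 0) && is_sign (cstep s c i)].
Proof.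
apply/setP => i; rewrite [in RHS]finset.in_setU -movedE inE [in RHS]inE.
rewrite cstep_sign //; case m: (moved s i) => /=; last by rewrite andbT.
by rewrite (moved_sign c_rev b m) andbT; move: m; rewrite movedE labB; lia.
Qed.

Let cstep0 : c (pos n 0) != c (pos n 1) -> cstep s c (pos n 0) = c (pos n 1).
Proof.
have S1 : is_sign (c (pos n 1)) by move: b; rewrite both_signsE s0 => /andP[].
have S0 := sign0 c_rev.
rewrite cstep_unmoved //; last by rewrite posK // s0.
rewrite s0 eqxx /=; move: S0 S1.
case: (c (pos n 0)) => [[]|//] _; case: (c (pos n 1)) => [[]|//] _; by rewrite ?eqxx.
Qed.

Hypothesis kM' : (k <= size (trivial_blocks M'))%N.

(** The new block adds the link from c_0 to c_1 in front. If the two signs differ, the step has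
    changed c_0 into c_1, so the remaining path starts from the right value. The bound [kM'] keeps
    the subtraction of [k] from being truncated. *)
Let pathE : path (fun x y => x != y) (c (pos n 0))
    [seq c i | i <- take (size (trivial_blocks M) - k) (trivial_blocks M)] =
  (c (pos n 0) != c (pos n 1)) && path (fun x y => x != y) (cstep s c (pos n 0))
    [seq cstep s c i | i <- take (size (trivial_blocks M') - k) (trivial_blocks M')].
Proof.
rewrite tb_trivial /= subSn //= (map_tb c_rev b M'_unmoved).
by case: eqP => [//|/eqP ne] /=; rewrite cstep0.
Qed.

Lemma NCSP_trivial_remove : NCSP k c M ->
  c (pos n 0) != c (pos n 1) /\ NCSP k (cstep s c) M'.
Proof.
case=> pM sM nM oM [_]; rewrite pathE => /andP[ne aM].
have sub S : S \in M' -> S \in M by rewrite in_setU1 => ->; rewrite orbT.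
split=> //; split=> //.
- rewrite XE in pM; have := perfectD1 pM BM'; set Y := [set i | _ && is_sign (cstep s c i)].
  have -> // : (B :|: Y) :\: B = Y.
  have := @setU2_diff _ B finset.set0 Y; rewrite finset.set0U finset.setD0; apply=> i.
  rewrite inE cstep_sign // => /and3P[_ _].
  by rewrite movedE => ->; rewrite inE.
- move=> i j ijM'; have := sM i j (sub _ ijM'); rewrite in_setU1.
  have [[mi _] _] := unmoved2 M'_unmoved ijM'; rewrite -moved_rev movedE in mi.
  by case/orP => // /eqP E; move: mi; rewrite -E !inE eqxx.
- by move=> i j l m /sub h1 /sub h2; apply: nM.
- move=> i j ijM' ne'; have [[mi i0] [mj j0]] := unmoved2 M'_unmoved ijM'.
  by rewrite !cstep_val //; apply: oM => //; apply: sub.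
Qed.

Lemma NCSP_trivial_insert : c (pos n 0) != c (pos n 1) ->
  NCSP k (cstep s c) M' -> NCSP k c M.
Proof.
move=> ne [pM sM nM oM [_ aM]].
have memM S : S \in M -> S = B \/ S \in M'.
  by rewrite in_setU1 => /orP[/eqP|]; [left|right].
have X0 i j : [set i; j] \in M' -> lab i != 0 /\ lab j != 0.
  by move/(unmoved2 M'_unmoved) => [[_ ?] [_ ?]].
(* Only 0 lies strictly between -1 and 1, and 0 is not matched; so the new block crosses nothing. *)
have between i j l : [set i; l] = B -> (i < j)%N -> (j < l)%N -> lab j = 0.
  move=> E; have : i \in B /\ l \in B by rewrite -E !inE !eqxx orbT.
  by rewrite !labB !lab_lt; lia.
split.
- rewrite XE; apply: perfectU1 => //.
  + by rewrite cards2 pos_eq ?normrN //; lia.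
  + by move=> i iB; rewrite inE cstep_sign // movedE iB !andbF.
- move=> i j; rewrite rev_set2 => /memM[->|h]; rewrite in_setU1.
    have -> : (@rev_ord n.*2.+1) @: B = B.
      by rewrite imset_set2 -!pos_opp ?opprK; [exact: finset.setUC|lia|lia].
    by rewrite eqxx.
  by rewrite -rev_set2 sM // orbT.
- move=> i j l m /memM h1 /memM h2; apply/negP => /and3P[ij jl lm].
  case: h1 h2 => [h1|h1] [h2|h2].
  + have : i \in B /\ j \in B by rewrite -{1}h1 -h2 !inE !eqxx.
    have : l \in B /\ m \in B by rewrite -{1}h1 -h2 !inE !eqxx !orbT.
    by move: ij jl lm; rewrite !labB !lab_lt; lia.
  + by have := between _ _ _ h1 ij jl; have [/eqP] := X0 _ _ h2.
  + by have := between _ _ _ h2 jl lm; have [_ /eqP] := X0 _ _ h1.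
  by have := nM _ _ _ _ h1 h2; rewrite ij jl lm.
- move=> i j /memM[/set2_eq h|h] ne0.
  + have n1 : `|1 : int| <= n%:Z by lia.
    by case: h ne0 => -[-> ->]; rewrite !posK ?normrN.
  have [[mi i0] [mj j0]] := unmoved2 M'_unmoved h.
  by rewrite -(cstep_val c_rev b mi i0) -(cstep_val c_rev b mj j0); apply: oM.
- by rewrite pathE ne aM tb_trivial /= (leqW kM').
Qed.

End TrivialBlock.

(** * Shapes and paths of clans *)

Section Opposite.
Variable n : nat.
Implicit Types (a w y z : {perm (idx n)}) (s : 'I_n).

Lemma ev_wopp w x : `|x| <= n%:Z -> ev (wopp w) x = - ev w x.
Proof.
by move=> h; rewrite /wopp evM /ev h lab_bound pos_lab permE lab_rev.
Qed.

Lemma wopp_involW a : involW a -> involW (wopp a).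
Proof.
move=> /involWP[aW aK]; apply/involWP; split.
  by apply: ev_W => x hx; rewrite !ev_wopp ?normrN // evN.
move=> x; have [hx|hx] := boolP (`|x| <= n%:Z).
  by rewrite [ev _ x]ev_wopp // ev_wopp ?normrN ?ev_bound // evN // aK opprK.
by rewrite ![ev _ x]ev_out //; lia.
Qed.

Lemma woppK a : involW a -> wopp (wopp a) = a.
Proof.
move=> aI; apply: ev_eq => x hx.
by rewrite !ev_wopp ?opprK.
Qed.

Lemma comm2_wopp a s : involW a -> asc s a -> let b := wopp (dconj s a) in
  [/\ ev b s = - dcz (ev a) s s, ev b s.+1 = - dcz (ev a) s s.+1 &
      asc s b].
Proof.
move=> aI aa /=; have [h0 h1] := bound_s s; have /involWP[aW aK] := aI.
have E0 : ev (wopp (dconj s a)) s = - dcz (ev a) s s by rewrite ev_wopp // ev_dconj.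
have E1 : ev (wopp (dconj s a)) s.+1 = - dcz (ev a) s s.+1 by rewrite ev_wopp // ev_dconj.
split=> //; rewrite /asc E0 E1 ltrN2.
have aN x : ev a (- x) = - ev a x by apply: evN.
have [_ _ ss ss1 _] := sig_evals s.
rewrite /dcz; case: ifP => [cm|/negbT ncm].
  have [[-> ->]|[sp [-> ->]]] := comm2E aN cm.
    by case_sig s s%:Z; case_sig s s.+1%:Z; lia.
  by rewrite !sigN ss // ss1 //; lia.
have := asc_wmul_l aI aa; rewrite ncm /asc !evM !ev_sgen => lt.
have [s0|sp] := posnP s; last by rewrite ss // ss1.
have E : sig s s = s /\ sig s s.+1 = - s.+1%:Z.
  by clear -s0; case_sig s s%:Z; case_sig s s.+1%:Z; lia.
have a0 : ev a s = 0 by rewrite s0 ev0.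
rewrite E.1 E.2 aN sigN.
by move: lt; rewrite a0; clear -s0; case_sig s (0 : int); lia.
Qed.

(** As -1 is central it commutes with conjugation by t_s, and it exchanges ascents and descents.
    Hence the step from a up to its conjugate becomes, after negation, a step with the same label
    and of the same kind in the opposite direction. *)
Lemma wopp_dconj a s : involW a -> asc s a -> let b := wopp (dconj s a) in
  [/\ involW b, asc s b, comm2 (ev b) s = comm2 (ev a) s & dconj s b = wopp a].
Proof.
move=> aI aa b; have [h0 h1] := bound_s s; have /involWP[aW aK] := aI.
have [E0 E1 ba] := comm2_wopp aI aa.
have bI : involW b by apply: wopp_involW; apply: dconj_invol.
have aN x : ev a (- x) = - ev a x by apply: evN.
have [_ _ ss ss1 _] := sig_evals s.
have cE : comm2 (ev b) s = comm2 (ev a) s.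
  have [s0|sp] := posnP s.
    have E : sig s s = s /\ sig s s.+1 = - s.+1%:Z.
      by clear -s0; case_sig s s%:Z; case_sig s s.+1%:Z; lia.
    have a0 : ev a s = 0 by rewrite s0 ev0.
    rewrite /comm2 E0 E1 /dcz E.1 E.2 aN sigN a0; move: aa.
    rewrite /asc a0 /comm2 a0 s0; clear.
    move: (ev a 1%N%:Z) => e e0; case: ifP; case_sig 0%N e; case_sig 0%N (0:int); lia.
  rewrite {1}/comm2 E0 E1 /dcz ss // ss1 //; move: aa.
  rewrite /asc /comm2; clear -sp.
  move: (ev a s) (ev a s.+1) => e f ef; case: ifP; case_sig s e; case_sig s f; lia.
split=> //; apply: ev_eq => x hx.
rewrite ev_dconj // ev_wopp // /dcz cE.
have hs : `|sig s x| <= n%:Z by rewrite -ev_sgen ev_bound.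
case: ifP => cm; rewrite ev_wopp // ev_dconj // /dcz cm sigN sigK //.
by rewrite sigK.
Qed.

End Opposite.

(** * Shapes of the chains that lift to paths of clans *)

Section ShapeInduction.
Variable n : nat.
Implicit Types (c : clan n) (a w y z : {perm (idx n)}) (s : 'I_n) (t : seq 'I_n).
Implicit Types (M : {set {set idx n}}).

Lemma tb_subset M M' : {subset M' <= M} ->
  (size (trivial_blocks M') <= size (trivial_blocks M))%N.
Proof.
move=> sub; rewrite !size_filter; apply: sub_count => i /andP[-> /sub] //.
Qed.

(** On the points it negates, [a] is decreasing; a pair of them reversed by t_s would make s a
    descent. *)
Lemma asc_mono a s i j : involW a -> asc s a -> 
  ev a (lab i) = - lab i -> ev a (lab j) = - lab j -> (i < j)%N ->
  (sgen s i < sgen s j)%N.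
Proof.
move=> /involWP[aW aK]; rewrite /asc !lab_lt -!ev_lab !ev_sgen.
move: (lab i) (lab j) => x x' aa hx hx' lt.
rewrite ltNge; apply/negP => le.
have aN e : ev a (- e) = - ev a e by apply: evN.
have [[E1 E2]|[[E1 E2]|[s0 [E1 E2]]]] : (x = s /\ x' = s.+1) \/
  (x = - s.+1%:Z /\ x' = - s%:Z) \/ (s = 0%N :> nat /\ (x = - 1%N%:Z /\ x' = 1%N%:Z)).
  exact: sig_inversion lt le.
- by move: aa; rewrite -E1 -E2 hx hx'; clear -lt; lia.
- move: hx hx' aa; rewrite E1 E2 !aN; clear; lia.
- move: hx' aa; rewrite s0 E2 ev0 //; clear; lia.
Qed.

(** The k trivial blocks of the first shape are relabelled in order and never removed. This bound is
    part of condition (2) and is needed to compare its lists before and after a step. *)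
Lemma tb_size k z t D x : (k <= n)%N -> ichain (yBC n k) z t ->
  red (chain_word k t) D x -> (k <= size (trivial_blocks (redshape n D x)))%N.
Proof.
move=> kn; elim: t z D x => [|s t IH] z D x.
  move=> _ r; have [_ ls _ neg] := gBC_word kn.
  have [-> ->] : D = [::] /\ x = wword (gBC n k).
    by apply: red_sortedE ls; move: r; rewrite /chain_word /wprod /= invg1 wmul1l.
  set M := redshape n _ _.
  have : uniq [seq pos n (i : nat)%:Z | i <- iota 1 k].
    rewrite map_inj_in_uniq ?iota_uniq // => i j; rewrite !mem_iota => hi hj.
    by move=> /(congr1 (@lab n)); rewrite !pos_K; lia.
  move/uniq_leq_size => /(_ (trivial_blocks M)); rewrite size_map size_iota; apply.
  move=> _ /mapP[j jk ->]; rewrite mem_iota in jk; rewrite mem_tb pos_K; last lia.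
  apply/andP; split; first by lia.
  apply/redshapeP; right; exists (- j%:Z); first by rewrite neg; lia.
  by rewrite opprK -pos_opp; [split; [lia|exact: finset.setUC]|lia].
case=> z' [zI aa _ ch] r.
have [D0 [x0 [r0 H]]] := redshape_step kn zI aa ch r.
have := IH _ _ _ ch r0; set M' := redshape n D0 x0 => le.
have /involWP[zW zK] := zI.
have [_ gw] := chain_good kn ch.
have neg i S : S \in M' -> i \in S -> ev z' (lab i) = - lab i /\ lab i != 0.
  by apply: redshape_neg zI gw _ r0 => e; exact: wword_bound.
case: H => [[ncm ->]|[_ _ _ ->]|[_ _ _ ->]|[_ _ ->]] //.
- rewrite -[sgen_blocks s M']/(blocks (sgen s) M').
  rewrite (@tb_blocks n (fun i => ev z' (lab i) == - lab i)) ?size_map ?sgen_W //.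
  + by rewrite pos_K // ev0.
  + move=> i j h; have [|-> _] := neg i _ h; first by rewrite !inE eqxx.
    by have [|-> _] := neg j _ h; rewrite ?inE ?eqxx ?orbT.
  + by move=> i j /eqP hi /eqP hj; apply: asc_mono hi hj.
- by apply: leq_trans le (tb_subset _) => S h; rewrite !in_setU1 h !orbT.
- by apply: leq_trans le (tb_subset _) => S h; rewrite !in_setU1 h !orbT.
Qed.

Lemma blocks_id M s : (forall S i, S \in M -> i \in S -> ~~ moved s i) ->
  blocks (sgen s) M = M.
Proof.
move=> h; have E S : S \in M -> sgen s @: S = S.
  move=> SM; rewrite -[RHS]imset_id; apply: eq_in_imset => i iS.
  by apply: lab_inj; rewrite -ev_lab ev_sgen; apply/eqP; have := h _ _ SM iS; rewrite negbK.
by rewrite /blocks (eq_in_imset E) imset_id.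
Qed.

Lemma blocksK s M : blocks (sgen s) (blocks (sgen s) M) = M.
Proof.
apply/setP => S; rewrite -[blocks _ _]/(sgen_blocks s (sgen_blocks s M)).
by rewrite !mem_imset_sgen imset_sgenK.
Qed.

Lemma NCSP_conj k c s M : clan_reversal c = c -> asc s (clan_inv c) ->
  ~~ both_signs s c -> NCSP k c (blocks (sgen s) M) <-> NCSP k (cstep s c) M.
Proof.
move=> cr ca nb; have sW := sgen_W s.
have sg i : is_sign (cstep s c i) = is_sign (c (sgen s i)).
  by rewrite !is_signE cstep_inv // fixed_conj.
have val i : is_sign (c i) -> cstep s c (sgen s i) = c i.
  move=> ic; have iS : is_sign (cstep s c (sgen s i)) by rewrite sg sgen_sgen.
  rewrite clanE -is_signE iS [RHS]clanE -is_signE ic sgn_cstep //.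
    by rewrite sgen_sgen (negPf nb) !andbF addbF.
  by move: iS; rewrite is_signE cstep_inv // => /eqP.
have mono i j : is_sign (c i) -> is_sign (c j) -> (i < j)%N -> (sgen s i < sgen s j)%N.
  by rewrite !is_signE => hi hj; apply: sgen_mono hi hj.
split=> h.
  rewrite -[M](blocksK s); apply: NCSP_transport h => //.
    by move=> i; rewrite sg sgen_sgen.
  exact: sign0.
apply: NCSP_transport h => //.
- by move=> i; rewrite sg => /val; rewrite sgen_sgen.
- by move=> i; rewrite sg.
- move=> i j; rewrite !sg => hi hj ij; rewrite ltnNge leq_eqVlt.
  apply/negP => /orP[/eqP/val_inj/perm_inj E|/(mono _ _ hj hi)].
    by rewrite E ltnn in ij.
  by rewrite !sgen_sgen => lt; have := ltn_trans lt ij; rewrite ltnn.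
- apply: sign0; exact: cstep_rev.
Qed.

(** Says that the labels [t] lift to a path of clans from [c]; steps that do not join signs impose
    nothing. *)
Fixpoint cchain c t : Prop :=
  if t is s :: t' then allowed s c /\ cchain (cstep s c) t' else True.

(** Matches the four cases of [redshape_step] with the steps of clans: two signs are joined exactly
    in the cases where blocks are added. *)
Lemma bothE c s a : clan_inv c = wopp (dconj s a) -> involW a -> asc s a ->
  [/\ ~~ comm2 (ev a) s -> ~~ both_signs s c,
      (0 < s)%N -> ev a s = s -> ~~ both_signs s c,
      (0 < s)%N -> ev a s = - s.+1%:Z -> ev a s.+1 = - s%:Z -> both_signs s c &
      s = 0%N :> nat -> ev a 1 = 1 -> both_signs s c].
Proof.
move=> E aI aa; have [E0 E1 _] := comm2_wopp aI aa.
have [_ _ cE _] := wopp_dconj aI aa; have /involWP[aW _] := aI.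
have [_ _ ss ss1 _] := sig_evals s.
rewrite /both_signs E; split.
- by apply: contra => b; rewrite -cE /comm2 b.
- move=> sp as_; apply/negP => b; have cm : comm2 (ev a) s by rewrite -cE /comm2 b.
  by move: b; rewrite E0 /dcz cm as_ ss //; clear; lia.
- move=> sp e1 e2; rewrite E0 E1 /dcz /comm2 e1 e2 !eqxx orbT !sigN ss // ss1 //.
  by rewrite !opprK !eqxx.
- move=> s0 e1; rewrite E0 E1 /dcz.
  have e1' : ev a s.+1 = s.+1 by rewrite s0.
  have e0 : ev a s = s by rewrite s0 ev0.
  rewrite /comm2 e0 e1' !eqxx /=; clear -s0.
  by case_sig s s%:Z; case_sig s s.+1%:Z; lia.
Qed.

(** The shape has exactly k blocks, all trivial and nested, so condition (1) is void and all entries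
    of the list in condition (2) are ignored. *)
Lemma NCSP_base k c : (k <= n)%N -> clan_reversal c = c ->
  wopp (clan_inv c) = yBC n k -> NCSP k c (redshape n [::] (wword (gBC n k))).
Proof.
move=> kn cr E; have [_ ls _ neg] := gBC_word kn.
set M := redshape n _ _.
have yI := yBC_involW kn; have cI := clan_involW cr.
have signE i : is_sign (c i) = (`|lab i| <= k%:Z).
  rewrite is_signE -(inj_eq (@lab_inj n)) -ev_lab -(woppK cI) E ev_wopp ?lab_bound //.
  by rewrite ev_yBC //; case: ifP; lia.
have memM S : S \in M <-> exists2 i, 0 < lab i <= k%:Z & S = [set i; rev_ord i].
  split.
    case/redshapeP => [[d]|[e]]; first by rewrite in_nil.
    move=> el [e0 ->]; move: el; rewrite neg // => ek.
    exists (pos n (- e)); first by rewrite pos_K; lia.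
    by rewrite -pos_opp ?opprK; [exact: finset.setUC|lia].
  case=> i /andP[i0 ik] ->; apply/redshapeP; right; exists (- lab i).
    by rewrite neg; lia.
  split; first by lia.
  by rewrite opprK pos_opp ?lab_bound // pos_lab finset.setUC.
have memM2 i j : [set i; j] \in M -> [/\ j = rev_ord i, lab i != 0 & `|lab i| <= k%:Z].
  case/memM => a /andP[a0 ak] /set2_eq[[-> ->]|[-> ->]]; rewrite ?rev_ordK ?lab_rev ?normrN;
    by split=> //; lia.
have memM3 i : lab i != 0 -> `|lab i| <= k%:Z -> [set i; rev_ord i] \in M.
  move=> i0 ik; apply/memM; have [ip|im] : 0 < lab i \/ lab i < 0 by lia.
    by exists i => //; lia.
  by exists (rev_ord i); [rewrite lab_rev; lia|rewrite rev_ordK finset.setUC].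
split.
- apply/andP; split; last first.
    apply/forallP => S; apply/implyP => /memM[i /andP[i0 ik] ->].
    by rewrite cards2 -(inj_eq (@lab_inj n)) lab_rev; lia.
  apply/and3P; split.
  + apply/eqP/setP => i; rewrite inE signE; apply/bigcupP/andP.
      case=> S /memM[a /andP[a0 ak] ->]; rewrite !inE => /orP[]/eqP ->; rewrite ?lab_rev; lia.
    by case=> i0 ik; exists [set i; rev_ord i]; [exact: memM3|rewrite !inE eqxx].
  + apply/finset.trivIsetP => S T /memM[i hi ->] /memM[j hj ->] ne.
    rewrite -setI_eq0; apply/eqP/setP => a; rewrite !inE.
    apply/negP => /andP[] /orP[]/eqP -> /orP[]/eqP Ea; case/eqP: ne.
    * by rewrite Ea.
    * by rewrite Ea rev_ordK finset.setUC.
    * by rewrite Ea finset.setUC -Ea rev_ordK.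
    * by rewrite (rev_ord_inj Ea).
  + apply/negP => /memM[i _ /setP/(_ i)]; rewrite !inE eqxx //.
- move=> i j /memM2[-> i0 ik]; rewrite rev_ordK finset.setUC; apply: memM3 => //.
- move=> i j l m /memM2[-> i0 ik] /memM2[-> j0 jk].
  by rewrite !lab_lt !lab_rev; lia.
- by move=> i j /memM2[-> i0 ik]; rewrite lab_rev addrN eqxx.
have -> : trivial_blocks M = [seq pos n (i : nat)%:Z | i <- iota 1 k].
  apply: tb_eq.
    rewrite sorted_map; apply: (@sub_in_sorted _ (fun j : nat => (j <= k)%N) ltn).
    - by move=> i j /= hi hj ij; change (pos n i%:Z < pos n j%:Z)%N; rewrite lab_lt !pos_K; lia.
    - by apply/allP => j; rewrite mem_iota; lia.
    - exact: iota_ltn_sorted.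
  move=> i; apply/mapP/andP.
    case=> j; rewrite mem_iota => hj ->; rewrite pos_K; last by lia.
    by split; [lia|apply: memM3; rewrite pos_K; lia].
  case=> i0 /memM2[_ _ ik]; exists (absz (lab i)); first by rewrite mem_iota; lia.
  by have -> : (absz (lab i))%:Z = lab i by [lia]; rewrite pos_lab.
by rewrite size_map size_iota subnn take0.
Qed.

Lemma NCSP_cchain k c t D x : (k <= n)%N -> clan_reversal c = c ->
  ichain (yBC n k) (wopp (clan_inv c)) t -> red (chain_word k t) D x ->
  NCSP k c (redshape n D x) <-> cchain c t.
Proof.
move=> kn; elim: t c D x => [|s t IH] c D x cr.
  move=> /= E r; split=> // _; have [_ ls _ _] := gBC_word kn.
  have [-> ->] : D = [::] /\ x = wword (gBC n k).
    by apply: red_sortedE ls; move: r; rewrite /chain_word /wprod /= invg1 wmul1l.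
  exact: NCSP_base.
move=> /= [z' [zI aa E ch]] r; have cI := clan_involW cr.
have Ec : clan_inv c = wopp (dconj s z') by rewrite -E woppK.
have [_ ca cmE Ed] := wopp_dconj zI aa; rewrite -Ec in ca cmE Ed.
have E1 : wopp (clan_inv (cstep s c)) = z' by rewrite cstep_inv // Ed woppK.
have cr1 : clan_reversal (cstep s c) = cstep s c by apply: cstep_rev.
have [D0 [x0 [r0 H]]] := redshape_step kn zI aa ch r.
rewrite -E1 in ch; have IH' := IH _ _ _ cr1 ch r0; rewrite E1 in ch.
have kM' := tb_size kn ch r0; set M' := redshape n D0 x0 in IH' kM' H.
have [_ gw] := chain_good kn ch; have /involWP[zW zK] := zI.
have neg S i : S \in M' -> i \in S -> ev z' (lab i) = - lab i /\ lab i != 0.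
  by apply: redshape_neg zI gw _ r0 => e; exact: wword_bound.
have [b1 b2 b3 b4] := bothE Ec zI aa.
have zN e : ev z' (- e) = - ev z' e by apply: evN.
(* In a commuting step no moved point is a nonzero negated point of z', so the old blocks avoid all
   moved points. *)
have unm S i : comm2 (ev z') s -> S \in M' -> i \in S -> ~~ moved s i /\ lab i != 0.
  move=> cm SM iS; have [hi i0] := neg _ _ SM iS; split=> //.
  apply/negP => /sig_moved mi.
  have [[f1 f2]|[sp [f1 f2]]] := comm2E zN cm.
    by case: mi => [|[|[|]]] Ei; move: hi i0; rewrite Ei ?zN ?f1 ?f2; clear; lia.
  by case: mi => [|[|[|]]] Ei; move: hi i0; rewrite Ei ?zN ?f1 ?f2; clear; lia.
case: H => [[ncm EM]|[sp e1 e2 EM]|[sp e1 e2 EM]|[s0 e1 EM]].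
- have nb := b1 ncm; rewrite EM -[sgen_blocks s M']/(blocks (sgen s) M').
  by rewrite NCSP_conj // IH' /allowed (negPf nb) /=; split=> [|[]].
(* At two fixed points the shape is not moved by t_s, so it may be rewritten as its own relabelling
   and treated like the first case. *)
- have nb := b2 sp e1; rewrite EM -(@blocks_id M' s); last first.
    by move=> S i SM iS; have [] := unm S i _ SM iS; rewrite // /comm2 e1 e2 !eqxx.
  by rewrite NCSP_conj // IH' /allowed (negPf nb) /=; split=> [|[]].
- have b := b3 sp e1 e2; rewrite EM /allowed b /=.
  have un S i : S \in M' -> i \in S -> ~~ moved s i /\ lab i != 0.
    by apply: unm; rewrite /comm2 e1 e2 !eqxx orbT.
  split.
    by move/(NCSP_pair_remove cr b sp un) => [ne /IH' ?].
  by case=> ne /IH'; apply: NCSP_pair_insert.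
- have b := b4 s0 e1; rewrite EM /allowed b /= s0.
  have un S i : S \in M' -> i \in S -> ~~ moved s i /\ lab i != 0.
    by apply: unm; rewrite /comm2 s0 ev0 // e1 !eqxx.
  split.
    by move/(NCSP_trivial_remove cr b s0 un kM') => [ne /IH' ?].
  by case=> ne /IH'; apply: NCSP_trivial_insert.
Qed.

End ShapeInduction.

(** * The degree *)

Section Degree.
Variable n : nat.
Implicit Types (c : clan n) (a w y z : {perm (idx n)}) (s : 'I_n) (t : seq 'I_n).

Lemma ell0_asc s w : w \in W n -> asc s w ->
  ell0 (wmul w (sgen s)) = (ell0 w + (s == 0%N :> nat))%N.
Proof.
move=> wW aw; rewrite /ell0; have [h0 h1] := bound_s s; have sn := ltn_ord s.
have E i : lab (wmul w (sgen s) i) = ev w (sig s (lab i)).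
  by rewrite -ev_lab evM ev_sgen.
have [s0|sp] := posnP s; last first.
  rewrite addn0 -(card_preimset _ (@perm_inj _ (sgen s))); apply: eq_card => i.
  rewrite !inE E -!ev_lab !ev_sgen sigK; congr (_ && _).
  by clear -sp; apply/idP/idP; case_sig s (lab i); lia.
have w1 : 0 < ev w 1%N%:Z by move: aw; rewrite /asc s0 ev0.
have -> : [set i | (0 < lab i) && (lab (wmul w (sgen s) i) < 0)] =
    pos n 1 |: [set i | (0 < lab i) && (lab (w i) < 0)].
  apply/setP => i; rewrite in_setU1 !inE E -[lab (w i)]ev_lab s0.
  rewrite -(inj_eq (@lab_inj n)) pos_K; last by lia.
  have [->|ne] := eqVneq (lab i) 1.
    have -> : sig 0 1 = - 1%N%:Z by [].
    by rewrite evN // oppr_lt0 w1.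
  have [ip|//] := boolP (0 < lab i).
  by have -> : sig 0 (lab i) = lab i by clear -ip ne; case_sig 0%N (lab i); lia.
rewrite cardsU1 inE -ev_lab pos_K; last by lia.
have -> : ev w 1 < 0 = false by clear -w1; move: w1; rewrite -[1%N%:Z]/(1 : int); lia.
by rewrite andbF /= addnC.
Qed.

(** For an involution this counts the 2-cycles (a, b) with 0 < a < b. *)
Definition posdesc z : nat :=
  #|[set i : idx n | (0 < lab (z i)) && (lab (z i) < lab i)]|.

(** Fixed points s, s+1 with s > 0 become a 2-cycle; the other commuting steps only produce negated
    points. *)
Lemma posdesc_comm a s : involW a -> asc s a -> comm2 (ev a) s ->
  posdesc (dconj s a) = (posdesc a + ((0 < s)%N && (ev a s == s)))%N.
Proof.
move=> aI aa cm; have /involWP[aW aK] := aI; have [h0 h1] := bound_s s.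
have aN e : ev a (- e) = - ev a e by apply: evN.
have [_ _ ss ss1 sid] := sig_evals s.
have E i : lab (dconj s a i) = sig s (ev a (lab i)).
  by rewrite -ev_lab ev_dconj // /dcz cm.
have un x : sig s x = x -> sig s (ev a x) = ev a x.
  by move=> m; rewrite -comm2_sig // m.
rewrite /posdesc; have [[e0 e1]|[sp [e0 e1]]] := comm2E aN cm; last first.
  have -> : (ev a s == s) = false by rewrite e0; clear; lia.
  rewrite andbF addn0; apply: eq_card => i; rewrite !inE E -[lab (a i)]ev_lab.
  move: (lab i) => x; have [m|/sig_moved mx] := eqVneq (sig s x) x; first by rewrite un.
  by case: mx => [|[|[|]]] ->; rewrite ?aN ?e0 ?e1 ?opprK ?sigN ?ss // ?ss1 //; clear; lia.
have [s0|sp] := posnP s.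
  rewrite andFb addn0; apply: eq_card => i; rewrite !inE E -[lab (a i)]ev_lab.
  move: (lab i) => x; have [m|/sig_moved mx] := eqVneq (sig s x) x; first by rewrite un.
  case: mx => [|[|[|]]] ->; rewrite ?aN ?e0 ?e1 ?sigN; clear -s0;
    by case_sig s s%:Z; case_sig s s.+1%:Z; lia.
rewrite e0 eqxx /=.
have -> : [set i | (0 < lab (dconj s a i)) && (lab (dconj s a i) < lab i)] =
    pos n s.+1 |: [set i | (0 < lab (a i)) && (lab (a i) < lab i)].
  apply/setP => i; rewrite in_setU1 !inE E -[lab (a i)]ev_lab.
  rewrite -(inj_eq (@lab_inj n)) pos_K //.
  move: (lab i) => x; have [m|/sig_moved mx] := eqVneq (sig s x) x.
    rewrite un //; case: eqP => // Ex; move: m; rewrite Ex ss1 //; clear; lia.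
  by case: mx => [|[|[|]]] ->; rewrite ?aN ?e0 ?e1 ?sigN ?ss // ?ss1 //; clear -sp; lia.
rewrite cardsU1 inE -ev_lab pos_K // e1 ltxx andbF addnC //.
Qed.

(** For s = 0 we have m = a 1 > 1, and the cycle (1, m) turns into (-1, m), so one is lost. For s >
    0 only the cycle (s, s+1) would be affected by the reversal, and it would make s a descent. *)
Lemma posdesc_noncomm a s : involW a -> asc s a -> ~~ comm2 (ev a) s ->
  (posdesc (dconj s a) + (s == 0%N :> nat))%N = posdesc a.
Proof.
move=> aI aa ncm; have /involWP[aW aK] := aI; have [h0 h1] := bound_s s.
have aN e : ev a (- e) = - ev a e by apply: evN.
have [_ _ ss ss1 sid] := sig_evals s.
have E i : lab (dconj s a i) = sig s (ev a (sig s (lab i))).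
  by rewrite -ev_lab ev_dconj // /dcz (negPf ncm).
rewrite /posdesc; have [s0|sp] := posnP s; last first.
  rewrite addn0 -[RHS](card_preimset _ (@perm_inj _ (sgen s))); apply: eq_card => i.
  rewrite !inE E -!ev_lab !ev_sgen -{3}(sigK s (lab i)).
  move: (sig s (lab i)) => x.
  have n1 : ~ (ev a x = s /\ x = s.+1).
    case=> e1 e2; have as1 : ev a s.+1 = s by rewrite -e2.
    have as0 : ev a s = s.+1 by rewrite -e1 aK.
    by move: aa; rewrite /asc as0 as1; clear; lia.
  have n2 : ~ (ev a x = s.+1 /\ x = s).
    case=> e1 e2; have as1 : ev a s = s.+1 by rewrite -e2.
    have as0 : ev a s.+1 = s by rewrite -e1 aK.
    by move: aa; rewrite /asc as0 as1; clear; lia.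
  clear -n1 n2 sp; move: (ev a x) n1 n2 => e n1 n2.
  by apply/idP/idP; case_sig s x; case_sig s e; lia.
have a0 := ev0 aW.
have [m m0 Em] : exists2 m : int, 1%N%:Z < m & ev a 1%N%:Z = m.
  exists (ev a 1%N%:Z) => //; move: aa ncm; rewrite /asc /comm2 s0 a0; clear; lia.
have am : ev a m = 1%N%:Z by rewrite -Em aK.
have mb : `|m| <= n%:Z by rewrite -Em ev_bound; lia.
have -> : [set i | (0 < lab (a i)) && (lab (a i) < lab i)] =
    pos n m |: [set i | (0 < lab (dconj s a i)) && (lab (dconj s a i) < lab i)].
  apply/setP => i; rewrite in_setU1 !inE E -[lab (a i)]ev_lab s0.
  rewrite -(inj_eq (@lab_inj n)) pos_K //; move: (lab i) => x.
  have [->|nm] := eqVneq x m; first by rewrite am; clear -m0; lia.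
  have [->|n1] := eqVneq x 1%N%:Z.
    have -> : sig 0 1%N%:Z = - 1%N%:Z by [].
    by rewrite aN Em; clear -m0; case_sig 0%N (- m); lia.
  have [->|n2] := eqVneq x (- 1%N%:Z).
    have -> : sig 0 (- 1%N%:Z) = 1%N%:Z by [].
    by rewrite aN Em; clear -m0; case_sig 0%N m; lia.
  have -> : sig 0 x = x by clear -n1 n2; case_sig 0%N x; lia.
  have na : ev a x <> 1%N%:Z by move=> ax; move: (aK x) nm; rewrite ax Em => ->; rewrite eqxx.
  have na2 : ev a x = - 1%N%:Z -> x = - m by move=> ax; rewrite -(aK x) ax aN Em.
  by clear -na na2 m0; move: (ev a x) na na2 => e na na2; case_sig 0%N e; lia.
rewrite cardsU1 addnC; congr (_ + _)%N.
rewrite inE E pos_K // s0.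
have -> : sig 0 m = m by clear -m0; case_sig 0%N m; lia.
by rewrite am.
Qed.

Lemma clan_doubledE s c : clan_reversal c = c -> clan_doubled s c =
  if s == 0%N :> nat then both_signs s c && (c (pos n 0) != c (pos n 1))
  else (ev (clan_inv c) s == - s.+1%:Z) && (ev (clan_inv c) s.+1 == - s%:Z).
Proof.
move=> cr; rewrite /clan_doubled; have [h0 h1] := bound_s s.
have cN x : ev (clan_inv c) (- x) = - ev (clan_inv c) x.
  by apply: evN; have /andP[] := clan_involW cr.
have [s0|sp] := posnP s.
  by rewrite s0 /= both_signsE s0 sign0.
have -> : (s%:Z == 0) = false by lia.
have -> : s%:Z + 1 = s.+1%:Z by lia.
have inrE (x v : int) : `|x| <= n%:Z -> `|v| <= n%:Z -> x != v ->
    (c (pos n x) == inr (pos n v)) = (ev (clan_inv c) x == v).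
  move=> hx hv ne; rewrite clanE ev_pos // pos_eq ?ev_bound //.
  case: (ev (clan_inv c) x =P x) => [->|_]; first by rewrite (negPf ne).
  by rewrite -(pos_eq _ hv) ?ev_bound.
rewrite !inrE ?normrN //; try lia.
by rewrite !cN !eqr_oppLR.
Qed.

Fixpoint dcount c t : nat :=
  if t is s :: t' then (clan_doubled s c + dcount (cstep s c) t')%N else 0%N.

Lemma posdesc_yBC k : (k <= n)%N -> posdesc (yBC n k) = 0%N.
Proof.
move=> kn; apply: eq_card0 => i; rewrite !inE -ev_lab ev_yBC //.
by case: ifP => _; lia.
Qed.

Lemma ell0_1 : ell0 (1%g : {perm (idx n)}) = 0%N.
Proof. by apply: eq_card0 => i; rewrite !inE perm1; lia. Qed.

(** A noncommuting step at t_0 lowers [posdesc] as it raises [ell0] and is not doubled. A commuting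
    step is doubled when it raises one of the two: [ell0] at t_0, [posdesc] at fixed points s, s+1
    with s > 0. The step that joins signs at s > 0 changes neither and is not doubled. *)
Lemma dcountE (dem : {perm (idx n)} -> {perm (idx n)} -> {perm (idx n)}) k c t :
  is_demazure dem -> (k <= n)%N -> clan_reversal c = c ->
  ichain (yBC n k) (wopp (clan_inv c)) t -> cchain c t ->
  dcount c t = (posdesc (wopp (clan_inv c)) + ell0 (wprod t))%N.
Proof.
move=> dm kn; have yI := yBC_involW kn; elim: t c => [|s t IH] c cr.
  by move=> /= -> _; rewrite posdesc_yBC // /wprod /= ell0_1.
move=> ch0 [al cc]; have [_ red _] := ichain_reduced dm yI ch0.
case: ch0 => z' [zI aa E ch]; have cI := clan_involW cr.
have Ec : clan_inv c = wopp (dconj s z') by rewrite -E woppK.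
have [_ ca cmE Ed] := wopp_dconj zI aa; rewrite -Ec in ca cmE Ed.
have E1 : wopp (clan_inv (cstep s c)) = z' by rewrite cstep_inv // Ed woppK.
have cr1 : clan_reversal (cstep s c) = cstep s c by apply: cstep_rev.
rewrite -E1 in ch; rewrite /= (IH _ cr1 ch cc) E1 E.
have aw : asc s (wprod t).
  apply/negPn/negP => na; have := invB_asc (s := s) (wmul_W (wprod_W t) (sgen_W s)).
  rewrite wmul_asc ?wprod_W // na wmulsK => /(_ isT).
  have := red; rewrite /= wprod_cons => ->.
  by have := invB_wprod t; clear; lia.
rewrite wprod_cons ell0_asc ?wprod_W // clan_doubledE //.
have [b1 b2 b3 b4] := bothE Ec zI aa; have [F0 F1 _] := comm2_wopp zI aa.
rewrite -Ec in F0 F1; have /involWP[zW zK] := zI.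
have zN e : ev z' (- e) = - ev z' e by apply: evN.
have [_ _ ss ss1 _] := sig_evals s.
have [cm|ncm] := boolP (comm2 (ev z') s); last first.
  rewrite -(posdesc_noncomm zI aa ncm).
  case: (posnP s) => s0.
    by rewrite (negPf (b1 ncm)) /=; move: (posdesc _) (ell0 _); clear; lia.
  have -> : (ev (clan_inv c) s == - s.+1%:Z) && (ev (clan_inv c) s.+1 == - s%:Z) = false.
    by apply: negbTE; apply: contra ncm => h; rewrite -cmE /comm2 h orbT.
  by move: (posdesc _) (ell0 _); clear; lia.
rewrite (posdesc_comm zI aa cm).
have [[e0 e1]|[sp [e0 e1]]] := comm2E zN cm; last first.
  have -> : (s == 0%N :> nat) = false by clear -sp; lia.
  have -> : (ev z' s == s) = false by rewrite e0; clear; lia.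
  have /andP[/eqP -> _] := b3 sp e0 e1.
  have -> : (s%:Z == - s.+1%:Z) = false by clear; lia.
  by rewrite andbF; move: (posdesc _) (ell0 _); clear; lia.
case: (posnP s) => s0.
  have b : both_signs s c by apply: b4 => //; move: e1; rewrite s0.
  by move: al; rewrite /allowed b s0 /= => ->; move: (posdesc _) (ell0 _); clear; lia.
rewrite F0 F1 /dcz cm e0 e1 ss // ss1 // !eqxx /=.
by move: (posdesc _) (ell0 _); clear; lia.
Qed.

End Degree.

(** * Maximal and alternating clans *)

Section MaximalClan.
Variable n : nat.
Implicit Types (c : clan n) (i j l : idx n) (s : 'I_n).

Lemma card_interval m : (m <= n)%N -> #|[set i : idx n | `|lab i| <= m%:Z]| = m.*2.+1.
Proof.
elim: m => [|m IH] mn.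
  have -> : [set i : idx n | `|lab i| <= 0%N%:Z] = [set pos n 0].
    by apply/setP => i; rewrite !inE -lab0P; lia.
  by rewrite cards1.
have -> : [set i : idx n | `|lab i| <= m.+1%:Z] =
    pos n m.+1 |: (pos n (- m.+1%:Z) |: [set i | `|lab i| <= m%:Z]).
  by apply/setP => i; rewrite !in_setU1 !inE -!(inj_eq (@lab_inj n)) !pos_K; lia.
rewrite !cardsU1 !in_setU1 !inE pos_eq ?pos_K ?IH; try lia.
Qed.

Lemma sign_interval c k : clan_reversal c = c -> (k <= n)%N ->
  wopp (clan_inv c) = yBC n k -> forall i, is_sign (c i) = (`|lab i| <= k%:Z).
Proof.
move=> cr kn E i; have cI := clan_involW cr.
rewrite is_signE -(inj_eq (@lab_inj n)) -ev_lab -(woppK cI) E ev_wopp ?lab_bound //.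
by rewrite ev_yBC //; case: ifP; lia.
Qed.

(** Let 0, ..., m be the longest initial run of fixed points. Beyond it y has only descents, and it
    falls below -m at once because the values in [-m, m] are taken. As it is bounded below by -n, it
    must fall by exactly one each time, so y j = -j for j > m. *)
Lemma fixed_maximal (y : {perm idx n}) : involW y ->
  (forall s, asc s y -> ev y s = s /\ ev y s.+1 = s.+1) ->
  exists2 m, (m <= n)%N & wopp y = yBC n m.
Proof.
move=> yI h; have /involWP[yW yK] := yI; have y0 := ev0 yW.
have yN e : ev y (- e) = - ev y e by apply: evN.
pose P m := (m <= n)%N && all (fun j : nat => ev y j == j) (iota 0 m.+1).
have P0 : exists m, P m by exists 0%N; rewrite /P /= y0 eqxx.
have Pb m : P m -> (m <= n)%N by case/andP.
case: (ex_maxnP P0 Pb) => m /andP[mn /allP mfix] mmax.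
have fixm (j : nat) : (j <= m)%N -> ev y j = j.
  by move=> jm; apply/eqP; apply: mfix; rewrite mem_iota; lia.
have dn (j : nat) : (m < j <= n)%N -> ev y j <= - j%:Z.
  elim: j => [|j IH] /andP[mj jn]; first by [].
  have lt : (ev y j = j /\ ev y j.+1 = j.+1) \/ ev y j.+1 < ev y j.
    have [aj|] := boolP (asc (Ordinal jn) y); first by left; apply: h aj.
    rewrite /asc /= -leNgt le_eqVlt => /orP[/eqP/ev_inj|]; last by right.
    by lia.
  have [Ej|lj] := eqVneq j m.
    subst j; have ne : ev y m.+1 <> m.+1.
      move=> E; have : P m.+1.
        rewrite /P jn andTb; apply/allP => j; rewrite mem_iota => /andP[j1 jm].
        have [E2|ne] := eqVneq j m.+1; first by rewrite E2 E.
        by apply/eqP; apply: fixm; lia.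
      by move/mmax; rewrite ltnn.
    have ym := fixm m (leqnn _).
    have {}lt : ev y m.+1 < m%:Z by case: lt => [[_ /ne]//|]; rewrite ym.
    suff : ~ (`|ev y m.+1| <= m%:Z) by lia.
    move=> hb; have fv x : `|x| <= m%:Z -> ev y x = x.
      move=> hx; have [E|E] : x = (absz x)%:Z \/ x = - (absz x)%:Z by lia.
        by rewrite E fixm; lia.
      by rewrite E yN fixm; lia.
    by have := fv _ hb; rewrite yK; lia.
  have jn' : (m < j <= n)%N by lia.
  by have := IH jn'; case: lt => [[-> _]|]; lia.
have up (d : nat) : (d < n - m)%N -> - (n - d)%N%:Z <= ev y (n - d)%N.
  elim: d => [|d IH] hd.
    have : `|ev y (n - 0)%N| <= n%:Z by rewrite ev_bound; lia.
    by lia.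
  have jn : (n - d.+1 < n)%N by lia.
  have E : (n - d.+1).+1 = (n - d)%N by lia.
  have := IH (ltnW hd).
  have lt : ev y (n - d)%N < ev y (n - d.+1)%N.
    have dj : ev y (n - d.+1)%N <= - (n - d.+1)%N%:Z by apply: dn; lia.
    have [aj|] := boolP (asc (Ordinal jn) y).
      by have [/= e1 _] := h _ aj; move: dj; rewrite e1; lia.
    rewrite /asc /= E -leNgt le_eqVlt => /orP[/eqP/ev_inj|//].
    by lia.
  by lia.
exists m => //; apply: ev_eq => x hx; rewrite ev_wopp // ev_yBC //.
have val (j : nat) : (m < j <= n)%N -> ev y j = - j%:Z.
  move=> hj; have := dn j hj; have := up (n - j)%N.
  by rewrite subKn; lia.
have [E|E] : x = (absz x)%:Z \/ x = - (absz x)%:Z by lia.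
  case: ifP => hm; rewrite E; first by rewrite fixm //; lia.
  by rewrite val ?opprK //; lia.
case: ifP => hm; rewrite E yN; first by rewrite fixm //; lia.
by rewrite val ?opprK //; lia.
Qed.

Lemma symclan_sum p q c : symclan p q c -> \sum_i sval (c i) = p.*2%:Z - q.*2.+1%:Z.
Proof. by case=> _ _ <-; rewrite sval_sum. Qed.

Lemma sum_signs c k (f : symbol n -> int) : (k <= n)%N ->
  (forall i, is_sign (c i) = (`|lab i| <= k%:Z)) -> (forall i, f (inr i) = 0) ->
  \sum_i f (c i) = \sum_(i in [set i : idx n | `|lab i| <= k%:Z]) f (c i).
Proof.
move=> kn sE f0; rewrite [RHS]big_mkcond; apply: eq_bigr => i _.
by rewrite inE -sE; case: (c i).
Qed.

(** Neighbouring signs are equal, hence all 2m + 1 signs are, and their sum 2p - 2q - 1 determines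
    m. *)
Lemma maximal_clan p q c : symclan p q c ->
  (forall s, asc s (clan_inv c) -> ~~ allowed s c) ->
  exists m, [/\ (m <= n)%N, wopp (clan_inv c) = yBC n m,
    forall i, `|lab i| <= m%:Z -> c i = c (pos n 0) &
    (m.*2.+1)%:Z = `|p.*2%:Z - q.*2.+1%:Z| ].
Proof.
move=> cS h; have [cr _ _] := cS; have cI := clan_involW cr.
have hb s : asc s (clan_inv c) -> both_signs s c /\ c (pos n s) = c (pos n s.+1).
  by move/h; rewrite /allowed negb_imply negbK => /andP[-> /eqP].
have [|m mn E] := fixed_maximal cI.
  by move=> s /hb [/andP[/eqP ? /eqP ?] _].
have sE := sign_interval cr mn E.
have cst (j : nat) : (j <= m)%N -> c (pos n j) = c (pos n 0).
  elim: j => [//|j IH] jm; have jn : (j < n)%N by lia.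
  rewrite -(IH (ltnW jm)); apply/esym.
  have sg x : `|x| <= m%:Z -> ev (clan_inv c) x = x.
    by move=> hx; apply/eqP; rewrite -sign_pos ?sE ?pos_K //; lia.
  by have [] := hb (Ordinal jn) _; rewrite // /asc /= !sg; lia.
have cst' i : `|lab i| <= m%:Z -> c i = c (pos n 0).
  move=> hi; have [Ei|Ei] : lab i = (absz (lab i))%:Z \/ lab i = - (absz (lab i))%:Z by lia.
    by rewrite -(pos_lab i) Ei cst //; lia.
  rewrite -(pos_lab i) Ei rev_symbol //; try lia.
    by rewrite cst //; lia.
  by rewrite sE pos_K; lia.
exists m; split=> //; rewrite -(symclan_sum cS) (sum_signs mn sE) //.
rewrite (eq_bigr (fun=> sval (c (pos n 0)))); last by move=> i; rewrite inE => /cst' ->.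
rewrite sumr_const card_interval //.
by have := sign0 cr; case: (c (pos n 0)) => [[]|//] _ /=; lia.
Qed.

(** The prescribed sum of the 2m + 1 signs is extremal, since it is attained by equal signs; this
    forces equality for [c] too. *)
Lemma maximal_clan_unique p q c c' m : symclan p q c -> symclan p q c' -> (m <= n)%N ->
  wopp (clan_inv c) = yBC n m -> wopp (clan_inv c') = yBC n m ->
  (forall i, `|lab i| <= m%:Z -> c' i = c' (pos n 0)) -> c = c'.
Proof.
move=> cS cS' mn E E' cst; have [cr _ _] := cS; have [cr' _ _] := cS'.
have cI := clan_involW cr; have cI' := clan_involW cr'.
have sE := sign_interval cr mn E; have sE' := sign_interval cr' mn E'.
apply: clan_ext => [|i ic]; first by rewrite -(woppK cI) -(woppK cI') E E'.
have hi : `|lab i| <= m%:Z by rewrite -sE is_signE ic.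
have := symclan_sum cS; rewrite -(symclan_sum cS') !(sum_signs mn) // => /eqP.
rewrite -subr_eq0 -sumrB => /eqP S0.
pose v := sval (c' (pos n 0)).
have v1 : v = 1 \/ v = -1.
  by have := sign0 cr'; rewrite /v; case: (c' (pos n 0)) => [[]|//] _; [left|right].
have svE j : sval (c j) = 1 \/ sval (c j) = -1 \/ sval (c j) = 0.
  by case: (c j) => [[]|j'] /=; tauto.
have iA : i \in [set i : idx n | `|lab i| <= m%:Z] by rewrite inE.
have Z : forall j, j \in [set i : idx n | `|lab i| <= m%:Z] -> sval (c j) = v.
  case: v1 => v1.
    have /psumr_eq0P : \sum_(j in [set i : idx n | `|lab i| <= m%:Z]) (v - sval (c j)) = 0.
      transitivity (- (\sum_(j in [set i : idx n | `|lab i| <= m%:Z])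
        (sval (c j) - sval (c' j)))); last by rewrite S0 oppr0.
      rewrite -sumrN; apply: eq_bigr => j.
      by rewrite inE opprB /v => /cst ->.
    by move=> Z j jA; have := Z (fun j _ => ltac:(have := svE j; lia)) j jA; lia.
  have /psumr_eq0P : \sum_(j in [set i : idx n | `|lab i| <= m%:Z]) (sval (c j) - v) = 0.
    by rewrite -[RHS]S0; apply: eq_bigr => j; rewrite inE /v => /cst ->.
  by move=> Z j jA; have := Z (fun j _ => ltac:(have := svE j; lia)) j jA; lia.
have := Z i iA; rewrite /v -(cst i hi) /sgn.
have : is_sign (c i) by rewrite sE.
have : is_sign (c' i) by rewrite sE'.
by case: (c i) => [[]|//] _; case: (c' i) => [[]|//].
Qed.

(** Halving the first hypothesis gives |p - q - 1/2| = m + 1/2. *)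
Lemma floor_half (p q k m : nat) :
  (m.*2.+1)%:Z = `|p.*2%:Z - q.*2.+1%:Z| ->
  k%:Z = Num.floor (`|p%:R - q%:R - 2%:R^-1| : rat) -> k = m.
Proof.
move=> hm hk; suff E : Num.floor (`|p%:R - q%:R - 2%:R^-1| : rat) = m%:Z.
  by move: hk; rewrite E => -[].
apply: floor_def; have mE : `|p%:R - q%:R - 2%:R^-1| = m%:R + 2%:R^-1 :> rat.
  have [h|h] : (p = m + q + 1)%N \/ (q = p + m)%N by lia.
    by rewrite h !natrD ger0_norm; have : (0 : rat) <= m%:R by []; lra.
  by rewrite h !natrD ler0_norm; have : (0 : rat) <= m%:R by []; lra.
by rewrite mE intrD -[m%:Z%:~R]/(m%:R); lra.
Qed.

End MaximalClan.

(** * Alternating clans *)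

Section Alternating.
Variable n : nat.
Implicit Types (c : clan n) (i j l : idx n) (s : 'I_n).

Definition signs_between c i j := exists2 l : idx n, (i < l < j)%N & is_sign (c l).

(** A positional form of alternation, better suited to moving and removing signs than the sequence
    of signs. *)
Definition alt_signs c := forall i j, is_sign (c i) -> is_sign (c j) -> (i < j)%N ->
  ~ signs_between c i j -> c i <> c j.

Lemma alternating_alt c : alternating c -> alt_signs c.
Proof.
rewrite /alternating signsE sorted_map => al i j si sj ij nb E.
set L := [seq _ <- _ | _] in al.
have Ls : sorted (@ord_lt n) L.
  apply: sorted_filter; first exact: ord_lt_trans.
  by rewrite -sorted_map val_enum_ord iota_ltn_sorted.
have memL l : (l \in L) = is_sign (c l) by rewrite mem_filter mem_enum andbT is_signE.
have iL : i \in L by rewrite memL.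
have jL : j \in L by rewrite memL.
case/splitPr: iL Ls jL al memL => A R Ls jL al memL.
move: Ls; rewrite (sorted_pairwise (@ord_lt_trans n)) pairwise_cat allrel_consr.
case/and3P => /andP[/allP Ai _] _ /=; case/andP => iR Rs.
have jR : j \in R.
  move: jL; rewrite mem_cat inE => /or3P[/Ai|/eqP Ej|//].
    by rewrite /ord_lt /= => ji; have := ltn_trans ij ji; rewrite ltnn.
  by move: ij; rewrite Ej ltnn.
case: R iR Rs jR al memL {jL} => [//|r R] /= /andP[ir _] /andP[rR _] jR al memL.
have rj : r = j.
  move: jR; rewrite inE => /orP[/eqP->//|/(allP rR) rj].
  case: nb; exists r; first by apply/andP; split; [exact: ir|exact: rj].
  by rewrite -memL mem_cat !inE eqxx !orbT.
case/cat_sorted2: al => _ /= /andP[/eqP ne _]; case: ne.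
by rewrite rj /sgn E.
Qed.

Lemma alt_allowed c s : clan_reversal c = c -> alt_signs c -> allowed s c.
Proof.
move=> cr al; have [h0 h1] := bound_s s; apply/implyP => b; apply/eqP.
have /andP[S0 S1] : is_sign (c (pos n s)) && is_sign (c (pos n s.+1)).
  by rewrite -both_signsE.
apply: al => //; first by rewrite lab_lt !pos_K //; lia.
by case=> l; rewrite !lab_lt !pos_K //; lia.
Qed.

Lemma sign_neq3 (a b d : symbol n) : is_sign a -> is_sign b -> is_sign d ->
  a <> b -> b <> d -> a = d.
Proof. by case: a b d => [[]|?] [[]|?] [[]|?]. Qed.

(** Removing two neighbouring unlike signs keeps the alternation. For s = 0 the signs at -1, 0, 1
    shrink to one sign at 0, which takes the common value of the outer two. *)
Lemma alt_cstep c s : clan_reversal c = c -> asc s (clan_inv c) ->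
  alt_signs c -> alt_signs (cstep s c).
Proof.
move=> cr ca al.
have [b|nb] := boolP (both_signs s c); last first.
  have sg i : is_sign (cstep s c i) = is_sign (c (sgen s i)).
    by rewrite !is_signE cstep_inv // fixed_conj.
  have val i : is_sign (cstep s c i) -> cstep s c i = c (sgen s i).
    move=> iS; have ic := iS; rewrite sg in ic.
    rewrite clanE -is_signE iS [RHS]clanE -is_signE ic sgn_cstep //.
      by rewrite (negPf nb) !andbF addbF.
    by move: iS; rewrite is_signE cstep_inv // => /eqP.
  have mono i j : is_sign (c i) -> is_sign (c j) -> (i < j)%N -> (sgen s i < sgen s j)%N.
    by rewrite !is_signE => hi hj; apply: sgen_mono hi hj.
  have mono' i j : is_sign (c (sgen s i)) -> is_sign (c (sgen s j)) ->
      (i < j)%N -> (sgen s i < sgen s j)%N.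
    move=> hi hj ij; rewrite ltnNge leq_eqVlt.
    apply/negP => /orP[/eqP/val_inj/perm_inj E|/(mono _ _ hj hi)].
      by rewrite E ltnn in ij.
    by rewrite !sgen_sgen => lt; have := ltn_trans lt ij; rewrite ltnn.
  move=> i j iS jS ij nbt; rewrite (val i iS) (val j jS); move: iS jS; rewrite !sg => iS jS.
  apply: al => //; first exact: mono'.
  case=> l /andP[il lj] lS; apply: nbt; exists (sgen s l); last by rewrite sg sgen_sgen.
  by rewrite -(sgen_sgen s i) -(sgen_sgen s j) !mono.
have [h0 h1] := bound_s s.
have /andP[S0 S1] : is_sign (c (pos n s)) && is_sign (c (pos n s.+1)).
  by rewrite -both_signsE.
have N0 : is_sign (c (pos n (- s%:Z))) by rewrite rev_symbol.
have N1 : is_sign (c (pos n (- s.+1%:Z))) by rewrite rev_symbol.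
have adj (x y : int) : `|x| <= n%:Z -> `|y| <= n%:Z -> y = x + 1 ->
    is_sign (c (pos n x)) -> is_sign (c (pos n y)) -> c (pos n x) <> c (pos n y).
  move=> hx hy E sx sy; apply: al => //; first by rewrite lab_lt !pos_K //; lia.
  by case=> l; rewrite !lab_lt !pos_K //; lia.
have A1 := adj s s.+1 h0 h1.
move=> i j; rewrite !cstep_sign // => /andP[iS im] /andP[jS jm] ij nbt.
have ijl : lab i < lab j by rewrite -lab_lt.
have S00 := sign0 cr.
have n1 : `|1 : int| <= n%:Z by clear -h1; lia.
have mv l : (i < l < j)%N -> is_sign (c l) -> moved s l.
  move=> hl lS; case ml: (moved s l) => //; case: nbt; exists l => //.
  by rewrite cstep_sign // lS ml.
have movedE l : moved s l -> lab l = s \/ lab l = s.+1 \/ lab l = - s%:Z \/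
    lab l = - s.+1%:Z by move=> ml; exact: (sig_moved ml).
have unm x : `|x| <= n%:Z -> sig s x != x -> lab i <> x /\ lab j <> x.
  move=> hx sx; split=> E; [move: im|move: jm]; by rewrite /moved E sx.
(* A sign remains at 0, so it separates negative positions from positive ones. *)
have zero : ~ (lab i < 0 /\ 0 < lab j).
  case=> i0 j0; have : moved s (pos n 0).
    by apply: mv => //; rewrite !lab_lt pos_K // i0 j0.
  by rewrite /moved pos_K //; clear; case_sig s (0 : int); lia.
have [s0|sp] := posnP s.
  have [u1 u1'] : lab i <> 1 /\ lab j <> 1 by apply: unm => //; rewrite s0.
  have [u2 u2'] : lab i <> -1 /\ lab j <> -1.
    by apply: unm; rewrite ?normrN // s0.
  have mE l : moved s l -> lab l = 1 \/ lab l = -1.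
    by rewrite /moved s0; clear; case_sig 0%N (lab l); lia.
  have c01 : cstep s c (pos n 0) = c (pos n 1).
    have ne : c (pos n 0) <> c (pos n 1) by move: A1 S0 S1; rewrite s0; apply.
    rewrite cstep_unmoved ?pos_K ?s0 //= eqxx.
    move: ne S00 S1; rewrite s0.
    by case: (c (pos n 0)) => [[]|//]; case: (c (pos n 1)) => [[]|].
  have S1' : is_sign (c (pos n 1)) by move: S1; rewrite s0.
  have [i0|i0] := eqVneq (lab i) 0.
    have lj : 1 < lab j by clear -ijl i0 u1'; lia.
    have -> : i = pos n 0 by rewrite -i0 pos_lab.
    rewrite c01 (cstep_val cr b jm); last by clear -lj; lia.
    apply: al => //; first by rewrite lab_lt pos_K.
    case=> l /andP[l1 l2] lS; rewrite lab_lt pos_K // in l1; rewrite lab_lt in l2.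
    have hl : (i < l < j)%N by rewrite !lab_lt; clear -l1 l2 i0; lia.
    by have := mE l (mv l hl lS); clear -l1; lia.
  have [j0|j0] := eqVneq (lab j) 0.
    have li : lab i < -1 by clear -ijl j0 u2; lia.
    have -> : j = pos n 0 by rewrite -j0 pos_lab.
    rewrite c01 (cstep_val cr b im i0) -(rev_symbol cr n1 S1').
    apply: al; rewrite ?rev_symbol // ?lab_lt ?pos_K ?normrN //.
    case=> l /andP[l1 l2] lS; rewrite lab_lt pos_K ?normrN // in l2; rewrite lab_lt in l1.
    have hl : (i < l < j)%N by rewrite !lab_lt; clear -l1 l2 j0; lia.
    by have := mE l (mv l hl lS); clear -l2; lia.
  rewrite (cstep_val cr b im i0) (cstep_val cr b jm j0); apply: al => // -[l hl lS].
  have := mE l (mv l hl lS); move: hl; rewrite !lab_lt.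
  by clear -i0 j0 u1 u1' u2 u2' zero; lia.
have val l : ~~ moved s l -> cstep s c l = c l.
  move=> /negPn/eqP m; rewrite cstep_unmoved //.
  by have -> : (s == 0%N :> nat) = false by [clear -sp; lia].
rewrite (val i im) (val j jm).
(* When a removed pair lies between i and j, three changes of sign in a row amount to one. *)
have skip (x y : int) : y = x + 1 -> `|x| <= n%:Z -> `|y| <= n%:Z ->
    is_sign (c (pos n x)) -> is_sign (c (pos n y)) -> lab i < x -> y < lab j ->
    (forall l, (i < l < j)%N -> moved s l -> lab l = x \/ lab l = y) -> c i <> c j.
  move=> E hx hy sx sy ix yj only.
  have c1 : c i <> c (pos n x).
    apply: al => //; first by rewrite lab_lt pos_K.
    case=> l /andP[l1 l2] lS; rewrite lab_lt in l1; rewrite lab_lt pos_K // in l2.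
    have hl : (i < l < j)%N by rewrite !lab_lt; clear -l1 l2 E yj; lia.
    by have := only l hl (mv l hl lS); clear -l2 E; lia.
  have c2 : c (pos n y) <> c j.
    apply: al => //; first by rewrite lab_lt pos_K.
    case=> l /andP[l1 l2] lS; rewrite lab_lt pos_K // in l1; rewrite lab_lt in l2.
    have hl : (i < l < j)%N by rewrite !lab_lt; clear -l1 l2 E ix; lia.
    by have := only l hl (mv l hl lS); clear -l1 E; lia.
  by rewrite (sign_neq3 iS sx sy c1 (adj x y hx hy E sx sy)).
have [u1 u1'] : lab i <> s /\ lab j <> s.
  by apply: unm => //; clear -sp; case_sig s s%:Z; lia.
have [u2 u2'] : lab i <> s.+1 /\ lab j <> s.+1.
  by apply: unm => //; clear -sp; case_sig s s.+1%:Z; lia.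
have [u3 u3'] : lab i <> - s%:Z /\ lab j <> - s%:Z.
  by apply: unm; rewrite ?normrN //; clear -sp; case_sig s (- s%:Z); lia.
have [u4 u4'] : lab i <> - s.+1%:Z /\ lab j <> - s.+1%:Z.
  by apply: unm; rewrite ?normrN //; clear -sp; case_sig s (- s.+1%:Z); lia.
have [[E1 E2]|[[E1 E2]|none]] : (lab i < s%:Z /\ s.+1%:Z < lab j) \/
    (lab i < - s.+1%:Z /\ - s%:Z < lab j) \/
    (forall l, (i < l < j)%N -> ~ moved s l).
- have [p|np] := boolP ((lab i < s%:Z) && (s.+1%:Z < lab j)).
    by left; case/andP: p.
  have [p|np'] := boolP ((lab i < - s.+1%:Z) && (- s%:Z < lab j)).
    by right; left; case/andP: p.
  right; right=> l; rewrite !lab_lt => hl /movedE.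
  by clear -hl np np' u1 u1' u2 u2' u3 u3' u4 u4' zero; lia.
- apply: (skip s s.+1) => //; first by clear; lia.
  by move=> l; rewrite !lab_lt => hl /movedE; clear -hl E1 E2 zero; lia.
- apply: (skip (- s.+1%:Z) (- s%:Z)); rewrite ?normrN //; first by clear; lia.
  by move=> l; rewrite !lab_lt => hl /movedE; clear -hl E1 E2 zero; lia.
apply: al => // -[l hl lS]; exact: none hl (mv l hl lS).
Qed.

End Alternating.

(** * Brion atoms *)

Lemma alt_cchain n k (c : clan n) t : (k <= n)%N -> clan_reversal c = c -> alt_signs c ->
  ichain (yBC n k) (wopp (clan_inv c)) t -> cchain c t.
Proof.
move=> kn; elim: t c => [//|s t IH] c cr al /= [z' [zI aa E ch]].
have cI := clan_involW cr.
have Ec : clan_inv c = wopp (dconj s z') by rewrite -E woppK.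
have [_ ca _ Ed] := wopp_dconj zI aa; rewrite -Ec in ca Ed.
split; first exact: alt_allowed.
apply: IH; [exact: cstep_rev|exact: alt_cstep|].
by rewrite cstep_inv // Ed woppK.
Qed.

Local Open Scope classical_set_scope.

Lemma Korbit_flags (R : realType) (n p : nat) (O : set (set 'M[R[i]]_(n.*2.+1))) :
  Korbit p O -> O `<=` @flags R n.
Proof.
case=> X [g [gJ gdet] ->] -> _ [h [[hJ hdet] _] <-]; exists (h *m g).
  split; last by rewrite det_mulmx hdet gdet mulr1.
  rewrite trmx_mul -!mulmxA (mulmxA _ h g) (mulmxA h^T) (mulmxA h^T _ h) hJ.
  by rewrite mulmxA gJ.
apply/seteqP; split=> [_ [_ [b bB <-] <-]|_ [b bB <-]].
  by exists b; rewrite // mulmxA.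
by exists (g *m b); [exists b|rewrite mulmxA].
Qed.

Section BrionPaths.
Variables (R : realType) (n p q k : nat).
Variable dem : {perm (idx n)} -> {perm (idx n)} -> {perm (idx n)}.
Hypothesis dem_ax : is_demazure dem.
Variable orb : clan n -> set (set 'M[R[i]]_(n.*2.+1)).
Hypothesis orb_ix : clan_indexing p q dem orb.
Variable Odense : set (set 'M[R[i]]_(n.*2.+1)).

(** Every flag is in the closure of the dense orbit, so each generator sends this orbit to itself.
    An allowed ascent would also send its clan to [cstep s cd], which is different. *)
Lemma dense_maximal cd : dense_orbit p Odense -> symclan p q cd -> orb cd = Odense ->
  forall s, asc s (clan_inv cd) -> ~~ allowed s cd.
Proof.
case=> OK dense cdS E s a; apply/negP => al; have [cr _ _] := cdS.
have act : clan_act dem s cd cd.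
  apply/(orb_act orb_ix s cdS cdS); rewrite E; split=> //.
    by move=> X OX; split; [exact: (Korbit_flags OK)|exists X].
  by move=> X [/dense].
have := clan_act_fun act (cstep_act dem_ax cr a al).
by move/esym/eqP; rewrite (negPf (cstep_neq cr a)).
Qed.

Variable cd : clan n.
Hypotheses (cdS : symclan p q cd) (cdE : orb cd = Odense) (kn : (k <= n)%N)
  (cdy : wopp (clan_inv cd) = yBC n k)
  (cd_const : forall i, `|lab i| <= k%:Z -> cd i = cd (pos n 0)).

Lemma brion_chain O t d : brion_path p Odense O t d -> forall c, symclan p q c ->
  O = orb c -> [/\ ichain (yBC n k) (wopp (clan_inv c)) t, cchain c t & d = dcount c t].
Proof.
have step s c c' : symclan p q c -> symclan p q c' -> edge p s (orb c) (orb c') ->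
    [/\ asc s (clan_inv c), allowed s c, c' = cstep s c &
      degree_two s (orb c) <-> clan_doubled s c].
  move=> cS cS' [ac ne]; have {}ac := (orb_act orb_ix s cS cS').1 ac.
  have nc : c' <> c by move=> E; apply: ne; rewrite E.
  have [cr _ _] := cS; have [a al E] := clan_actP dem_ax cr ac nc.
  by split=> //; exact: (orb_doubled orb_ix) ac nc.
have next s c t' : symclan p q c -> asc s (clan_inv c) ->
    ichain (yBC n k) (wopp (clan_inv (cstep s c))) t' ->
    ichain (yBC n k) (wopp (clan_inv c)) (s :: t').
  move=> [cr _ _] a ch; have cI := clan_involW cr.
  have [bI ba _ Eb] := wopp_dconj cI a.
  by exists (wopp (dconj s (clan_inv c))); split=> //; rewrite -?cstep_inv.
elim=> [|s O1 O2 t' d' e nd bp IH|s O1 O2 t' d' e nd bp IH] c cS E.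
- have -> : c = cd by apply: (orb_inj orb_ix) => //; rewrite cdE -E.
  by split; rewrite //= cdy.
- have [c' cS' E'] : exists2 c', symclan p q c' & orb c' = O2.
    by apply: (orb_surj orb_ix); case: e => -[].
  rewrite -E' E in e nd; have [a al Ec dbl] := step _ _ _ cS cS' e.
  have [ch cc ->] := IH c' cS' (esym E'); rewrite Ec in ch cc *.
  split=> //; first exact: next.
  by rewrite /=; case: (boolP (clan_doubled s c)) => // /dbl /nd.
- have [c' cS' E'] : exists2 c', symclan p q c' & orb c' = O2.
    by apply: (orb_surj orb_ix); case: e => -[].
  rewrite -E' E in e nd; have [a al Ec dbl] := step _ _ _ cS cS' e.
  have [ch cc ->] := IH c' cS' (esym E'); rewrite Ec in ch cc *.
  split=> //; first exact: next.
  by rewrite /=; have -> := dbl.1 nd.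
Qed.

(** The chain ends at some symmetric clan over y_k, which the count of signs identifies with the
    dense one. *)
Lemma chain_brion t c : symclan p q c -> ichain (yBC n k) (wopp (clan_inv c)) t ->
  cchain c t -> brion_path p Odense (orb c) t (dcount c t).
Proof.
elim: t c => [|s t IH] c cS; have [cr _ _] := cS; have cI := clan_involW cr.
  move=> /= E _; rewrite (maximal_clan_unique cS cdS kn E cdy cd_const) cdE.
  exact: brion_nil.
move=> [z' [zI aa E ch]] [al cc].
have Ec : clan_inv c = wopp (dconj s z') by rewrite -E woppK.
have [_ ca _ Ed] := wopp_dconj zI aa; rewrite -Ec in ca Ed.
have E1 : wopp (clan_inv (cstep s c)) = z' by rewrite cstep_inv // Ed woppK.
have cS1 := symclan_cstep cS ca al; rewrite -E1 in ch.
have bp := IH _ cS1 ch cc.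
have act := cstep_act dem_ax cr ca al.
have ne : cstep s c <> c by apply/eqP; apply: cstep_neq.
have e : edge p s (orb c) (orb (cstep s c)).
  split; first by apply/(orb_act orb_ix s cS cS1).
  by move=> /(orb_inj orb_ix cS1 cS).
have dbl := orb_doubled orb_ix cS cS1 act ne.
rewrite /=; case: (boolP (clan_doubled s c)) => h.
  by apply: brion_double e _ bp; apply/dbl.
by apply: brion_single e _ bp => /dbl; rewrite (negPf h).
Qed.

End BrionPaths.

Theorem theorem8p7 (R : realType) (p q n : nat)
  (n_def : n = (p + q)%N) (n_ge1 : (1 <= n)%N)
  (dem : {perm (idx n)} -> {perm (idx n)} -> {perm (idx n)})
  (dem_demazure : is_demazure dem)
  (orb : clan n -> set (set 'M[R[i]]_(n.*2.+1)))
  (orb_indexing : clan_indexing p q dem orb)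
  (Odense : set (set 'M[R[i]]_(n.*2.+1)))
  (Odense_dense : dense_orbit p Odense)
  (c : clan n) (c_sym : symclan p q c)
  (k : nat)
  (k_def : k%:Z = Num.floor (`|p%:R - q%:R - 2%:R^-1| : rat))
  (z : {perm (idx n)}) (z_def : z = wopp (clan_inv c)) :
  [/\ forall w, brion_atoms p Odense (orb c) w ->
        forall d, brion_degree p Odense (orb c) w d <->
          d = (#|[set i : idx n | ((0 < lab (z i)) && (lab (z i) < lab i))%R]%SET|
               + ell0 w)%N,
      brion_atoms p Odense (orb c) =
        \bigcup_(M in [set M | NCSP k c M])
          [set w | w \in atoms_shape dem k z M],
      trivIset [set M | NCSP k c M]
        (fun M => [set w | w \in atoms_shape dem k z M]),
      brion_atoms p Odense (orb c) `<=` [set w | w \in atoms dem (yBC n k) z] &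
      (p = q \/ p = q.+1) -> alternating c ->
        brion_atoms p Odense (orb c) = [set w | w \in atoms dem 1%g z]].
Proof.
have [cr _ _] := c_sym.
have [cd cdS cdE] := orb_surj orb_indexing Odense_dense.1.
have [m [mn cdy cst hm]] := maximal_clan cdS (dense_maximal dem_demazure orb_indexing
  Odense_dense cdS cdE).
have km := floor_half hm k_def; subst m.
have yI := yBC_involW mn.
have to_chain t d : brion_path p Odense (orb c) t d ->
    [/\ ichain (yBC n k) z t, cchain c t & d = dcount c t].
  move=> bp; rewrite z_def.
  exact: (brion_chain dem_demazure orb_indexing cdS cdE cdy bp c_sym erefl).
have from_chain t : ichain (yBC n k) z t -> cchain c t ->
    brion_path p Odense (orb c) t (dcount c t).
  by rewrite z_def; apply: (chain_brion dem_demazure orb_indexing cdS cdE mn cdy cst).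
have deg t : ichain (yBC n k) z t -> cchain c t ->
    dcount c t = (posdesc z + ell0 (wprod t))%N.
  by rewrite z_def; apply: (dcountE dem_demazure mn cr).
have atomE w : w \in atoms dem (yBC n k) z <-> exists2 t, ichain (yBC n k) z t & wprod t = w.
  exact: atomsP.
have shape_chain t : ichain (yBC n k) z t ->
    (NCSP k c (shapek k (wprod t)^-1%g) <-> cchain c t).
  have [D [x [r E]]] := shape_red (wmul (wprod t)^-1%g (gBC n k)).
  by rewrite /shapek E z_def => ch; apply: NCSP_cchain mn cr ch r.
have sub : brion_atoms p Odense (orb c) `<=` [set w | w \in atoms dem (yBC n k) z].
  by move=> w [t [d [/to_chain[ch _ _] Ew]]]; apply/atomE; exists t.
split=> //.
- move=> w [t [d [/to_chain[ch cc _] Ew]]] d'; split.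
    by case=> t' /to_chain[ch' cc' ->] <-; apply: deg.
  by move=> ->; exists t => //; rewrite -Ew -[X in brion_path _ _ _ _ X](deg t ch cc); apply: from_chain.
- apply/seteqP; split=> w.
    move=> [t [d [/to_chain[ch cc _] Ew]]]; exists (shapek k w^-1%g).
      by rewrite -Ew; apply/shape_chain.
    by rewrite /= inE eqxx andbT; apply/atomE; exists t.
  case=> M nM; rewrite /= inE => /andP[/atomE[t ch Ew] /eqP EM].
  exists t, (dcount c t); split=> //; apply: from_chain => //.
  by apply/shape_chain => //; rewrite Ew EM.
- move=> M M' _ _ [w [/=]]; rewrite !inE => /andP[_ /eqP <-] /andP[_ /eqP <-] //.
(* Here |2p - 2q - 1| = 1, so k = 0 and y_k is the identity; alternation then makes every chain
   lift. *)
- move=> pq alt; have k0 : k = 0%N by move: hm; case: pq => ->; lia.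
  have y1 : yBC n k = 1%g by rewrite /yBC k0 big_ord0.
  rewrite -y1; apply/seteqP; split=> // w /atomE[t ch Ew].
  exists t, (dcount c t); split=> //; apply: from_chain => //.
  by move: ch; rewrite z_def; apply: alt_cchain => //; apply: alternating_alt.
Qed.
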